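(* Let $1\le m\le n$ be integers, let $A_m,\dots,A_n$ be real constants with $A_m^2+\cdots+A_n^2\neq 0$, and let $Y=\sum_{p=m}^nA_pV_p$ be the corresponding linear combination of eigenfunctions of the Sturm-Liouville eigenvalue problem described in the context. Then $$N_v(Y,(\alpha,\beta))\le N_m(Y,(\alpha,\beta))\le \overline{N}_m(Y,[\alpha,\beta]),$$ and $$m-1\le N_v(Y,(\alpha,\beta))\quad\text{and}\quad \overline{N}_m(Y,[\alpha,\beta])\le n-1.$$
   Context: Let $[\alpha,\beta]\subset(\alpha_0,\beta_0)$ with $\alpha<\beta$, let $K,G,L\in C^\infty((\alpha_0,\beta_0))$ be real-valued with $K,G,L>0$ on $(\alpha_0,\beta_0)$, and let $h,H\in[0,\infty]$. The eigenvalue problem, with spectral parameter $r$, is $$\frac{d}{dx}\Big(K\frac{dV}{dx}\Big)+(rG-L)V=0,\qquad \Big(K\frac{dV}{dx}-hV\Big)(\alpha)=0,\qquad \Big(K\frac{dV}{dx}+HV\Big)(\beta)=0,$$ where $h=\infty$ (resp. $H=\infty$) means the Dirichlet condition $V(\alpha)=0$ (resp. $V(\beta)=0$). It is known (Sturm) that this problem has an increasing infinite sequence $0<\rho_1<\rho_2<\cdots$ of simple eigenvalues tending to infinity; $V_j$ denotes a real eigenfunction associated with $\rho_j$, extended as a solution of the differential equation (with $r=\rho_j$) to $(\alpha_0,\beta_0)$, so $V_j\in C^\infty((\alpha_0,\beta_0))$; $V_j$ vanishes, and changes sign, exactly $j-1$ times in $(\alpha,\beta)$. Let $U$ be a non-trivial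 linear combination of the $V_j$'s. It is a fact that $U$ does not vanish to infinite order at any point of $[\alpha,\beta]$, hence has finitely many zeros there. For $\xi\in[\alpha,\beta]$ the multiplicity is $m(U,\xi)=\min\{p\ge 0: \frac{d^pU}{dx^p}(\xi)\neq0\}$. If $h\in[0,\infty)$ the multiplicity $m(U,\alpha)$ is even (possibly $0$), and if $H\in[0,\infty)$ the multiplicity $m(U,\beta)$ is even. The reduced multiplicity at $\alpha$ is $\overline{m}(U,\alpha)=\frac12 m(U,\alpha)$ if $h\in[0,\infty)$ and $\overline{m}(U,\alpha)=0$ if $h=\infty$; similarly $\overline{m}(U,\beta)=\frac12m(U,\beta)$ if $H\in[0,\infty)$ and $0$ if $H=\infty$. Let $\xi_1<\cdots<\xi_q$ be the distinct zeros of $U$ in $(\alpha,\beta)$. Define $N_m(U,(\alpha,\beta))=\sum_{j=1}^q m(U,\xi_j)$ (zeros counted with multiplicities), $\overline{N}_m(U,[\alpha,\beta])=\sum_{j=1}^q m(U,\xi_j)+\overline{m}(U,\alpha)+\overline{m}(U,\beta)$, $N_v(U,(\alpha,\beta))=\sum_{j=1}^q\frac12\big[1-(-1)^{m(U,\xi_j)}\big]$ (number of sign changes). *)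

(* Defs.v *)
From Stdlib Require Import Reals List Sorting.Sorted.
From Coquelicot Require Import Coquelicot.
Open Scope R_scope.

(* The end points of the open interval may be infinite. *)
Definition in_open (a0 b0 : Rbar) (x : R) : Prop :=
  Rbar_lt a0 x /\ Rbar_lt x b0.

Definition smooth_on (a0 b0 : Rbar) (f : R -> R) : Prop :=
  forall (k : nat) (x : R), in_open a0 b0 x -> ex_derive_n f k x.

Definition positive_on (a0 b0 : Rbar) (f : R -> R) : Prop :=
  forall x : R, in_open a0 b0 x -> 0 < f x.

Definition SL_equation (a0 b0 : Rbar) (K G L : R -> R) (r : R) (V : R -> R) : Prop :=
  forall x : R, in_open a0 b0 x ->
    ex_derive V x /\
    ex_derive (fun t => K t * Derive V t) x /\
    Derive (fun t => K t * Derive V t) x + (r * G x - L x) * V x = 0.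

(* [p_infty] encodes the Dirichlet condition; [m_infty] is not a legal value. *)
Definition left_bc (alpha : R) (K : R -> R) (h : Rbar) (V : R -> R) : Prop :=
  match h with
  | Finite c => K alpha * Derive V alpha - c * V alpha = 0
  | p_infty => V alpha = 0
  | m_infty => False
  end.

Definition right_bc (beta : R) (K : R -> R) (H : Rbar) (V : R -> R) : Prop :=
  match H with
  | Finite c => K beta * Derive V beta + c * V beta = 0
  | p_infty => V beta = 0
  | m_infty => False
  end.

(* Eigenfunctions are identified with their extensions to (a0, b0) as solutions
   of the differential equation. *)
Definition eigenfunction (a0 b0 : Rbar) (alpha beta : R) (K G L : R -> R)
    (h H : Rbar) (r : R) (V : R -> R) : Prop :=
  SL_equation a0 b0 K G L r V /\
  left_bc alpha K h V /\
  right_bc beta K H V /\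
  exists x : R, alpha <= x <= beta /\ V x <> 0.

Definition eigenvalue (a0 b0 : Rbar) (alpha beta : R) (K G L : R -> R)
    (h H : Rbar) (r : R) : Prop :=
  exists V : R -> R, eigenfunction a0 b0 alpha beta K G L h H r V.

(* Indices start at 1; the value [rho 0] is irrelevant. *)
Definition eigenvalue_sequence (a0 b0 : Rbar) (alpha beta : R) (K G L : R -> R)
    (h H : Rbar) (rho : nat -> R) : Prop :=
  (forall i j : nat, (1 <= i)%nat -> (i < j)%nat -> rho i < rho j) /\
  (forall r : R, eigenvalue a0 b0 alpha beta K G L h H r <->
     exists j : nat, (1 <= j)%nat /\ r = rho j).

Definition has_multiplicity (U : R -> R) (xi : R) (p : nat) : Prop :=
  Derive_n U p xi <> 0 /\ forall k : nat, (k < p)%nat -> Derive_n U k xi = 0.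

(* [zs] is the increasing list xi_1 < ... < xi_q of all zeros in (alpha, beta);
   in particular there are finitely many. *)
Definition zeros_between (alpha beta : R) (U : R -> R) (zs : list R) : Prop :=
  StronglySorted Rlt zs /\
  forall x : R, In x zs <-> (alpha < x < beta /\ U x = 0).

Definition sum_over (zs : list R) (f : R -> R) : R :=
  fold_right Rplus 0 (map f zs).

(* In the next definitions [mu x] stands for the multiplicity m(U, x). The
   multiplicities are cast to R, so that halving is exact. *)
Definition reduced_mult (h : Rbar) (p : nat) : R :=
  match h with
  | Finite _ => INR p / 2
  | _ => 0
  end.

Definition N_m (zs : list R) (mu : R -> nat) : R :=
  sum_over zs (fun x => INR (mu x)).

Definition N_m_bar (alpha beta : R) (h H : Rbar) (zs : list R) (mu : R -> nat) : R :=
  N_m zs mu + reduced_mult h (mu alpha) + reduced_mult H (mu beta).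

Definition N_v (zs : list R) (mu : R -> nat) : R :=
  sum_over zs (fun x => / 2 * (1 - (-1) ^ mu x)).

(* Main.v *)
Require Import Defs.
From Stdlib Require Import Reals Ranalysis5 List Lra Lia Psatz Sorting.Sorted.
From Stdlib Require Import ClassicalEpsilon FunctionalExtensionality.
From Coquelicot Require Import Coquelicot.
Open Scope R_scope.

(** The proof has three ingredients.

    Shooting. A solution [u] of the equation and its flux [p = K u'] form a plane vector whose
    angle can cross a multiple of [PI] only upwards, and does so exactly at the zeros of [u]
    ([angle_counts_zeros]). For the solutions that satisfy the left boundary condition, the
    final angle is a continuous function of the spectral parameter and is below [PI / 2] for
    nonpositive parameters. Whenever it equals [gam + i * PI], where [gam] is the direction
    prescribed at the right end, the parameter is an eigenvalue. Since [rho] enumerates all the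
    eigenvalues, the intermediate value theorem bounds the final angle of the [n]-th
    eigenfunction by [n * PI] ([eigenfunction_angle]).

    Sturm's step. Let the operator act on the span of the eigenfunctions by multiplying [V p]
    by [rho p - rho 1]. Its value at [U] is, up to nonzero factors, the derivative of the
    Wronskian of [U] and [V 1], which is itself up to nonzero factors the derivative of
    [U / V 1] and vanishes at both ends. By Rolle's theorem used twice, the operator does not
    decrease the reduced number of zeros ([sturm_step]). Its iterates make a combination with
    top index [n] nearly proportional to [V n] ([shifted_near_last]), and such a function has
    the same angles as [V n] at the ends, hence fewer than [n] zeros: this is the upper bound
    [comb_zeros_lt].

    Orthogonality. If [Y], a combination of [V m, ..., V n], had [s < m - 1] sign changes, a
    nonzero combination [W] of [V 1, ..., V (s + 1)] would vanish at these [s] points; by the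
    upper bound it has no other zeros and these are simple, so [G * W * Y] would be of constant
    sign although its integral is zero ([sign_changes_ge]). *)

(** * Monotonicity and mean values *)

Lemma Derive_pos_right (f : R -> R) (x : R) :
  ex_derive f x -> 0 < Derive f x ->
  exists d, 0 < d /\ forall t, x < t < x + d -> f x < f t.
Proof.
  intros Hf Hp. apply Derive_correct in Hf. apply is_derive_Reals in Hf.
  destruct (Hf _ Hp) as [d Hd].
  exists d. split; [apply cond_pos|]. intros t Ht.
  specialize (Hd (t - x)).
  assert (Hne : t - x <> 0) by lra.
  assert (Hlt : Rabs (t - x) < d) by (rewrite Rabs_pos_eq; lra).
  specialize (Hd Hne Hlt). replace (x + (t - x)) with t in Hd by ring.
  apply Rabs_def2 in Hd.
  assert (0 < (f t - f x) / (t - x)) by lra.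
  assert (0 < (f t - f x) / (t - x) * (t - x)) by (apply Rmult_lt_0_compat; lra).
  replace ((f t - f x) / (t - x) * (t - x)) with (f t - f x) in H0 by (field; lra). lra.
Qed.

Lemma Derive_pos_left (f : R -> R) (x : R) :
  ex_derive f x -> 0 < Derive f x ->
  exists d, 0 < d /\ forall t, x - d < t < x -> f t < f x.
Proof.
  intros Hf Hp.
  destruct (Derive_pos_right (fun t => - f (- t)) (- x)) as [d [Hd H]].
  - auto_derive. rewrite Ropp_involutive. auto.
  - replace (Derive (fun t => - f (- t)) (- x)) with (Derive f x); auto.
    symmetry. apply is_derive_unique. auto_derive.
    + rewrite Ropp_involutive. auto.
    + rewrite Ropp_involutive. rewrite (Derive_ext (fun x0 => f x0) f) by auto. ring.
  - exists d. split; auto. intros t Ht. specialize (H (- t)).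
    rewrite !Ropp_involutive in H. assert (- x < - t < - x + d) by lra. specialize (H H0). lra.
Qed.

Lemma MVT_interval (f df : R -> R) (a b : R) :
  a < b -> (forall x, a <= x <= b -> is_derive f x (df x)) ->
  exists c, a <= c <= b /\ f b - f a = df c * (b - a).
Proof.
  intros Hab Hf.
  destruct (MVT_gen f a b df) as [c [Hc He]].
  - intros x Hx. apply Hf. rewrite Rmin_left, Rmax_right in Hx by lra. lra.
  - intros x Hx. rewrite Rmin_left, Rmax_right in Hx by lra.
    apply continuity_pt_filterlim. apply @ex_derive_continuous.
    exists (df x). apply Hf. lra.
  - exists c. rewrite Rmin_left, Rmax_right in Hc by lra. auto.
Qed.

Lemma derive_nonneg_incr (f df : R -> R) (a b : R) :
  a <= b -> (forall x, a <= x <= b -> is_derive f x (df x)) ->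
  (forall x, a <= x <= b -> 0 <= df x) -> f a <= f b.
Proof.
  intros Hab Hf Hp. destruct (Req_dec a b) as [<-|Hn]; [lra|].
  destruct (MVT_interval f df a b) as [c [Hc He]]; [lra|auto|].
  assert (0 <= df c * (b - a)) by (apply Rmult_le_pos; [auto|lra]). lra.
Qed.

Lemma derive_zero_const (f : R -> R) (a b : R) :
  a <= b -> (forall x, a <= x <= b -> is_derive f x 0) -> f b = f a.
Proof.
  intros Hab Hf. destruct (Req_dec a b) as [<-|Hn]; [auto|].
  destruct (MVT_interval f (fun _ => 0) a b) as [c [Hc He]]; [lra|auto|]. lra.
Qed.

Lemma Rolle_interval (f df : R -> R) (a b : R) :
  a < b -> (forall x, a <= x <= b -> is_derive f x (df x)) -> f a = f b ->
  exists c, a < c < b /\ df c = 0.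
Proof.
  intros Hab Hf He.
  assert (pr : forall x, a < x < b -> derivable_pt f x).
  { intros x Hx. exists (df x). apply is_derive_Reals. apply Hf. lra. }
  destruct (Rolle f a b pr) as [c [P Hc]]; auto.
  - intros x Hx. apply continuity_pt_filterlim. apply @ex_derive_continuous.
    exists (df x). auto.
  - exists c. split; auto. rewrite <- Hc. symmetry.
    apply derive_pt_eq_0. apply is_derive_Reals. apply Hf. lra.
Qed.

Lemma continuous_bounded (f : R -> R) (a b : R) :
  a <= b -> (forall x, a <= x <= b -> continuous f x) ->
  exists M, 0 < M /\ forall x, a <= x <= b -> Rabs (f x) <= M.
Proof.
  intros Hab Hf.
  destruct (continuity_ab_maj (fun x => Rabs (f x)) a b) as [m [Hm _]]; auto.
  - intros x Hx. apply continuity_pt_filterlim.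
    apply (continuous_comp f Rabs); [auto|apply continuous_Rabs].
  - exists (Rabs (f m) + 1). split; [pose proof (Rabs_pos (f m)); lra|].
    intros x Hx. specialize (Hm x Hx). simpl in Hm. lra.
Qed.

(** * Smooth functions and orders of vanishing *)

Section OpenInterval.
Context {a0 b0 : Rbar}.
Local Notation I := (in_open a0 b0).

Lemma in_open_locally (x : R) : I x -> locally x I.
Proof.
  intros [H1 H2]. apply (locally_interval _ x a0 b0); auto.
  intros y; split; auto.
Qed.

Lemma in_open_between (x y t : R) : I x -> I y -> x <= t <= y -> I t.
Proof.
  intros [H1 H2] [H3 H4] [H5 H6]. split.
  - apply Rbar_lt_le_trans with x; auto.
  - apply Rbar_le_lt_trans with y; auto.
Qed.

Lemma in_open_margin (x : R) : I x -> exists d, 0 < d /\ I (x - d) /\ I (x + d).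
Proof.
  intros Hx. destruct (in_open_locally x Hx) as [d Hd].
  exists (d / 2). pose proof (cond_pos d). split; [lra|].
  split; apply Hd; unfold ball; simpl; unfold AbsRing_ball, abs, minus, plus, opp; simpl.
  - replace (x - d / 2 + - x) with (- (d / 2)) by ring. rewrite Rabs_Ropp, Rabs_pos_eq; lra.
  - replace (x + d / 2 + - x) with (d / 2) by ring. rewrite Rabs_pos_eq; lra.
Qed.

Lemma locally_eq_on (f g : R -> R) (x : R) :
  (forall t, I t -> f t = g t) -> I x -> locally x (fun t => f t = g t).
Proof.
  intros H Hx. generalize (in_open_locally x Hx). apply filter_imp. auto.
Qed.

Lemma Derive_ext_on (f g : R -> R) (x : R) :
  (forall t, I t -> f t = g t) -> I x -> Derive f x = Derive g x.
Proof. intros H Hx. apply Derive_ext_loc. apply locally_eq_on; auto. Qed.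

(** Recursion on the derivative makes the product rule and bootstrapping along a
    differential equation plain inductions, unlike [ex_derive_n]. *)
Fixpoint Ck (n : nat) (f : R -> R) : Prop :=
  match n with
  | O => True
  | S n => (forall x, I x -> ex_derive f x) /\ Ck n (Derive f)
  end.

Definition Cinf (f : R -> R) : Prop := forall n, Ck n f.

Lemma Ck_ext (n : nat) : forall f g, (forall x, I x -> f x = g x) -> Ck n f -> Ck n g.
Proof.
  induction n as [|n IH]; simpl; auto. intros f g H [H1 H2]. split.
  - intros x Hx. apply (ex_derive_ext_loc f); auto. apply locally_eq_on; auto.
  - apply (IH (Derive f)); auto. intros x Hx. apply Derive_ext_on; auto.
Qed.

Lemma Ck_S (n : nat) : forall f, Ck (S n) f -> Ck n f.
Proof.
  induction n as [|n IH]; [simpl; auto|]. intros f [H1 H2]. split; auto.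
Qed.

Lemma Ck_plus (n : nat) : forall f g, Ck n f -> Ck n g -> Ck n (fun x => f x + g x).
Proof.
  induction n as [|n IH]; simpl; auto. intros f g [F1 F2] [G1 G2]. split.
  - intros x Hx. auto_derive. auto.
  - apply (Ck_ext n (fun x => Derive f x + Derive g x)); auto.
    intros x Hx. rewrite Derive_plus; auto.
Qed.

Lemma Ck_mult (n : nat) : forall f g, Ck n f -> Ck n g -> Ck n (fun x => f x * g x).
Proof.
  induction n as [|n IH]; [simpl; auto|].
  intros f g F G. pose proof (Ck_S _ _ F) as F'. pose proof (Ck_S _ _ G) as G'.
  destruct F as [F1 F2]. destruct G as [G1 G2]. split.
  - intros x Hx. auto_derive. auto.
  - apply (Ck_ext n (fun x => Derive f x * g x + f x * Derive g x)).
    + intros x Hx. rewrite Derive_mult; auto.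
    + apply Ck_plus; apply IH; auto.
Qed.

Lemma Ck_const (n : nat) : forall c, Ck n (fun _ => c).
Proof.
  induction n as [|n IH]; simpl; auto. intros c. split.
  - intros x _. apply ex_derive_const.
  - apply (Ck_ext n (fun _ => 0)); auto. intros x _. rewrite Derive_const. auto.
Qed.

Lemma Ck_inv (n : nat) : forall f, (forall x, I x -> f x <> 0) -> Ck n f ->
  Ck n (fun x => / f x).
Proof.
  induction n as [|n IH]; [simpl; auto|]. intros f H0 F.
  pose proof (IH _ H0 (Ck_S _ _ F)) as F'. destruct F as [F1 F2]. split.
  - intros x Hx. auto_derive. auto.
  - apply (Ck_ext n (fun x => (-1) * (Derive f x * (/ f x * / f x)))).
    + intros x Hx. rewrite Derive_inv by auto. field. auto.
    + repeat apply Ck_mult; auto. apply Ck_const.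
Qed.

Lemma smooth_Ck (n : nat) : forall f, smooth_on a0 b0 f -> Ck n f.
Proof.
  induction n as [|n IH]; simpl; auto. intros f H. split.
  - intros x Hx. apply (H 1%nat x Hx).
  - apply IH. intros k x Hx. destruct k as [|k]; simpl; auto.
    apply (ex_derive_ext (Derive_n f (S k))).
    + intros t. replace (Derive f) with (Derive_n f 1) by reflexivity.
      rewrite Derive_n_comp. replace (k + 1)%nat with (S k) by lia. reflexivity.
    + apply (H (S (S k)) x Hx).
Qed.

Lemma Cinf_plus (f g : R -> R) : Cinf f -> Cinf g -> Cinf (fun x => f x + g x).
Proof. intros F G n. apply Ck_plus; auto. Qed.
Lemma Cinf_mult (f g : R -> R) : Cinf f -> Cinf g -> Cinf (fun x => f x * g x).
Proof. intros F G n. apply Ck_mult; auto. Qed.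
Lemma Cinf_const (c : R) : Cinf (fun _ => c).
Proof. intros n. apply Ck_const. Qed.
Lemma Cinf_ext (f g : R -> R) : (forall x, I x -> f x = g x) -> Cinf f -> Cinf g.
Proof. intros H F n. apply (Ck_ext n f); auto. Qed.
Lemma Cinf_inv (f : R -> R) : (forall x, I x -> f x <> 0) -> Cinf f -> Cinf (fun x => / f x).
Proof. intros H F n. apply Ck_inv; auto. Qed.
Lemma Cinf_Derive (f : R -> R) : Cinf f -> Cinf (Derive f).
Proof. intros F n. apply (F (S n)). Qed.
Lemma Cinf_ex_derive (f : R -> R) (x : R) : Cinf f -> I x -> ex_derive f x.
Proof. intros F Hx. apply (F 1%nat); auto. Qed.
Lemma Cinf_continuous (f : R -> R) (x : R) : Cinf f -> I x -> continuous f x.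
Proof. intros F Hx. apply @ex_derive_continuous. apply Cinf_ex_derive; auto. Qed.

(** Multiplicity at least [k]. The recursion on derivatives suits inductions that differentiate
    a product or an equation. *)
Fixpoint vanish (k : nat) (f : R -> R) (x : R) : Prop :=
  match k with
  | O => True
  | S k => f x = 0 /\ vanish k (Derive f) x
  end.

Lemma vanish_Derive_n (k : nat) : forall f x,
  vanish k f x <-> forall j, (j < k)%nat -> Derive_n f j x = 0.
Proof.
  induction k as [|k IH]; simpl; intros f x.
  - split; auto. intros _ j Hj. lia.
  - rewrite IH. split.
    + intros [H1 H2] [|j] Hj; auto.
      replace (S j) with (j + 1)%nat by lia. rewrite <- Derive_n_comp. apply H2. lia.
    + intros H. split; [apply (H 0%nat); lia|].
      intros j Hj. replace (Derive f) with (Derive_n f 1) by reflexivity.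
      rewrite Derive_n_comp. apply H. lia.
Qed.

Lemma vanish_ext (k : nat) : forall f g x, (forall t, I t -> f t = g t) -> I x ->
  vanish k f x -> vanish k g x.
Proof.
  induction k as [|k IH]; simpl; auto. intros f g x H Hx [H1 H2]. split.
  - rewrite <- H; auto.
  - apply (IH (Derive f)); auto. intros t Ht. apply Derive_ext_on; auto.
Qed.

Lemma vanish_le (k : nat) : forall j f x, (j <= k)%nat -> vanish k f x -> vanish j f x.
Proof.
  intros j f x Hj H. rewrite vanish_Derive_n in *. intros i Hi. apply H. lia.
Qed.

Lemma vanish_plus (k : nat) : forall f g x, Cinf f -> Cinf g -> I x ->
  vanish k f x -> vanish k g x -> vanish k (fun t => f t + g t) x.
Proof.
  induction k as [|k IH]; simpl; auto. intros f g x F G Hx [F1 F2] [G1 G2]. split.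
  - rewrite F1, G1. ring.
  - apply (vanish_ext k (fun t => Derive f t + Derive g t)); auto.
    + intros t Ht. rewrite Derive_plus; auto using Cinf_ex_derive.
    + apply IH; auto using Cinf_Derive.
Qed.

Lemma vanish_mult (k : nat) : forall c f x, Cinf c -> Cinf f -> I x ->
  vanish k f x -> vanish k (fun t => c t * f t) x.
Proof.
  induction k as [|k IH]; [simpl; auto|]. intros c f x C F Hx H.
  assert (H' : vanish k f x) by (apply (vanish_le (S k)); auto).
  destruct H as [F1 F2]. split.
  - rewrite F1. ring.
  - apply (vanish_ext k (fun t => Derive c t * f t + c t * Derive f t)); auto.
    + intros t Ht. rewrite Derive_mult; auto using Cinf_ex_derive.
    + apply vanish_plus; auto using Cinf_Derive, Cinf_mult.
Qed.

Lemma vanish_cancel (k : nat) : forall c f x, Cinf c -> Cinf f -> I x -> c x <> 0 ->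
  vanish k (fun t => c t * f t) x -> vanish k f x.
Proof.
  induction k as [|k IH]; [simpl; auto|]. intros c f x C F Hx H0 H.
  assert (Fk : vanish k f x) by (apply (IH c); auto; apply (vanish_le (S k)); auto).
  destruct H as [H1 H2]. split.
  - apply Rmult_integral in H1. tauto.
  - apply (IH c); auto using Cinf_Derive.
    apply (vanish_ext k (fun t => Derive (fun t => c t * f t) t + (-1 * Derive c t) * f t)); auto.
    + intros t It. rewrite Derive_mult by auto using Cinf_ex_derive. ring.
    + apply vanish_plus; auto using Cinf_Derive, Cinf_mult, Cinf_const.
      apply vanish_mult; auto using Cinf_Derive, Cinf_mult, Cinf_const.
Qed.

End OpenInterval.
Arguments Cinf a0 b0 f : clear implicits.
(** * Linear systems: uniqueness, dependence on a parameter, existence *)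

Lemma gronwall (E dE : R -> R) (M c a b : R) :
  a <= b -> 0 < M ->
  (forall x, a <= x <= b -> is_derive E x (dE x)) ->
  (forall x, a <= x <= b -> dE x <= M * E x + c) ->
  E a = 0 -> E b <= c / M * (exp (M * (b - a)) - 1).
Proof.
  intros Hab HM HE HdE E0.
  set (F := fun x => - ((E x + c / M) * exp (- (M * (x - a))))).
  assert (HF : F a <= F b).
  { apply (derive_nonneg_incr F
      (fun x => (M * E x + c - dE x) * exp (- (M * (x - a))))); auto.
    - intros x Hx. unfold F. specialize (HE x Hx).
      evar_last.
      + apply @is_derive_opp. apply @is_derive_mult.
        * apply @is_derive_plus; [exact HE|apply is_derive_const].
        * apply (is_derive_comp exp); [apply is_derive_exp|].
          apply (is_derive_ext (fun x => - M * x + M * a)); [intros; simpl; ring|].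
          apply @is_derive_plus; [|apply is_derive_const].
          apply is_derive_scal. apply is_derive_id.
        * intros; apply Rmult_comm.
      + unfold opp, plus, mult, scal, zero, one; simpl; unfold mult; simpl. field. lra.
    - intros x Hx. apply Rmult_le_pos; [|apply Rlt_le, exp_pos].
      specialize (HdE x Hx). lra. }
  unfold F in HF. rewrite E0, Rminus_diag, Rmult_0_r, Ropp_0, exp_0 in HF.
  assert (He : exp (M * (b - a)) * exp (- (M * (b - a))) = 1)
    by (rewrite <- exp_plus, Rplus_opp_r; apply exp_0).
  pose proof (exp_pos (M * (b - a))) as Hp.
  set (e := exp (M * (b - a))) in *. set (e' := exp (- (M * (b - a)))) in *.
  assert (H1 : (E b + c / M) * e' <= c / M) by lra.
  apply (Rmult_le_compat_l e) in H1; [|lra].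
  replace (e * ((E b + c / M) * e')) with ((E b + c / M) * (e * e')) in H1 by ring.
  rewrite He in H1. lra.
Qed.

Section LinearSystem.
Context {a0 b0 : Rbar}.
Local Notation I := (in_open a0 b0).

Definition linear_system (A B u p : R -> R) : Prop :=
  forall x, I x -> is_derive u x (A x * p x) /\ is_derive p x (B x * u x).

Lemma is_derive_energy (u p : R -> R) (x du dp : R) :
  is_derive u x du -> is_derive p x dp ->
  is_derive (fun t => u t * u t + p t * p t) x (2 * (u x * du + p x * dp)).
Proof.
  intros Hu Hp. evar_last.
  - apply @is_derive_plus; (apply @is_derive_mult; [eassumption|eassumption|exact Rmult_comm]).
  - unfold plus, mult; simpl. ring.
Qed.

Lemma product_le_energy (u p q M : R) : Rabs q <= M -> 2 * (u * p * q) <= M * (u * u + p * p).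
Proof.
  intros H. assert (H1 : - M <= q <= M) by (apply Rabs_le_between; auto).
  assert (0 <= (u + p) * (u + p) * (M - q)) by (apply Rmult_le_pos; [apply Rle_0_sqr|lra]).
  assert (0 <= (u - p) * (u - p) * (M + q)) by (apply Rmult_le_pos; [apply Rle_0_sqr|lra]).
  nra.
Qed.

Lemma energy_zero (u p : R) : u * u + p * p <= 0 -> u = 0 /\ p = 0.
Proof. intros H. split; nra. Qed.

(** The squared norm of a solution satisfies a Gronwall inequality in both directions of time. *)
Lemma linear_system_unique (A B u p : R -> R) (a x : R) :
  (forall x, I x -> continuous A x) -> (forall x, I x -> continuous B x) ->
  linear_system A B u p -> I a -> I x -> u a = 0 -> p a = 0 -> u x = 0 /\ p x = 0.
Proof.
  intros CA CB HS Ia Ix Ua Pa.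
  set (E := fun t => u t * u t + p t * p t).
  assert (HE : forall t, I t -> is_derive E t (2 * (u t * p t * (A t + B t)))).
  { intros t It. destruct (HS t It) as [H1 H2].
    pose proof (is_derive_energy u p t _ _ H1 H2) as H.
    replace (2 * (u t * p t * (A t + B t)))
      with (2 * (u t * (A t * p t) + p t * (B t * u t))) by ring. exact H. }
  assert (Ea : E a = 0) by (unfold E; rewrite Ua, Pa; ring).
  apply energy_zero. fold (E x).
  destruct (Rle_dec a x) as [Hax|Hax].
  - destruct (continuous_bounded (fun t => A t + B t) a x) as [M [HM HB]]; auto.
    { intros t Ht. apply (continuous_plus A B); [apply CA|apply CB];
        apply (in_open_between a x); auto. }
    replace 0 with (0 / M * (exp (M * (x - a)) - 1)) by (field; lra).
    apply (gronwall E (fun t => 2 * (u t * p t * (A t + B t)))); auto.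
    + intros t Ht. apply HE. apply (in_open_between a x); auto.
    + intros t Ht. rewrite Rplus_0_r. apply product_le_energy. auto.
  - destruct (continuous_bounded (fun t => A t + B t) x a) as [M [HM HB]]; [lra| |].
    { intros t Ht. apply (continuous_plus A B); [apply CA|apply CB];
        apply (in_open_between x a); auto. }
    replace 0 with (0 / M * (exp (M * (- x - - a)) - 1)) by (field; lra).
    replace (E x) with ((fun t => E (- t)) (- x)) by (simpl; f_equal; ring).
    apply (gronwall (fun t => E (- t))
            (fun t => - (2 * (u (- t) * p (- t) * (A (- t) + B (- t)))))); auto; try lra.
    + intros t Ht.
      replace (- (2 * (u (- t) * p (- t) * (A (- t) + B (- t)))))
        with ((-1) * (2 * (u (- t) * p (- t) * (A (- t) + B (- t))))) by ring.
      apply (is_derive_comp E (fun t => - t)).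
      * apply HE. apply (in_open_between x a); auto. lra.
      * apply (is_derive_ext (fun t => (-1) * t)); [intros; simpl; ring|].
        evar_last; [apply is_derive_scal; apply is_derive_id|]. unfold one; simpl. ring.
    + intros t Ht. rewrite Rplus_0_r.
      replace (- (2 * (u (- t) * p (- t) * (A (- t) + B (- t)))))
        with (2 * (u (- t) * p (- t) * (- (A (- t) + B (- t))))) by ring.
      apply product_le_energy. rewrite Rabs_Ropp. apply HB. lra.
    + simpl. rewrite Ropp_involutive. auto.
Qed.

(** Gronwall's inequality for the squared norm of the difference of two solutions with common
    initial data: it yields the continuity of the shooting solutions in the parameter. *)
Lemma linear_system_perturb (A B g u p : R -> R) (a b : R) :
  (forall x, I x -> continuous A x) -> (forall x, I x -> continuous B x) ->
  (forall x, I x -> continuous g x) ->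
  linear_system A B u p -> I a -> I b -> a <= b ->
  exists C, 0 < C /\ forall eps v q,
    linear_system A (fun x => B x + eps * g x) v q -> v a = u a -> q a = p a ->
    Rabs eps <= 1 ->
    forall x, a <= x <= b ->
      (v x - u x) * (v x - u x) + (q x - p x) * (q x - p x) <= C * (eps * eps).
Proof.
  intros CA CB Cg HS Ia Ib Hab.
  assert (HI : forall t, a <= t <= b -> I t)
    by (intros t Ht; apply (in_open_between a b); auto).
  assert (Cu : forall x, I x -> continuous u x).
  { intros x Hx. apply @ex_derive_continuous. eexists. apply (HS x Hx). }
  destruct (continuous_bounded (fun t => A t + B t) a b) as [M [HM HB]]; auto.
  { intros t Ht. apply (continuous_plus A B); auto. }
  destruct (continuous_bounded g a b) as [N [HN Hg]]; auto.
  destruct (continuous_bounded u a b) as [S [HS0 Hu]]; auto.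
  set (M' := M + N + 1). assert (HM' : 0 < M') by (unfold M'; lra).
  exists (((N * S) * (N * S)) / M' * exp (M' * (b - a))). split.
  { apply Rmult_lt_0_compat; [apply Rdiv_lt_0_compat; auto; apply Rmult_lt_0_compat; nra|
      apply exp_pos]. }
  intros eps v q HV Va Qa Heps x Hx.
  set (c := (N * S) * (N * S) * (eps * eps)).
  assert (Hc : 0 <= c) by (unfold c; apply Rmult_le_pos; apply Rle_0_sqr).
  set (d := fun t => v t - u t). set (e := fun t => q t - p t).
  set (E := fun t => d t * d t + e t * e t).
  apply Rle_trans with (c / M' * (exp (M' * (x - a)) - 1)).
  - apply (gronwall E (fun t => 2 * (d t * (A t * e t)
              + e t * (B t * d t + eps * g t * v t)))); auto; try lra.
    + intros t Ht. assert (It : I t) by (apply HI; lra).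
      destruct (HS t It) as [H1 H2]. destruct (HV t It) as [H3 H4].
      apply is_derive_energy; unfold d, e.
      * evar_last; [apply @is_derive_minus; [exact H3|exact H1]|].
        unfold minus, plus, opp; simpl. ring.
      * evar_last; [apply @is_derive_minus; [exact H4|exact H2]|].
        unfold minus, plus, opp; simpl. ring.
    + intros t Ht. assert (Ht' : a <= t <= b) by lra.
      specialize (HB t Ht'). specialize (Hg t Ht'). specialize (Hu t Ht').
      replace (2 * (d t * (A t * e t) + e t * (B t * d t + eps * g t * v t)))
        with (2 * (d t * e t * (A t + B t)) + 2 * (d t * e t * (eps * g t))
               + 2 * (e t * (eps * g t * u t))) by (unfold d; ring).
      assert (P1 : 2 * (d t * e t * (A t + B t)) <= M * E t) by (apply product_le_energy; auto).
      assert (P2 : 2 * (d t * e t * (eps * g t)) <= N * E t).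
      { apply product_le_energy. rewrite Rabs_mult.
        pose proof (Rabs_pos (g t)). pose proof (Rabs_pos eps). nra. }
      assert (P3 : (eps * g t * u t) * (eps * g t * u t) <= c).
      { unfold c.
        assert (Q : (g t * u t) * (g t * u t) <= (N * S) * (N * S)).
        { apply Rsqr_le_abs_1. rewrite (Rabs_pos_eq (N * S)) by nra.
          rewrite Rabs_mult. apply Rmult_le_compat; auto using Rabs_pos. }
        replace (eps * g t * u t * (eps * g t * u t))
          with ((g t * u t) * (g t * u t) * (eps * eps)) by ring.
        apply Rmult_le_compat_r; [apply Rle_0_sqr|auto]. }
      assert (P4 : 2 * (e t * (eps * g t * u t)) <= E t + c).
      { unfold E. set (w := eps * g t * u t) in *.
        assert (0 <= (e t - w) * (e t - w)) by apply Rle_0_sqr. pose proof (Rle_0_sqr (d t)). unfold Rsqr in *. nra. }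
      unfold M'. lra.
    + unfold E, d, e. rewrite Va, Qa. ring.
  - replace ((N * S) * (N * S) / M' * exp (M' * (b - a)) * (eps * eps))
      with (c / M' * exp (M' * (b - a))) by (unfold c; field; lra).
    apply Rmult_le_compat_l.
    + apply Rmult_le_pos; [auto|apply Rlt_le, Rinv_0_lt_compat; auto].
    + assert (exp (M' * (x - a)) <= exp (M' * (b - a))).
      { destruct (Req_dec x b) as [->|Hn]; [lra|].
        apply Rlt_le, exp_increasing. apply Rmult_lt_compat_l; lra. }
      lra.
Qed.

Lemma is_derive_RInt_on (f : R -> R) (a x : R) :
  (forall t, I t -> continuous f t) -> I a -> I x ->
  is_derive (fun t => RInt f a t) x (f x).
Proof.
  intros Cf Ia Ix. apply (is_derive_RInt f (fun t => RInt f a t) a); auto.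
  generalize (in_open_locally x Ix). apply filter_imp. intros t It.
  apply @RInt_correct. apply @ex_RInt_continuous. intros z Hz. apply Cf.
  unfold Rmin, Rmax in Hz. destruct (Rle_dec a t).
  - apply (in_open_between a t); auto.
  - apply (in_open_between t a); auto.
Qed.

End LinearSystem.
Arguments linear_system a0 b0 A B u p : clear implicits.
(** The exponential weight absorbs the integration: this is the estimate that makes the Picard
    map a contraction for a suitable norm. *)
Lemma exp_compare_right (f df : R -> R) (W lam a x : R) :
  a <= x -> 0 <= W -> f a = 0 ->
  (forall t, a <= t <= x -> is_derive f t (df t)) ->
  (forall t, a <= t <= x -> Rabs (df t) <= W * lam * exp (lam * (t - a))) ->
  Rabs (f x) <= W * exp (lam * (x - a)).
Proof.
  intros Hax HW Fa Hf Hdf.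
  assert (He : forall t, is_derive (fun t => W * exp (lam * (t - a))) t
                 (W * lam * exp (lam * (t - a)))).
  { intros t. auto_derive; auto. unfold one, zero; simpl. unfold Rminus. ring. }
  assert (Hd : forall t, a <= t <= x -> - (W * lam * exp (lam * (t - a))) <= df t
                 <= W * lam * exp (lam * (t - a))).
  { intros t Ht. apply Rabs_le_between. auto. }
  assert (E0 : exp (lam * (a - a)) = 1) by (rewrite Rminus_diag, Rmult_0_r; apply exp_0).
  apply Rabs_le. split.
  - assert (H : W * exp (lam * (a - a)) + f a <= W * exp (lam * (x - a)) + f x).
    { apply (derive_nonneg_incr (fun t => W * exp (lam * (t - a)) + f t)
               (fun t => W * lam * exp (lam * (t - a)) + df t)); auto.
      - intros t Ht. apply @is_derive_plus; auto.
      - intros t Ht. specialize (Hd t Ht). lra. }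
    rewrite E0, Fa in H. lra.
  - assert (H : W * exp (lam * (a - a)) - f a <= W * exp (lam * (x - a)) - f x).
    { apply (derive_nonneg_incr (fun t => W * exp (lam * (t - a)) - f t)
               (fun t => W * lam * exp (lam * (t - a)) - df t)); auto.
      - intros t Ht. apply @is_derive_minus; auto.
      - intros t Ht. specialize (Hd t Ht). lra. }
    rewrite E0, Fa in H. lra.
Qed.

Lemma exp_compare (f df : R -> R) (W lam c d a x : R) :
  c <= a <= d -> c <= x <= d -> 0 <= W -> f a = 0 ->
  (forall t, c <= t <= d -> is_derive f t (df t)) ->
  (forall t, c <= t <= d -> Rabs (df t) <= W * lam * exp (lam * Rabs (t - a))) ->
  Rabs (f x) <= W * exp (lam * Rabs (x - a)).
Proof.
  intros Ha Hx HW Fa Hf Hdf. destruct (Rle_dec a x) as [Hax|Hax].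
  - rewrite (Rabs_pos_eq (x - a)) by lra.
    apply (exp_compare_right f df); auto.
    + intros t Ht. apply Hf. lra.
    + intros t Ht. rewrite <- (Rabs_pos_eq (t - a)) by lra. apply Hdf. lra.
  - rewrite (Rabs_left (x - a)) by lra.
    replace (- (x - a)) with (- x - - a) by ring.
    replace (f x) with ((fun t => f (- t)) (- x)) by (simpl; f_equal; ring).
    apply (exp_compare_right (fun t => f (- t)) (fun t => - df (- t))); auto; try lra.
    + simpl. rewrite Ropp_involutive. auto.
    + intros t Ht. replace (- df (- t)) with ((-1) * df (- t)) by ring.
      apply (is_derive_comp f (fun t => - t)); [apply Hf; lra|].
      apply (is_derive_ext (fun t => (-1) * t)); [intros; simpl; ring|].
      evar_last; [apply is_derive_scal; apply is_derive_id|]. unfold one; simpl. ring.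
    + intros t Ht. rewrite Rabs_Ropp.
      replace (t - - a) with (Rabs (- t - a)).
      * apply Hdf. lra.
      * rewrite Rabs_left1 by lra. ring.
Qed.

Section Picard.
Context {a0 b0 : Rbar}.
Local Notation I := (in_open a0 b0).
Context (A B : R -> R) (a c0 c1 : R).
Context (CA : forall x, I x -> continuous A x) (CB : forall x, I x -> continuous B x).
Context (Ia : I a).

Fixpoint picard (k : nat) : (R -> R) * (R -> R) :=
  match k with
  | O => (fun _ => c0, fun _ => c1)
  | S k => (fun x => c0 + RInt (fun t => A t * snd (picard k) t) a x,
            fun x => c1 + RInt (fun t => B t * fst (picard k) t) a x)
  end.

Lemma is_derive_const_RInt (f : R -> R) (c x : R) :
  (forall t, I t -> continuous f t) -> I x ->
  is_derive (fun t => c + RInt f a t) x (f x).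
Proof.
  intros Cf Ix. evar_last.
  - apply @is_derive_plus; [apply is_derive_const|apply (is_derive_RInt_on (a0 := a0) (b0 := b0) f a x); auto].
  - unfold plus, zero; simpl. ring.
Qed.

Lemma picard_continuous (k : nat) : forall x, I x ->
  continuous (fst (picard k)) x /\ continuous (snd (picard k)) x.
Proof.
  induction k as [|k IH]; intros x Ix; simpl.
  - split; apply continuous_const.
  - split; apply @ex_derive_continuous; eexists; apply is_derive_const_RInt; auto;
      intros t It; apply (continuous_mult (K := R_AbsRing)); auto; apply IH; auto.
Qed.

Lemma picard_derive (k : nat) (x : R) : I x ->
  is_derive (fst (picard (S k))) x (A x * snd (picard k) x) /\
  is_derive (snd (picard (S k))) x (B x * fst (picard k) x).
Proof.
  intros Ix. simpl. split.
  - apply (is_derive_const_RInt (fun t => A t * snd (picard k) t)); auto.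
    intros t It. apply (continuous_mult (K := R_AbsRing)); auto. apply picard_continuous; auto.
  - apply (is_derive_const_RInt (fun t => B t * fst (picard k) t)); auto.
    intros t It. apply (continuous_mult (K := R_AbsRing)); auto. apply picard_continuous; auto.
Qed.

Lemma picard_initial (k : nat) : fst (picard k) a = c0 /\ snd (picard k) a = c1.
Proof.
  destruct k as [|k]; simpl; auto. rewrite !RInt_point. unfold zero; simpl. split; ring.
Qed.

(** In the norm weighted by [exp (- 2 * M * |x - a|)] the Picard map halves distances. *)
Lemma picard_step (c d : R) : I c -> I d -> c <= a <= d ->
  exists C, 0 <= C /\ forall k x, c <= x <= d ->
    Rabs (fst (picard (S k)) x - fst (picard k) x) <= C * (/ 2) ^ k /\
    Rabs (snd (picard (S k)) x - snd (picard k) x) <= C * (/ 2) ^ k.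
Proof.
  intros Ic Id Ha.
  assert (HI : forall t, c <= t <= d -> I t)
    by (intros t Ht; apply (in_open_between c d); auto).
  destruct (continuous_bounded A c d) as [M1 [HM1 H1]]; [lra|auto|].
  destruct (continuous_bounded B c d) as [M2 [HM2 H2]]; [lra|auto|].
  destruct (continuous_bounded (fun x => fst (picard 1) x - fst (picard 0) x) c d)
    as [W1 [HW1 H3]]; [lra| |].
  { intros x Hx. apply (continuous_minus (V := R_NormedModule)); apply picard_continuous; auto. }
  destruct (continuous_bounded (fun x => snd (picard 1) x - snd (picard 0) x) c d)
    as [W2 [HW2 H4]]; [lra| |].
  { intros x Hx. apply (continuous_minus (V := R_NormedModule)); apply picard_continuous; auto. }
  set (M := M1 + M2). set (W := W1 + W2). set (lam := 2 * M).
  assert (HW : 0 <= W) by (unfold W; lra).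
  assert (Hlam : 0 < lam) by (unfold lam, M; lra).
  assert (Key : forall k x, c <= x <= d ->
    Rabs (fst (picard (S k)) x - fst (picard k) x)
      <= W * (/ 2) ^ k * exp (lam * Rabs (x - a)) /\
    Rabs (snd (picard (S k)) x - snd (picard k) x)
      <= W * (/ 2) ^ k * exp (lam * Rabs (x - a))).
  { assert (Hm : forall q m r E, Rabs q <= m -> m <= M -> 0 <= E -> Rabs r <= E ->
              Rabs (q * r) <= (E * / 2) * lam).
    { intros q m r E Hq Hm HE Hr. rewrite Rabs_mult.
      replace (E * / 2 * lam) with (M * E) by (unfold lam; field).
      apply Rmult_le_compat; auto using Rabs_pos. lra. }
    induction k as [|k IH]; intros x Hx.
    - assert (He : 1 <= exp (lam * Rabs (x - a))).
      { rewrite <- exp_0. destruct (Req_dec (lam * Rabs (x - a)) 0) as [->|Hn]; [lra|].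
        apply Rlt_le, exp_increasing.
        assert (0 <= lam * Rabs (x - a)) by (apply Rmult_le_pos; [lra|apply Rabs_pos]). lra. }
      specialize (H3 x Hx). specialize (H4 x Hx).
      rewrite pow_O, Rmult_1_r.
      assert (W * 1 <= W * exp (lam * Rabs (x - a))) by (apply Rmult_le_compat_l; auto).
      unfold W in *. lra.
    - assert (Hp : 0 <= (/ 2) ^ k) by (apply pow_le; lra).
      assert (HWk : 0 <= W * (/ 2) ^ S k).
      { simpl. apply Rmult_le_pos; auto. apply Rmult_le_pos; lra. }
      destruct (picard_initial (S (S k))) as [i1 i2].
      destruct (picard_initial (S k)) as [i3 i4].
      split.
      + apply (exp_compare (fun x => fst (picard (S (S k))) x - fst (picard (S k)) x)
          (fun t => A t * (snd (picard (S k)) t - snd (picard k) t)) _ lam c d a x); auto.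
        * rewrite i1, i3. ring.
        * intros t Ht. evar_last.
          -- apply (is_derive_minus (fst (picard (S (S k)))) (fst (picard (S k))));
             [exact (proj1 (picard_derive (S k) t (HI t Ht)))|exact (proj1 (picard_derive k t (HI t Ht)))].
          -- unfold minus, plus, opp; simpl. ring.
        * intros t Ht. destruct (IH t Ht) as [_ I2].
          replace (W * (/ 2) ^ S k * lam * exp (lam * Rabs (t - a)))
            with (W * (/ 2) ^ k * exp (lam * Rabs (t - a)) * / 2 * lam) by (simpl; ring).
          apply (Hm _ M1); auto; [unfold M; lra|].
          apply Rmult_le_pos; [apply Rmult_le_pos; auto|apply Rlt_le, exp_pos].
      + apply (exp_compare (fun x => snd (picard (S (S k))) x - snd (picard (S k)) x)
          (fun t => B t * (fst (picard (S k)) t - fst (picard k) t)) _ lam c d a x); auto.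
        * rewrite i2, i4. ring.
        * intros t Ht. evar_last.
          -- apply (is_derive_minus (snd (picard (S (S k)))) (snd (picard (S k))));
             [exact (proj2 (picard_derive (S k) t (HI t Ht)))|exact (proj2 (picard_derive k t (HI t Ht)))].
          -- unfold minus, plus, opp; simpl. ring.
        * intros t Ht. destruct (IH t Ht) as [I1 _].
          replace (W * (/ 2) ^ S k * lam * exp (lam * Rabs (t - a)))
            with (W * (/ 2) ^ k * exp (lam * Rabs (t - a)) * / 2 * lam) by (simpl; ring).
          apply (Hm _ M2); auto; [unfold M; lra|].
          apply Rmult_le_pos; [apply Rmult_le_pos; auto|apply Rlt_le, exp_pos]. }
  exists (W * exp (lam * (d - c))). split.
  { apply Rmult_le_pos; [auto|apply Rlt_le, exp_pos]. }
  intros k x Hx.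
  assert (He : exp (lam * Rabs (x - a)) <= exp (lam * (d - c))).
  { assert (Hl : lam * Rabs (x - a) <= lam * (d - c)).
    { apply Rmult_le_compat_l; [lra|]. apply Rabs_le. lra. }
    destruct Hl as [Hl| ->]; [apply Rlt_le, exp_increasing; auto|lra]. }
  assert (Hq : W * (/ 2) ^ k * exp (lam * Rabs (x - a))
               <= W * exp (lam * (d - c)) * (/ 2) ^ k).
  { replace (W * exp (lam * (d - c)) * (/ 2) ^ k)
      with (W * (/ 2) ^ k * exp (lam * (d - c))) by ring.
    apply Rmult_le_compat_l; auto. apply Rmult_le_pos; auto. apply pow_le; lra. }
  destruct (Key k x Hx). split; lra.
Qed.

Lemma geometric_CVU (f : nat -> R -> R) (D : R -> Prop) (C : R) :
  0 <= C -> (forall k x, D x -> Rabs (f (S k) x - f k x) <= C * (/ 2) ^ k) -> CVU_dom f D.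
Proof.
  intros HC H. apply CVU_dom_cauchy.
  assert (Hj : forall j k x, D x ->
            Rabs (f (k + j)%nat x - f k x) <= 2 * C * (/ 2) ^ k * (1 - (/ 2) ^ j)).
  { induction j as [|j IH]; intros k x Dx.
    - rewrite Nat.add_0_r, Rminus_diag, Rabs_R0. simpl. lra.
    - replace (k + S j)%nat with (S (k + j)) by lia.
      specialize (IH k x Dx). specialize (H (k + j)%nat x Dx).
      replace (f (S (k + j)) x - f k x)
        with ((f (S (k + j)) x - f (k + j)%nat x) + (f (k + j)%nat x - f k x)) by ring.
      eapply Rle_trans; [apply Rabs_triang|].
      rewrite pow_add in H. simpl.
      set (y := (/ 2) ^ k) in *. set (z := (/ 2) ^ j) in *.
      replace (2 * C * y * (1 - / 2 * z)) with (C * (y * z) + 2 * C * y * (1 - z)) by field. lra. }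
  intros eps.
  assert (Hlim : is_lim_seq (fun k => 2 * C * (/ 2) ^ k) 0).
  { replace (Finite 0) with (Rbar_mult (Finite (2 * C)) (Finite 0))
      by (simpl; f_equal; ring).
    apply is_lim_seq_scal_l. apply is_lim_seq_geom. rewrite Rabs_pos_eq; lra. }
  apply is_lim_seq_spec in Hlim. destruct (Hlim (pos_div_2 eps)) as [N HN].
  exists N.
  assert (Hk : forall k x, D x -> (N <= k)%nat -> Rabs (f k x - f N x) < eps / 2).
  { intros k x Dx Hk. replace k with (N + (k - N))%nat by lia.
    eapply Rle_lt_trans; [apply Hj; auto|].
    specialize (HN N (Nat.le_refl N)). rewrite Rminus_0_r in HN. simpl in HN.
    apply Rabs_def2 in HN. destruct HN as [HN _].
    assert (0 <= (/ 2) ^ (k - N)) by (apply pow_le; lra).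
    assert (0 <= 2 * C * (/ 2) ^ N) by (apply Rmult_le_pos; [lra|apply pow_le; lra]).
    nra. }
  intros n m x Dx Hn Hm.
  replace (f n x - f m x) with ((f n x - f N x) - (f m x - f N x)) by ring.
  unfold Rminus at 1. eapply Rle_lt_trans; [apply Rabs_triang|]. rewrite Rabs_Ropp.
  pose proof (Hk n x Dx Hn). pose proof (Hk m x Dx Hm). lra.
Qed.

Lemma CVU_dom_is_lim (f : nat -> R -> R) (D : R -> Prop) (x : R) :
  CVU_dom f D -> D x -> is_lim_seq (fun n => f n x) (real (Lim_seq (fun n => f n x))).
Proof.
  intros H Dx. apply is_lim_seq_spec. intros eps. generalize (H eps).
  apply filter_imp. auto.
Qed.

Lemma linear_system_exists : exists u p,
  linear_system a0 b0 A B u p /\ u a = c0 /\ p a = c1.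
Proof.
  exists (fun x => real (Lim_seq (fun n => fst (picard n) x))),
         (fun x => real (Lim_seq (fun n => snd (picard n) x))).
  split; [|split].
  2: { rewrite (Lim_seq_ext _ (fun _ => c0)) by (intros; apply picard_initial).
       rewrite Lim_seq_const. auto. }
  2: { rewrite (Lim_seq_ext _ (fun _ => c1)) by (intros; apply picard_initial).
       rewrite Lim_seq_const. auto. }
  intros x Ix.
  (* the convergence is uniform only on compact subintervals: take one around a and x *)
  destruct (in_open_margin a Ia) as [d1 [Hd1 [M1 M2]]].
  destruct (in_open_margin x Ix) as [d2 [Hd2 [M3 M4]]].
  assert (HE : exists c d, I c /\ I d /\ c < a < d /\ c < x < d).
  { destruct (Rle_dec a x).
    - exists (a - d1), (x + d2). split; [|split]; auto; lra.
    - exists (x - d2), (a + d1). split; [|split]; auto; lra. }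
  destruct HE as [c [d [Ic [Id [Ha Hx]]]]].
  assert (HI : forall t, c <= t <= d -> I t)
    by (intros t Ht; apply (in_open_between c d); auto).
  set (D := fun t => c < t < d).
  assert (OD : open D) by (apply open_and; [apply open_gt|apply open_lt]).
  assert (CD : is_connected D) by (intros p q t Hp Hq Ht; unfold D in *; lra).
  destruct (picard_step c d Ic Id) as [C [HC HS]]; [lra|].
  assert (HS1 : forall k t, D t ->
            Rabs (fst (picard (S k)) t - fst (picard k) t) <= C * (/ 2) ^ k)
    by (intros k t Ht; apply HS; unfold D in Ht; lra).
  assert (HS2 : forall k t, D t ->
            Rabs (snd (picard (S k)) t - snd (picard k) t) <= C * (/ 2) ^ k)
    by (intros k t Ht; apply HS; unfold D in Ht; lra).
  assert (ID : forall t, D t -> I t) by (intros t Ht; apply HI; unfold D in Ht; lra).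
  assert (Main : forall (v w : nat -> R -> R),
    (forall k t, I t -> continuous (w k) t) ->
    (forall k t, I t -> is_derive (v k) t (w k t)) ->
    CVU_dom v D -> CVU_dom w D ->
    is_derive (fun y => real (Lim_seq (fun n => v n y))) x
      (real (Lim_seq (fun n => w n x)))).
  { intros v w Cw Hv Uv Uw.
    assert (Ew : forall k t, D t -> Derive (v k) t = w k t)
      by (intros; apply is_derive_unique; auto).
    rewrite <- (Lim_seq_ext (fun n => Derive (v n) x)) by (intros; apply Ew; auto).
    apply (CVU_Derive v D); auto.
    - intros n t Ht. eexists. apply Hv; auto.
    - intros n t Ht. apply continuity_pt_filterlim.
      apply (continuous_ext_loc _ (w n)); [|apply Cw; auto].
      generalize (OD t Ht). apply filter_imp. intros y Hy. symmetry. apply Ew; auto.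
    - intros eps. generalize (Uw eps). apply filter_imp. intros n Hn t Ht.
      rewrite (Lim_seq_ext _ (fun n => w n t)) by (intros; apply Ew; auto).
      rewrite Ew; auto. }
  destruct (continuous_bounded A c d) as [MA [HMA HA]]; [lra|auto|].
  destruct (continuous_bounded B c d) as [MB [HMB HB]]; [lra|auto|].
  assert (Uw : forall (m : R -> R) (Mm : R) (v : nat -> R -> R), 0 < Mm ->
    (forall t, c <= t <= d -> Rabs (m t) <= Mm) ->
    (forall k t, D t -> Rabs (v (S k) t - v k t) <= C * (/ 2) ^ k) ->
    CVU_dom (fun n t => m t * v n t) D).
  { intros m Mm v HMm Hm Hv. apply (geometric_CVU _ _ (Mm * C)); [nra|].
    intros k t Ht. rewrite <- Rmult_minus_distr_l, Rabs_mult, Rmult_assoc.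
    apply Rmult_le_compat; auto using Rabs_pos. apply Hm. unfold D in Ht. lra. }
  assert (Shift : forall v : nat -> R -> R,
    (forall k t, D t -> Rabs (v (S k) t - v k t) <= C * (/ 2) ^ k) ->
    CVU_dom (fun n => v (S n)) D).
  { intros v Hv. apply (geometric_CVU _ _ C); auto. intros k t Ht.
    eapply Rle_trans; [apply Hv; auto|]. simpl.
    assert (0 <= (/ 2) ^ k) by (apply pow_le; lra). nra. }
  assert (Lim : forall (m : R -> R) (v : nat -> R -> R),
    (forall k t, D t -> Rabs (v (S k) t - v k t) <= C * (/ 2) ^ k) ->
    real (Lim_seq (fun n => m x * v n x)) = m x * real (Lim_seq (fun n => v n x))).
  { intros m v Hv. rewrite (is_lim_seq_unique _ (Finite (m x * real (Lim_seq (fun n => v n x))))); auto.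
    apply (is_lim_seq_scal_l _ (m x) (Finite _)).
    apply (CVU_dom_is_lim v D); auto. apply (geometric_CVU _ _ C); auto. }
  split.
  - rewrite <- (Lim A (fun n => snd (picard n)) HS2).
    apply (is_derive_ext (fun y => real (Lim_seq (fun n => fst (picard (S n)) y)))).
    { intros t. f_equal. apply (Lim_seq_incr_1 (fun n => fst (picard n) t)). }
    apply (Main (fun n => fst (picard (S n))) (fun n t => A t * snd (picard n) t)).
    + intros k t It. apply (continuous_mult (K := R_AbsRing)); auto. apply picard_continuous; auto.
    + intros k t It. apply picard_derive; auto.
    + apply (Shift (fun n => fst (picard n))); auto.
    + apply (Uw A MA (fun n => snd (picard n))); auto.
  - rewrite <- (Lim B (fun n => fst (picard n)) HS1).
    apply (is_derive_ext (fun y => real (Lim_seq (fun n => snd (picard (S n)) y)))).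
    { intros t. f_equal. apply (Lim_seq_incr_1 (fun n => snd (picard n) t)). }
    apply (Main (fun n => snd (picard (S n))) (fun n t => B t * fst (picard n) t)).
    + intros k t It. apply (continuous_mult (K := R_AbsRing)); auto. apply picard_continuous; auto.
    + intros k t It. apply picard_derive; auto.
    + apply (Shift (fun n => snd (picard n))); auto.
    + apply (Uw B MB (fun n => fst (picard n))); auto.
Qed.

End Picard.
(** * The Pruefer angle *)

(** A function that can cross the level [c] only upwards stays above it once it is there: look
    at the last time it was at least [c]. *)
Lemma barrier (phi : R -> R) (a b c : R) :
  (forall x, a <= x <= b -> ex_derive phi x) ->
  (forall x, a <= x <= b -> phi x = c -> 0 < Derive phi x) ->
  c <= phi a -> forall x, a < x <= b -> c < phi x.
Proof.
  intros Hd Hp Ha.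
  assert (Ccont : forall x, a <= x <= b -> continuous phi x)
    by (intros; apply @ex_derive_continuous; auto).
  assert (Main : forall y, a < y <= b -> ~ phi y < c).
  { intros y Hy Hlt.
    destruct (completeness (fun t => a <= t <= y /\ c <= phi t)) as [s [S1 S2]].
    { exists y. intros t [Ht _]. lra. }
    { exists a. split; [lra|auto]. }
    assert (Has : a <= s) by (apply S1; split; [lra|auto]).
    assert (Hsy : s <= y) by (apply S2; intros t [Ht _]; lra).
    assert (Is : a <= s <= b) by lra.
    assert (Hs : c <= phi s).
    { destruct (Rle_dec c (phi s)) as [H|H]; auto. exfalso.
      assert (L : locally s (fun t => phi t < c)).
      { apply (Ccont s Is (fun v => v < c)). apply (open_lt c). lra. }
      destruct L as [d Hd'].
      assert (s <= s - d / 2).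
      { pose proof (cond_pos d). apply S2. intros t [Ht1 Ht2].
        destruct (Rle_dec t (s - d / 2)) as [|Hn]; auto. exfalso.
        assert (t <= s) by (apply S1; split; auto).
        assert (phi t < c); [|lra]. apply Hd'.
        unfold ball; simpl; unfold AbsRing_ball, abs, minus, plus, opp; simpl.
        apply Rabs_def1; lra. }
      pose proof (cond_pos d). lra. }
    assert (Hsy' : s < y) by (destruct (Req_dec s y) as [->|]; lra).
    assert (Hright : forall t, s < t <= y -> phi t < c).
    { intros t Ht. destruct (Rlt_dec (phi t) c) as [|Hn]; auto. exfalso.
      assert (t <= s) by (apply S1; split; lra). lra. }
    assert (Hge : phi s <= c).
    { destruct (Rle_dec (phi s) c) as [|Hn]; auto. exfalso.
      assert (L : locally s (fun t => c < phi t)).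
      { apply (Ccont s Is (fun v => c < v)). apply (open_gt c). lra. }
      destruct L as [d Hd']. pose proof (cond_pos d).
      set (t := s + Rmin (d / 2) (y - s)).
      assert (0 < Rmin (d / 2) (y - s)) by (apply Rmin_glb_lt; lra).
      pose proof (Rmin_l (d / 2) (y - s)). pose proof (Rmin_r (d / 2) (y - s)).
      assert (phi t < c) by (apply Hright; unfold t; lra).
      assert (c < phi t); [|lra]. apply Hd'.
      unfold ball; simpl; unfold AbsRing_ball, abs, minus, plus, opp; simpl.
      unfold t. apply Rabs_def1; lra. }
    destruct (Derive_pos_right phi s) as [d [Hd0 Hd']]; auto.
    { apply Hp; auto. lra. }
    set (t := s + Rmin (d / 2) (y - s)).
    assert (0 < Rmin (d / 2) (y - s)) by (apply Rmin_glb_lt; lra).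
    pose proof (Rmin_l (d / 2) (y - s)). pose proof (Rmin_r (d / 2) (y - s)).
    assert (phi t < c) by (apply Hright; unfold t; lra).
    assert (phi s < phi t) by (apply Hd'; unfold t; lra). lra. }
  intros x Hx. destruct (Rlt_dec c (phi x)) as [|Hn]; auto. exfalso.
  destruct (Req_dec (phi x) c) as [He|He].
  - destruct (Derive_pos_left phi x) as [d [Hd0 Hd']].
    { apply Hd; lra. } { apply Hp; auto; lra. }
    set (t := x - Rmin (d / 2) ((x - a) / 2)).
    assert (0 < Rmin (d / 2) ((x - a) / 2)) by (apply Rmin_glb_lt; lra).
    pose proof (Rmin_l (d / 2) ((x - a) / 2)). pose proof (Rmin_r (d / 2) ((x - a) / 2)).
    apply (Main t); [unfold t; lra|]. rewrite <- He. apply Hd'. unfold t; lra.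
  - apply (Main x); auto. lra.
Qed.

Lemma Derive_zero_on_segment (f : R -> R) (a b x : R) :
  a < b -> a <= x <= b -> ex_derive f x -> (forall t, a <= t <= b -> f t = 0) -> Derive f x = 0.
Proof.
  intros Hab Hx.
  assert (Main : forall g, ex_derive g x -> (forall t, a <= t <= b -> g t = 0) -> ~ 0 < Derive g x).
  { intros g Hg H0 Hp. destruct (Rlt_dec x b) as [Hxb|Hxb].
    - destruct (Derive_pos_right g x Hg Hp) as [d [Hd H]].
      pose proof (Rmin_l (d / 2) (b - x)). pose proof (Rmin_r (d / 2) (b - x)).
      assert (0 < Rmin (d / 2) (b - x)) by (apply Rmin_glb_lt; lra).
      specialize (H (x + Rmin (d / 2) (b - x))). rewrite !H0 in H; lra.
    - destruct (Derive_pos_left g x Hg Hp) as [d [Hd H]].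
      pose proof (Rmin_l (d / 2) (x - a)). pose proof (Rmin_r (d / 2) (x - a)).
      assert (0 < Rmin (d / 2) (x - a)) by (apply Rmin_glb_lt; lra).
      specialize (H (x - Rmin (d / 2) (x - a))). rewrite !H0 in H; lra. }
  intros Hf H0.
  pose proof (Main f Hf H0) as H1.
  assert (H2 : ~ 0 < Derive (fun t => - f t) x).
  { apply Main; [auto_derive; auto|]. intros t Ht. rewrite (H0 t Ht). apply Ropp_0. }
  rewrite Derive_opp in H2. lra.
Qed.

Section Angle.
Context (al be : R) (al_lt_be : al < be).

(** A differentiable choice of the argument of [p + i u] on the segment, stated without
    dividing by the modulus. *)
Definition angle (u p phi : R -> R) : Prop :=
  forall x, al <= x <= be ->
    ex_derive phi x /\ u x * cos (phi x) = p x * sin (phi x) /\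
    0 < u x * sin (phi x) + p x * cos (phi x).

Lemma polar_coordinates (u p t : R) : u * cos t = p * sin t ->
  u = (u * sin t + p * cos t) * sin t /\ p = (u * sin t + p * cos t) * cos t.
Proof.
  intros H. pose proof (sin2_cos2 t) as H2. unfold Rsqr in H2. split.
  - replace ((u * sin t + p * cos t) * sin t)
      with (u * (sin t * sin t) + (p * sin t) * cos t) by ring.
    rewrite <- H. replace (u * (sin t * sin t) + u * cos t * cos t)
      with (u * (sin t * sin t + cos t * cos t)) by ring. rewrite H2. ring.
  - replace ((u * sin t + p * cos t) * cos t)
      with ((u * cos t) * sin t + p * (cos t * cos t)) by ring.
    rewrite H. replace (p * sin t * sin t + p * (cos t * cos t))
      with (p * (sin t * sin t + cos t * cos t)) by ring. rewrite H2. ring.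
Qed.

Lemma angle_polar (u p phi : R -> R) (x : R) : angle u p phi -> al <= x <= be ->
  exists d, 0 < d /\ u x = d * sin (phi x) /\ p x = d * cos (phi x).
Proof.
  intros HA Hx. destruct (HA x Hx) as [_ [H1 H2]].
  exists (u x * sin (phi x) + p x * cos (phi x)). split; auto.
  apply polar_coordinates; auto.
Qed.

Lemma angle_derive (u p phi : R -> R) (x du dp : R) :
  angle u p phi -> al <= x <= be -> is_derive u x du -> is_derive p x dp ->
  Derive phi x * (u x * u x + p x * p x) = p x * du - u x * dp.
Proof.
  intros HA Hx Hu Hp. destruct (HA x Hx) as [Hphi [H1 H2]].
  set (c := fun t => u t * cos (phi t) - p t * sin (phi t)).
  assert (Dc : is_derive c x (du * cos (phi x) - u x * (Derive phi x * sin (phi x))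
                 - (dp * sin (phi x) + p x * (Derive phi x * cos (phi x))))).
  { unfold c. apply Derive_correct in Hphi. evar_last.
    - apply @is_derive_minus; apply @is_derive_mult;
        [exact Hu| |exact Rmult_comm|exact Hp| |exact Rmult_comm].
      + apply (is_derive_comp cos phi); [apply is_derive_cos|exact Hphi].
      + apply (is_derive_comp sin phi); [apply is_derive_sin|exact Hphi].
    - unfold minus, plus, opp, mult, scal; simpl; unfold mult; simpl. ring. }
  assert (Z : Derive c x = 0).
  { apply (Derive_zero_on_segment c al be); auto.
    - eexists; exact Dc.
    - intros t Ht. unfold c. destruct (HA t Ht) as [_ [H3 _]]. lra. }
  rewrite (is_derive_unique _ _ _ Dc) in Z.
  destruct (polar_coordinates _ _ _ H1) as [E1 E2].
  set (d := u x * sin (phi x) + p x * cos (phi x)) in *.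
  pose proof (sin2_cos2 (phi x)) as H3. unfold Rsqr in H3.
  assert (F : du * cos (phi x) - dp * sin (phi x) = Derive phi x * d).
  { rewrite E1, E2 in Z.
    replace (Derive phi x * d) with
      (Derive phi x * d * (sin (phi x) * sin (phi x) + cos (phi x) * cos (phi x)))
      by (rewrite H3; ring). lra. }
  replace (p x * du - u x * dp) with (d * (du * cos (phi x) - dp * sin (phi x)))
    by (rewrite E1, E2; ring).
  rewrite F. rewrite E1, E2.
  replace (Derive phi x * (d * sin (phi x) * (d * sin (phi x)) + d * cos (phi x) * (d * cos (phi x))))
    with (Derive phi x * (d * d) * (sin (phi x) * sin (phi x) + cos (phi x) * cos (phi x))) by ring.
  rewrite H3. ring.
Qed.

Lemma angle_norm_pos (u p phi : R -> R) (x : R) :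
  angle u p phi -> al <= x <= be -> 0 < u x * u x + p x * p x.
Proof.
  intros HA Hx. destruct (angle_polar u p phi x HA Hx) as [d [Hd [-> ->]]].
  pose proof (sin2_cos2 (phi x)) as H3. unfold Rsqr in H3.
  replace (d * sin (phi x) * (d * sin (phi x)) + d * cos (phi x) * (d * cos (phi x)))
    with (d * d * (sin (phi x) * sin (phi x) + cos (phi x) * cos (phi x))) by ring.
  rewrite H3. nra.
Qed.

(** The derivative of an angle is determined by the vector, so two angles differ by a constant. *)
Lemma angle_unique (u p du dp phi psi : R -> R) :
  (forall x, al <= x <= be -> is_derive u x (du x) /\ is_derive p x (dp x)) ->
  angle u p phi -> angle u p psi -> phi al = psi al -> phi be = psi be.
Proof.
  intros Hd H1 H2 He.
  assert ((fun x => phi x - psi x) be = (fun x => phi x - psi x) al); [|simpl in *; lra].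
  apply (derive_zero_const (fun x => phi x - psi x)); [lra|]. intros x Hx. destruct (Hd x Hx) as [Du Dp].
  pose proof (angle_derive _ _ _ _ _ _ H1 Hx Du Dp) as D1.
  pose proof (angle_derive _ _ _ _ _ _ H2 Hx Du Dp) as D2.
  pose proof (angle_norm_pos _ _ _ _ H1 Hx) as P.
  rewrite <- D2 in D1. apply Rmult_eq_reg_r in D1; [|lra].
  evar_last.
  - apply @is_derive_minus; apply Derive_correct; [apply H1|apply H2]; auto.
  - unfold minus, plus, opp; simpl. rewrite D1. ring.
Qed.

(** If [p2 + i u2] stays in the open half plane around [p1 + i u1], the argument of the
    quotient is an arctangent, so the angle of the first vector yields one of the second. *)
Lemma angle_perturb (u1 p1 u2 p2 phi : R -> R) :
  angle u1 p1 phi ->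
  (forall x, al <= x <= be -> ex_derive u1 x /\ ex_derive p1 x /\ ex_derive u2 x /\ ex_derive p2 x) ->
  (forall x, al <= x <= be -> 0 < p1 x * p2 x + u1 x * u2 x) ->
  angle u2 p2 (fun x => phi x + atan ((u2 x * p1 x - p2 x * u1 x) / (p1 x * p2 x + u1 x * u2 x))).
Proof.
  intros HA Hd Hpos x Hx. specialize (Hpos x Hx).
  destruct (Hd x Hx) as [D1 [D2 [D3 D4]]].
  destruct (HA x Hx) as [Dphi _].
  destruct (angle_polar _ _ _ _ HA Hx) as [d [Hd0 [E1 E2]]].
  split.
  { apply @ex_derive_plus; auto.
    apply (ex_derive_comp atan).
    - eexists. apply is_derive_atan.
    - auto_derive. repeat split; auto. lra. }
  set (q := (u2 x * p1 x - p2 x * u1 x) / (p1 x * p2 x + u1 x * u2 x)).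
  set (psi := atan q).
  assert (Hc : 0 < cos psi).
  { pose proof (atan_bound q). apply cos_gt_0; unfold psi; lra. }
  assert (Ht : sin psi = q * cos psi).
  { assert (tan psi = q) by apply tan_atan. unfold tan in H. rewrite <- H. field. lra. }
  rewrite E1, E2 in Hpos.
  set (X := u2 x * cos (phi x) - p2 x * sin (phi x)).
  set (Y := u2 x * sin (phi x) + p2 x * cos (phi x)).
  assert (HY : 0 < Y).
  { apply (Rmult_lt_reg_l d); auto. unfold Y. rewrite Rmult_0_r. lra. }
  assert (Hq : q = X / Y).
  { unfold q. rewrite E1, E2. unfold X, Y. field. unfold Y in HY. split; try lra. }
  rewrite sin_plus, cos_plus, Ht, Hq. split.
  - unfold X, Y. field. unfold Y in HY; lra.
  - replace (u2 x * (sin (phi x) * cos psi + cos (phi x) * (X / Y * cos psi))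
             + p2 x * (cos (phi x) * cos psi - sin (phi x) * (X / Y * cos psi)))
      with (cos psi * (Y + X * X / Y)) by (unfold X, Y; field; unfold Y in HY; lra).
    apply Rmult_lt_0_compat; auto.
    assert (0 <= X * X / Y).
    { apply Rmult_le_pos; [apply Rle_0_sqr|]. apply Rlt_le, Rinv_0_lt_compat; auto. }
    lra.
Qed.

(** Each zero of [u] lifts the angle past one more multiple of [PI], because the angle
    crosses these multiples only upwards. *)
Lemma angle_counts_zeros (u p phi k : R -> R) :
  angle u p phi ->
  (forall x, al <= x <= be -> is_derive u x (k x * p x) /\ ex_derive p x /\ 0 < k x) ->
  forall zs a (c : Z), al <= a < be -> IZR c * PI <= phi a ->
  StronglySorted Rlt zs -> (forall x, In x zs -> a < x < be /\ u x = 0) ->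
  IZR (c + Z.of_nat (length zs)) * PI < phi be.
Proof.
  intros HA Hd.
  assert (Up : forall a (c : Z), al <= a < be -> IZR c * PI <= phi a ->
            forall x, a < x <= be -> IZR c * PI < phi x).
  { intros a c Ha Hc. apply barrier; auto.
    - intros x Hx. apply HA. lra.
    - intros x Hx He. assert (Hx' : al <= x <= be) by lra.
      destruct (Hd x Hx') as [Du [Dp Hk]]. apply Derive_correct in Dp.
      pose proof (angle_derive _ _ _ _ _ _ HA Hx' Du Dp) as D.
      destruct (angle_polar _ _ _ _ HA Hx') as [d [Hd0 [E1 E2]]].
      pose proof (angle_norm_pos _ _ _ _ HA Hx') as P.
      assert (S0 : sin (phi x) = 0) by (rewrite He; apply sin_eq_0_1; exists c; auto).
      rewrite S0, Rmult_0_r in E1. rewrite E1 in D, P.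
      apply (Rmult_lt_reg_r (0 * 0 + p x * p x)); auto. rewrite D.
      replace (p x * (k x * p x) - 0 * Derive p x) with (k x * (0 * 0 + p x * p x)) by ring.
      rewrite Rmult_0_l. apply Rmult_lt_0_compat; auto. }
  induction zs as [|x zs IH]; intros a c Ha Hc HS Hz.
  - simpl. rewrite Z.add_0_r. apply (Up a c); auto. lra.
  - simpl length. inversion HS as [|? ? HS' HF]; subst.
    destruct (Hz x) as [Hx Ux]; [left; auto|].
    assert (Hphi : IZR c * PI < phi x) by (apply (Up a c); auto; lra).
    destruct (angle_polar _ _ _ x HA) as [d [Hd0 [E1 _]]]; [lra|].
    rewrite Ux in E1. symmetry in E1. apply Rmult_integral in E1.
    destruct E1 as [E1|E1]; [lra|].
    destruct (sin_eq_0_0 _ E1) as [j Hj].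
    assert (Hcj : (c < j)%Z).
    { apply lt_IZR. apply (Rmult_lt_reg_r PI); [apply PI_RGT_0|]. lra. }
    replace (c + Z.of_nat (S (length zs)))%Z with ((c + 1) + Z.of_nat (length zs))%Z by lia.
    apply (IH x); auto; [lra| |].
    + rewrite Hj. apply Rmult_le_compat_r; [apply Rlt_le, PI_RGT_0|]. apply IZR_le. lia.
    + intros y Hy. destruct (Hz y) as [H1 H2]; [right; auto|]. split; auto.
      rewrite Forall_forall in HF. specialize (HF y Hy). lra.
Qed.

End Angle.

(** The derivative that an angle must have is known; its primitive [phi] is an angle because the
    component of the vector orthogonal to the direction [phi] keeps a constant ratio to the
    norm, and this ratio is zero at the start. *)
Lemma angle_exists {a0 b0 : Rbar} (al be phi0 r : R) (u p du dp : R -> R) :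
  in_open a0 b0 al -> in_open a0 b0 be -> al <= be ->
  (forall x, in_open a0 b0 x -> is_derive u x (du x) /\ is_derive p x (dp x)) ->
  (forall x, in_open a0 b0 x -> continuous du x /\ continuous dp x) ->
  (forall x, in_open a0 b0 x -> 0 < u x * u x + p x * p x) ->
  0 < r -> u al = r * sin phi0 -> p al = r * cos phi0 ->
  exists phi, angle al be u p phi /\ phi al = phi0.
Proof.
  intros Ia Ib Hab Hd Hc Hpos Hr Hu0 Hp0.
  assert (HI : forall t, al <= t <= be -> in_open a0 b0 t)
    by (intros t Ht; apply (in_open_between al be); auto).
  set (N := fun x => u x * u x + p x * p x).
  set (w := fun x => (p x * du x - u x * dp x) / N x).
  assert (Cu : forall x, in_open a0 b0 x -> continuous u x /\ continuous p x).
  { intros x Ix. destruct (Hd x Ix).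
    split; apply @ex_derive_continuous; eexists; eassumption. }
  assert (Cw : forall x, in_open a0 b0 x -> continuous w x).
  { intros x Ix. destruct (Cu x Ix). destruct (Hc x Ix). specialize (Hpos x Ix).
    apply (continuous_mult (K := R_AbsRing)).
    - apply (continuous_minus (V := R_NormedModule)); apply (continuous_mult (K := R_AbsRing)); auto.
    - apply (continuous_comp N Rinv).
      + apply (continuous_plus (V := R_NormedModule)); apply (continuous_mult (K := R_AbsRing)); auto.
      + apply continuous_Rinv. unfold N. lra. }
  set (phi := fun x => phi0 + RInt w al x).
  assert (Dphi : forall x, in_open a0 b0 x -> is_derive phi x (w x)).
  { intros x Ix. unfold phi. apply (is_derive_const_RInt (a0 := a0) (b0 := b0)); auto. }
  assert (phi al = phi0) as Hphi0.
  { unfold phi. rewrite RInt_point. unfold zero; simpl. ring. }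
  exists phi. split; auto.
  set (c := fun x => u x * cos (phi x) - p x * sin (phi x)).
  set (d := fun x => u x * sin (phi x) + p x * cos (phi x)).
  assert (Dcos : forall x, in_open a0 b0 x ->
             is_derive (fun t => cos (phi t)) x (w x * - sin (phi x))).
  { intros x Ix. apply (is_derive_comp cos phi); [apply is_derive_cos|auto]. }
  assert (Dsin : forall x, in_open a0 b0 x ->
             is_derive (fun t => sin (phi t)) x (w x * cos (phi x))).
  { intros x Ix. apply (is_derive_comp sin phi); [apply is_derive_sin|auto]. }
  assert (Dc : forall x, in_open a0 b0 x ->
            is_derive c x (du x * cos (phi x) - dp x * sin (phi x) - w x * d x)).
  { intros x Ix. destruct (Hd x Ix) as [H1 H2]. evar_last.
    - apply @is_derive_minus; apply @is_derive_mult;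
        [exact H1|apply Dcos; auto|exact Rmult_comm|exact H2|apply Dsin; auto|exact Rmult_comm].
    - unfold minus, plus, opp, mult, d; simpl. ring. }
  assert (cN : forall x, c x * c x + d x * d x = N x).
  { intros x. unfold c, d, N. pose proof (sin2_cos2 (phi x)) as H3. unfold Rsqr in H3.
    replace (u x * u x + p x * p x) with ((u x * u x + p x * p x) *
      (sin (phi x) * sin (phi x) + cos (phi x) * cos (phi x))) by (rewrite H3; ring). ring. }
  assert (c0 : forall x, al <= x <= be -> c x = 0).
  { intros x Hx. assert (Ix := HI x Hx).
    (* the squared sine of the angle between the vector and the direction phi *)
    set (F := fun x => c x * c x / N x).
    assert (HF : F x = F al).
    { apply derive_zero_const; [lra|]. intros t Ht. assert (It : in_open a0 b0 t) by (apply HI; lra).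
      specialize (Hpos t It). destruct (Hd t It) as [H1 H2].
      unfold F. evar_last.
      - apply (is_derive_div (fun x => c x * c x) N t).
        + apply @is_derive_mult; [apply Dc; auto|apply Dc; auto|exact Rmult_comm].
        + apply is_derive_energy; [exact H1|exact H2].
        + unfold N. lra.
      - unfold plus, mult; simpl. unfold w.
        pose proof (cN t) as E. unfold N in E |- *.
        set (n := u t * u t + p t * p t) in *.
        assert (Hn : n <> 0) by lra.
        assert (P : n * (du t * cos (phi t) - dp t * sin (phi t))
                = (p t * du t - u t * dp t) * d t + (u t * du t + p t * dp t) * c t).
        { unfold n, c, d. ring. }
        replace (du t * cos (phi t) - dp t * sin (phi t))
          with (((p t * du t - u t * dp t) * d t + (u t * du t + p t * dp t) * c t) / n)
          by (rewrite <- P; field; auto).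
        field. auto. }
    assert (Fal : F al = 0).
    { unfold F, c. rewrite Hphi0, Hu0, Hp0.
      replace (r * sin phi0 * cos phi0 - r * cos phi0 * sin phi0) with 0 by ring.
      unfold Rdiv. ring. }
    rewrite Fal in HF. unfold F in HF. specialize (Hpos x Ix). fold (N x) in Hpos.
    assert (c x * c x = 0).
    { replace (c x * c x) with (c x * c x / N x * N x) by (field; lra). rewrite HF. ring. }
    apply Rmult_integral in H. tauto. }
  assert (Cd : forall x, in_open a0 b0 x -> continuity_pt d x).
  { intros x Ix. apply continuity_pt_filterlim. apply @ex_derive_continuous.
    destruct (Hd x Ix) as [H1 H2]. apply @ex_derive_plus; apply @ex_derive_mult.
    - eexists; exact H1.
    - eexists; exact (Dsin x Ix).
    - eexists; exact H2.
    - eexists; exact (Dcos x Ix). }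
  assert (dal : 0 < d al).
  { unfold d. rewrite Hphi0, Hu0, Hp0. pose proof (sin2_cos2 phi0) as H3. unfold Rsqr in H3.
    replace (r * sin phi0 * sin phi0 + r * cos phi0 * cos phi0)
      with (r * (sin phi0 * sin phi0 + cos phi0 * cos phi0)) by ring. rewrite H3. lra. }
  intros x Hx. split; [eexists; apply Dphi; auto|]. split.
  - specialize (c0 x Hx). unfold c in c0. lra.
  - destruct (Rlt_dec 0 (d x)) as [|Hn]; auto. exfalso.
    assert (Hne : forall t, al <= t <= be -> d t <> 0).
    { intros t Ht E. specialize (Hpos t (HI t Ht)). pose proof (cN t) as E2.
      rewrite E, (c0 t Ht) in E2. unfold N in E2. lra. }
    assert (Hdx : d x < 0) by (specialize (Hne x Hx); lra).
    destruct (Req_dec al x) as [->|Hne2]; [lra|].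
    destruct (IVT_interv (fun t => - d t) al x) as [z [Hz1 Hz2]]; try lra.
    + intros t Ht. apply (continuity_pt_opp d). apply Cd. apply HI. lra.
    + apply (Hne z); lra.
Qed.
(** * Solutions of the Sturm-Liouville equation *)

Lemma continuous_pos_min (f : R -> R) (a b : R) :
  a <= b -> (forall x, a <= x <= b -> continuous f x) ->
  (forall x, a <= x <= b -> 0 < f x) ->
  exists m, 0 < m /\ forall x, a <= x <= b -> m <= f x.
Proof.
  intros Hab Hf Hp.
  destruct (continuity_ab_min f a b) as [m [Hm Im]]; auto.
  - intros x Hx. apply continuity_pt_filterlim. apply (Hf x Hx).
  - exists (f m). split; auto.
Qed.

(** Either kind of boundary condition prescribes the direction of the vector formed by a
    function and its flux; the angle form treats the two kinds at once. The sign of the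
    constant confines the direction to a quadrant. *)
Lemma boundary_angle (h : Rbar) : Rbar_le 0 h ->
  exists phi0, 0 <= phi0 <= PI / 2 /\
    (forall c, h = Finite c -> sin phi0 <> 0) /\
    forall v p, match h with Finite c => p - c * v = 0 | p_infty => v = 0 | m_infty => False end
      <-> v * cos phi0 = p * sin phi0.
Proof.
  intros Hh. destruct h as [c| |]; simpl in Hh; [| |tauto].
  - exists (PI / 2 - atan c). pose proof (atan_bound c) as Hb.
    assert (Hc : 0 < cos (atan c)) by (apply cos_gt_0; lra).
    assert (Hs : sin (atan c) = c * cos (atan c)).
    { pose proof (tan_atan c) as H. unfold tan in H. rewrite <- H at 2. field. lra. }
    assert (0 <= atan c).
    { destruct (Req_dec c 0) as [->|Hn]; [rewrite atan_0; lra|].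
      rewrite <- atan_0. apply Rlt_le, atan_increasing. lra. }
    rewrite cos_shift, sin_shift. split; [lra|]. split; [intros; lra|].
    intros v p. rewrite Hs. split; intros H1.
    + replace p with (c * v) by lra. ring.
    + apply (Rmult_eq_reg_r (cos (atan c))); lra.
  - exists 0. rewrite cos_0, sin_0. pose proof PI_RGT_0. split; [lra|].
    split; [discriminate|]. intros v p. split; intros; lra.
Qed.

Lemma left_bc_angle (al : R) (h : Rbar) : Rbar_le 0 h ->
  exists phi0, 0 <= phi0 <= PI / 2 /\
    (forall c, h = Finite c -> sin phi0 <> 0) /\
    forall K V, left_bc al K h V <-> V al * cos phi0 = K al * Derive V al * sin phi0.
Proof.
  intros Hh. destruct (boundary_angle h Hh) as [phi0 [H1 [H2 H3]]].
  exists phi0. split; auto. split; auto. intros K V.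
  rewrite <- H3. destruct h; simpl; tauto.
Qed.

Lemma right_bc_angle (be : R) (H : Rbar) : Rbar_le 0 H ->
  exists gam, PI / 2 <= gam <= PI /\
    (forall c, H = Finite c -> sin gam <> 0) /\
    forall K V, right_bc be K H V <-> V be * cos gam = K be * Derive V be * sin gam.
Proof.
  intros HH. destruct (boundary_angle H HH) as [phi0 [H1 [H2 H3]]].
  assert (Hs : sin (PI - phi0) = sin phi0) by apply sin_PI_x.
  assert (Hc : cos (PI - phi0) = - cos phi0).
  { unfold Rminus. rewrite Rplus_comm, neg_cos, cos_neg. auto. }
  exists (PI - phi0). rewrite Hs, Hc. split; [lra|]. split; auto. intros K V.
  specialize (H3 (V be) (- (K be * Derive V be))).
  assert (E : V be * cos phi0 = - (K be * Derive V be) * sin phi0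
              <-> V be * - cos phi0 = K be * Derive V be * sin phi0) by (split; intros; lra).
  rewrite <- E, <- H3. destruct H; simpl; try tauto. lra.
Qed.

Section SturmLiouville.
Context {a0 b0 : Rbar} {K G L : R -> R}.
Local Notation I := (in_open a0 b0).
Context (CK : Cinf a0 b0 K) (CG : Cinf a0 b0 G) (CL : Cinf a0 b0 L).
Context (K_pos : positive_on a0 b0 K) (G_pos : positive_on a0 b0 G) (L_pos : positive_on a0 b0 L).

Lemma K_neq0 (x : R) : I x -> K x <> 0.
Proof. intros Hx. apply Rgt_not_eq, K_pos; auto. Qed.

Lemma Cinf_potential (r : R) : Cinf a0 b0 (fun x => L x - r * G x).
Proof.
  apply (Cinf_ext (fun x => L x + (- r) * G x)); [intros; ring|].
  apply Cinf_plus; auto. apply Cinf_mult; auto. apply Cinf_const.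
Qed.

Lemma Cinf_invK : Cinf a0 b0 (fun x => / K x).
Proof. apply Cinf_inv; auto using K_neq0. Qed.

Lemma SL_linear_system (r : R) (V : R -> R) : SL_equation a0 b0 K G L r V ->
  linear_system a0 b0 (fun x => / K x) (fun x => L x - r * G x) V (fun x => K x * Derive V x).
Proof.
  intros HV x Ix. destruct (HV x Ix) as [H1 [H2 H3]]. split.
  - replace (/ K x * (K x * Derive V x)) with (Derive V x) by (field; apply K_neq0; auto).
    apply Derive_correct; auto.
  - replace ((L x - r * G x) * V x) with (Derive (fun t => K t * Derive V t) x) by lra.
    apply Derive_correct; auto.
Qed.

Lemma linear_system_SL (r : R) (u p : R -> R) :
  linear_system a0 b0 (fun x => / K x) (fun x => L x - r * G x) u p ->
  SL_equation a0 b0 K G L r u /\ forall x, I x -> K x * Derive u x = p x.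
Proof.
  intros HS.
  assert (E : forall x, I x -> K x * Derive u x = p x).
  { intros x Ix. destruct (HS x Ix) as [H1 _].
    rewrite (is_derive_unique _ _ _ H1). field. apply K_neq0; auto. }
  split; auto. intros x Ix. destruct (HS x Ix) as [H1 H2].
  assert (LE : locally x (fun t => p t = K t * Derive u t)).
  { apply (locally_eq_on (a0 := a0) (b0 := b0)); auto. intros; symmetry; auto. }
  assert (D : is_derive (fun t => K t * Derive u t) x ((L x - r * G x) * u x))
    by (apply (is_derive_ext_loc p); auto).
  split; [eexists; eauto|]. split; [eexists; eauto|].
  replace (Derive (fun t => K t * Derive u t) x) with ((L x - r * G x) * u x)
    by (symmetry; apply is_derive_unique; exact D). ring.
Qed.

(** Bootstrapping: the equation expresses the derivative of the solution through the flux, and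
    that of the flux through the solution. *)
Lemma SL_Cinf (r : R) (V : R -> R) : SL_equation a0 b0 K G L r V -> Cinf a0 b0 V.
Proof.
  intros HV. apply SL_linear_system in HV.
  set (p := fun x => K x * Derive V x) in HV.
  assert (H : forall n, Ck (a0 := a0) (b0 := b0) n V /\ Ck (a0 := a0) (b0 := b0) n p).
  { induction n as [|n [IH1 IH2]]; [simpl; auto|]. split; split.
    - intros x Ix. destruct (HV x Ix) as [D _]. eexists. exact D.
    - apply (Ck_ext n (fun x => / K x * p x)).
      + intros x Ix. symmetry. apply is_derive_unique. apply (HV x Ix).
      + apply Ck_mult; auto. apply Cinf_invK.
    - intros x Ix. destruct (HV x Ix) as [_ D]. eexists. exact D.
    - apply (Ck_ext n (fun x => (L x - r * G x) * V x)).
      + intros x Ix. symmetry. apply is_derive_unique. apply (HV x Ix).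
      + apply Ck_mult; auto. apply (Cinf_potential r). }
  intros n. apply H.
Qed.

Lemma SL_unique (r : R) (u p v q : R -> R) (a x : R) :
  linear_system a0 b0 (fun x => / K x) (fun x => L x - r * G x) u p ->
  linear_system a0 b0 (fun x => / K x) (fun x => L x - r * G x) v q ->
  I a -> I x -> u a = v a -> p a = q a -> u x = v x /\ p x = q x.
Proof.
  intros H1 H2 Ia Ix E1 E2.
  destruct (linear_system_unique (a0 := a0) (b0 := b0) (fun x => / K x) (fun x => L x - r * G x)
    (fun t => u t - v t) (fun t => p t - q t) a x) as [F1 F2]; auto.
  - intros t It. apply (Cinf_continuous (a0 := a0) (b0 := b0)); auto using Cinf_invK.
  - intros t It. apply (Cinf_continuous (a0 := a0) (b0 := b0)); auto using Cinf_potential.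
  - intros t It. destruct (H1 t It) as [D1 D2]. destruct (H2 t It) as [D3 D4]. split.
    + evar_last; [apply @is_derive_minus; [exact D1|exact D3]|].
      unfold minus, plus, opp; simpl. ring.
    + evar_last; [apply @is_derive_minus; [exact D2|exact D4]|].
      unfold minus, plus, opp; simpl. ring.
  - lra.
  - lra.
  - lra.
Qed.

Lemma zero_linear_system (A B : R -> R) : linear_system a0 b0 A B (fun _ => 0) (fun _ => 0).
Proof.
  intros x _. rewrite !Rmult_0_r. split; apply @is_derive_const.
Qed.

Lemma solution_norm_pos (r : R) (u p : R -> R) (a x : R) :
  linear_system a0 b0 (fun x => / K x) (fun x => L x - r * G x) u p ->
  I a -> I x -> 0 < u a * u a + p a * p a -> 0 < u x * u x + p x * p x.
Proof.
  intros H1 Ia Ix Hpos.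
  destruct (Rlt_dec 0 (u x * u x + p x * p x)) as [|Hn]; auto. exfalso.
  destruct (energy_zero (u x) (p x)) as [E1 E2]; [lra|].
  destruct (SL_unique r u p (fun _ => 0) (fun _ => 0) x a H1
             (zero_linear_system _ _) Ix Ia E1 E2) as [F1 F2].
  rewrite F1, F2 in Hpos. lra.
Qed.

Context {al be : R} (Ial : I al) (Ibe : I be) (al_lt_be : al < be).

Lemma segment_in (x : R) : al <= x <= be -> I x.
Proof. intros Hx. apply (in_open_between al be); auto. Qed.

(** ** Shooting *)

Section Shooting.
Context {phi0 : R} (phi0_range : 0 <= phi0 <= PI / 2).
Context {u p Phi : R -> R -> R}.
Context (HS : forall r, linear_system a0 b0 (fun x => / K x) (fun x => L x - r * G x) (u r) (p r)).
Context (Hu : forall r, u r al = sin phi0) (Hp : forall r, p r al = cos phi0).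
Context (HPhi : forall r, angle al be (u r) (p r) (Phi r)) (HPhi0 : forall r, Phi r al = phi0).

Lemma shooting_norm_pos (r x : R) : I x -> 0 < u r x * u r x + p r x * p r x.
Proof.
  intros Ix. apply (solution_norm_pos r _ _ al); auto.
  rewrite Hu, Hp. pose proof (sin2_cos2 phi0) as H. unfold Rsqr in H. lra.
Qed.

(** For a nonpositive parameter the potential is positive and the angle crosses [PI / 2] only
    downwards. *)
Lemma final_angle_nonpos (r : R) : r <= 0 -> Phi r be < PI / 2.
Proof.
  intros Hr.
  assert (H : - (PI / 2) < - Phi r be); [|lra].
  apply (barrier (fun x => - Phi r x) al be (- (PI / 2))); try lra.
  - intros x Hx. destruct (HPhi r x Hx) as [D _]. auto_derive. exact D.
  - intros x Hx He. rewrite Derive_opp.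
    assert (Ix := segment_in x Hx). destruct (HS r x Ix) as [D1 D2].
    pose proof (angle_derive _ _ al_lt_be _ _ _ _ _ _ (HPhi r) Hx D1 D2) as D.
    destruct (angle_polar _ _ _ _ _ _ (HPhi r) Hx) as [d [Hd [E1 E2]]].
    pose proof (shooting_norm_pos r x Ix) as P.
    assert (E : Phi r x = PI / 2) by lra. rewrite E in E1, E2.
    rewrite sin_PI2 in E1. rewrite cos_PI2 in E2.
    rewrite E2 in D. rewrite E2 in P.
    assert (Hq : 0 < L x - r * G x).
    { pose proof (L_pos x Ix). pose proof (G_pos x Ix). nra. }
    apply (Rmult_lt_reg_r (u r x * u r x + d * 0 * (d * 0))); auto.
    rewrite Rmult_0_l.
    replace (- Derive (Phi r) x * (u r x * u r x + d * 0 * (d * 0)))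
      with (- (Derive (Phi r) x * (u r x * u r x + d * 0 * (d * 0)))) by ring.
    rewrite D, E1.
    replace (- (d * 0 * (/ K x * (d * 0)) - d * 1 * ((L x - r * G x) * (d * 1))))
      with (d * d * (L x - r * G x)) by ring.
    apply Rmult_lt_0_compat; auto. nra.
  - rewrite HPhi0. lra.
Qed.

(** Near a given parameter the angle differs from the given one by a small arctangent. *)
Lemma final_angle_continuous : continuity (fun r => Phi r be).
Proof.
  intros r. apply continuity_pt_filterlim.
  assert (CA : forall x, I x -> continuous (fun x => / K x) x)
    by (intros x Ix; apply (Cinf_continuous (a0 := a0) (b0 := b0)); auto using Cinf_invK).
  assert (CB : forall x, I x -> continuous (fun x => L x - r * G x) x)
    by (intros x Ix; apply (Cinf_continuous (a0 := a0) (b0 := b0)); auto using Cinf_potential).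
  assert (Cg : forall x, I x -> continuous (fun x => (-1) * G x) x).
  { intros x Ix; apply (Cinf_continuous (a0 := a0) (b0 := b0)); auto.
    apply Cinf_mult; auto. apply Cinf_const. }
  destruct (linear_system_perturb _ _ (fun x => (-1) * G x) _ _ al be CA CB Cg (HS r)
              Ial Ibe (Rlt_le _ _ al_lt_be)) as [C [HC Hpert]].
  assert (Near : forall s, Rabs (s - r) <= 1 -> forall x, al <= x <= be ->
      (u s x - u r x) * (u s x - u r x) + (p s x - p r x) * (p s x - p r x)
        <= C * ((s - r) * (s - r))).
  { intros s Hs x Hx. apply Hpert; auto.
    - intros t It. destruct (HS s t It) as [D1 D2]. split; auto.
      replace (L t - r * G t + (s - r) * (-1 * G t)) with (L t - s * G t) by ring. auto.
    - rewrite !Hu; auto.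
    - rewrite !Hp; auto. }
  destruct (continuous_pos_min (fun x => u r x * u r x + p r x * p r x) al be)
    as [m [Hm Hmin]]; [lra| | |].
  { intros x Hx. destruct (HS r x (segment_in x Hx)) as [D1 D2].
    apply @ex_derive_continuous. eexists. apply is_derive_energy; [exact D1|exact D2]. }
  { intros x Hx. apply shooting_norm_pos. apply segment_in; auto. }
  set (cr := fun s => u s be * p r be - p s be * u r be).
  set (dt := fun s => p r be * p s be + u r be * u s be).
  assert (Heta : exists eta : posreal, eta <= 1 /\ C * (eta * eta) < m).
  { set (e := Rmin 1 (m / (2 * C))).
    assert (He0 : 0 < m / (2 * C)) by (apply Rdiv_lt_0_compat; lra).
    assert (He : 0 < e) by (apply Rmin_glb_lt; lra).
    pose proof (Rmin_l 1 (m / (2 * C))) as H1. pose proof (Rmin_r 1 (m / (2 * C))) as H2.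
    fold e in H1, H2. exists (mkposreal e He). simpl. split; auto.
    apply Rle_lt_trans with (C * e).
    - apply Rmult_le_compat_l; [lra|]. nra.
    - apply Rle_lt_trans with (C * (m / (2 * C))).
      + apply Rmult_le_compat_l; lra.
      + replace (C * (m / (2 * C))) with (m / 2) by (field; lra). lra. }
  destruct Heta as [eta [Heta1 Heta2]].
  assert (Loc : locally r (fun s => Phi r be + atan (cr s / dt s) = Phi s be)).
  { exists eta. intros s Hs.
    assert (Hs' : Rabs (s - r) < eta) by exact Hs.
    assert (Hsq : (s - r) * (s - r) <= eta * eta).
    { rewrite <- (Rabs_pos_eq ((s - r) * (s - r))) by apply Rle_0_sqr.
      rewrite Rabs_mult. apply Rmult_le_compat; try apply Rabs_pos; lra. }
    assert (A2 : angle al be (u s) (p s) (fun x => Phi r x + atan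
        ((u s x * p r x - p s x * u r x) / (p r x * p s x + u r x * u s x)))).
    { apply angle_perturb; auto.
      - intros x Hx. assert (Ix := segment_in x Hx).
        destruct (HS r x Ix) as [D1 D2]. destruct (HS s x Ix) as [D3 D4].
        repeat split; eexists; eassumption.
      - intros x Hx.
        assert (N1 : (u s x - u r x) * (u s x - u r x) + (p s x - p r x) * (p s x - p r x) < m).
        { eapply Rle_lt_trans; [apply Near; auto; lra|].
          eapply Rle_lt_trans; [|exact Heta2]. apply Rmult_le_compat_l; lra. }
        specialize (Hmin x Hx). simpl in Hmin.
        assert (0 <= (u s x * u s x + p s x * p s x))
          by (apply Rplus_le_le_0_compat; apply Rle_0_sqr). lra. }
    symmetry.
    apply (angle_unique al be al_lt_be (u s) (p s)
            (fun x => / K x * p s x) (fun x => (L x - s * G x) * u s x) _ _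
            (fun x Hx => HS s x (segment_in x Hx)) (HPhi s) A2).
    rewrite !HPhi0, !Hu, !Hp. replace (sin phi0 * cos phi0 - cos phi0 * sin phi0) with 0 by ring.
    unfold Rdiv. rewrite Rmult_0_l, atan_0. ring. }
  change (continuous (fun s => Phi s be) r).
  apply (continuous_ext_loc (fun s => Phi s be) (fun s => Phi r be + atan (cr s / dt s)) r Loc).
  assert (Lip : forall f : R -> R, (forall s, Rabs (s - r) <= 1 ->
            (f s - f r) * (f s - f r) <= C * ((s - r) * (s - r))) -> continuous f r).
  { intros f Hf. apply continuity_pt_filterlim. intros eps Heps.
    set (e := Rmin 1 (eps / (C + 1))).
    assert (He0 : 0 < eps / (C + 1)) by (apply Rdiv_lt_0_compat; lra).
    assert (He : 0 < e) by (apply Rmin_glb_lt; lra).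
    pose proof (Rmin_l 1 (eps / (C + 1))) as H1. pose proof (Rmin_r 1 (eps / (C + 1))) as H2.
    fold e in H1, H2. exists e. split; auto. intros s [_ Hs].
    change (Rabs (s - r) < e) in Hs. change (Rabs (f s - f r) < eps).
    assert (Hfs := Hf s (Rle_trans _ _ _ (Rlt_le _ _ Hs) H1)).
    assert (Q : Rabs (f s - f r) <= Rabs ((C + 1) * (s - r))).
    { apply Rsqr_le_abs_0. unfold Rsqr. eapply Rle_trans; [exact Hfs|].
      replace ((C + 1) * (s - r) * ((C + 1) * (s - r)))
        with ((C + 1) * (C + 1) * ((s - r) * (s - r))) by ring.
      apply Rmult_le_compat_r; [apply Rle_0_sqr|nra]. }
    rewrite Rabs_mult, (Rabs_pos_eq (C + 1)) in Q by lra.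
    apply Rle_lt_trans with ((C + 1) * Rabs (s - r)); auto.
    apply Rlt_le_trans with ((C + 1) * e); [apply Rmult_lt_compat_l; lra|].
    apply Rle_trans with ((C + 1) * (eps / (C + 1))); [apply Rmult_le_compat_l; lra|].
    right. field. lra. }
  assert (Cu : continuous (fun s => u s be) r).
  { apply Lip. intros s Hs. pose proof (Near s Hs be) as N1.
    pose proof (Rle_0_sqr (p s be - p r be)) as N2. unfold Rsqr in N2. lra. }
  assert (Cp : continuous (fun s => p s be) r).
  { apply Lip. intros s Hs. pose proof (Near s Hs be) as N1.
    pose proof (Rle_0_sqr (u s be - u r be)) as N2. unfold Rsqr in N2. lra. }
  apply (continuous_plus (V := R_NormedModule)); [apply continuous_const|].
  apply (continuous_comp (fun s => cr s / dt s) atan).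
  - apply (continuous_mult (K := R_AbsRing)).
    + apply (continuous_minus (V := R_NormedModule)); apply (continuous_mult (K := R_AbsRing));
        auto; apply continuous_const.
    + apply (continuous_comp dt Rinv).
      * apply (continuous_plus (V := R_NormedModule)); apply (continuous_mult (K := R_AbsRing));
        auto; apply continuous_const.
      * apply continuous_Rinv. unfold dt. pose proof (shooting_norm_pos r be Ibe). lra.
  - apply @ex_derive_continuous. eexists. apply is_derive_atan.
Qed.
End Shooting.

Lemma shooting_family (phi0 : R) : exists u p Phi : R -> R -> R,
  (forall r, linear_system a0 b0 (fun x => / K x) (fun x => L x - r * G x) (u r) (p r)) /\
  (forall r, u r al = sin phi0) /\ (forall r, p r al = cos phi0) /\
  (forall r, angle al be (u r) (p r) (Phi r)) /\ (forall r, Phi r al = phi0).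
Proof.
  assert (E : forall r, { s : (R -> R) * (R -> R) * (R -> R) |
    linear_system a0 b0 (fun x => / K x) (fun x => L x - r * G x) (fst (fst s)) (snd (fst s)) /\
    fst (fst s) al = sin phi0 /\ snd (fst s) al = cos phi0 /\
    angle al be (fst (fst s)) (snd (fst s)) (snd s) /\ snd s al = phi0 }).
  { intros r. apply constructive_indefinite_description.
    assert (CA : forall x, I x -> continuous (fun x => / K x) x)
      by (intros x Ix; apply (Cinf_continuous (a0 := a0) (b0 := b0)); auto using Cinf_invK).
    assert (CB : forall x, I x -> continuous (fun x => L x - r * G x) x)
      by (intros x Ix; apply (Cinf_continuous (a0 := a0) (b0 := b0)); auto using Cinf_potential).
    destruct (linear_system_exists (a0 := a0) (b0 := b0) _ _ al (sin phi0) (cos phi0) CA CB Ial)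
      as [u [p [HS [Hu Hp]]]].
    destruct (angle_exists (a0 := a0) (b0 := b0) al be phi0 1 u p
      (fun x => / K x * p x) (fun x => (L x - r * G x) * u x)) as [phi [HA Hphi]]; auto; try lra.
    - intros x Ix. destruct (HS x Ix) as [D1 D2].
      split; apply (continuous_mult (K := R_AbsRing)); auto;
        apply @ex_derive_continuous; eexists; eassumption.
    - intros x Ix. apply (solution_norm_pos r u p al x); auto. rewrite Hu, Hp.
      pose proof (sin2_cos2 phi0) as E. unfold Rsqr in E. lra.
    - exists (u, p, phi). simpl. auto. }
  exists (fun r => fst (fst (proj1_sig (E r)))), (fun r => snd (fst (proj1_sig (E r)))),
         (fun r => snd (proj1_sig (E r))).
  split; [|split; [|split; [|split]]]; intros r;
    destruct (proj2_sig (E r)) as [H1 [H2 [H3 [H4 H5]]]]; assumption.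
Qed.

Context {h H : Rbar} {rho : nat -> R}.
Context (rho_seq : eigenvalue_sequence a0 b0 al be K G L h H rho).
Context {phi0 gam : R} (phi0_range : 0 <= phi0 <= PI / 2) (gam_range : PI / 2 <= gam <= PI).
Context (left_bcE : forall V, left_bc al K h V <-> V al * cos phi0 = K al * Derive V al * sin phi0).
Context (right_bcE : forall V, right_bc be K H V <-> V be * cos gam = K be * Derive V be * sin gam).

Lemma final_angle_eigenvalue (r : R) (i : nat) (u p phi : R -> R) :
  linear_system a0 b0 (fun x => / K x) (fun x => L x - r * G x) u p ->
  u al = sin phi0 -> p al = cos phi0 -> angle al be u p phi ->
  phi be = gam + INR i * PI ->
  eigenvalue a0 b0 al be K G L h H r.
Proof.
  intros HS Hu Hp HA Hphi.
  destruct (linear_system_SL r u p HS) as [HSL HKu].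
  exists u. split; auto. rewrite left_bcE, right_bcE, !HKu by auto. split; [|split].
  - rewrite Hu, Hp. ring.
  - destruct (angle_polar _ _ _ _ _ be HA) as [d [Hd [E1 E2]]]; [lra|].
    assert (S0 : sin (phi be - gam) = 0).
    { apply sin_eq_0_1. exists (Z.of_nat i). rewrite <- INR_IZR_INZ, Hphi. ring. }
    rewrite sin_minus in S0. rewrite E1, E2.
    apply Rminus_diag_uniq.
    replace (d * sin (phi be) * cos gam - d * cos (phi be) * sin gam)
      with (d * (sin (phi be) * cos gam - cos (phi be) * sin gam)) by ring.
    rewrite S0. ring.
  - destruct (excluded_middle_informative (exists x, al <= x <= be /\ u x <> 0)) as [E|E]; auto.
    exfalso.
    assert (Z : forall x, al <= x <= be -> u x = 0).
    { intros x Hx. destruct (Req_dec (u x) 0); auto. exfalso. eauto. }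
    assert (D0 : Derive u al = 0).
    { apply (Derive_zero_on_segment u al be); auto; [lra|].
      destruct (HS al Ial) as [D _]. eexists. exact D. }
    specialize (HKu al Ial). rewrite D0 in HKu.
    assert (U0 : u al = 0) by (apply Z; lra).
    pose proof (sin2_cos2 phi0) as S2. unfold Rsqr in S2.
    rewrite <- Hu, <- Hp, U0, <- HKu in S2. lra.
Qed.

(** If the final angle of the [n]-th eigenfunction exceeded [n * PI], the final angle of the
    shooting solutions, continuous in the parameter and below [PI / 2] for nonpositive
    parameters, would pass through [gam + i * PI] for [i < n]: that makes [n] distinct
    eigenvalues below [rho n]. *)
Lemma final_angle_le (n : nat) (u p Phi : R -> R -> R) : (1 <= n)%nat ->
  (forall r, linear_system a0 b0 (fun x => / K x) (fun x => L x - r * G x) (u r) (p r)) ->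
  (forall r, u r al = sin phi0) -> (forall r, p r al = cos phi0) ->
  (forall r, angle al be (u r) (p r) (Phi r)) -> (forall r, Phi r al = phi0) ->
  Phi (rho n) be <= INR n * PI.
Proof.
  intros Hn HS Hu Hp HPhi HPhi0.
  destruct (Rle_dec (Phi (rho n) be) (INR n * PI)) as [|Hgt]; auto. exfalso.
  apply Rnot_le_lt in Hgt. pose proof PI_RGT_0 as Hpi.
  destruct rho_seq as [Hinc Hall].
  assert (Hcont : continuity (fun r => Phi r be)) by (apply (final_angle_continuous HS Hu Hp HPhi HPhi0)).
  assert (E : forall i, { j | (i < n)%nat ->
             (1 <= j < n)%nat /\ Phi (rho j) be = gam + INR i * PI }).
  { intros i. apply constructive_indefinite_description.
    destruct (Nat.lt_ge_cases i n) as [Hi|Hi]; [|exists 0%nat; intros; lia].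
    set (lo := Rmin 0 (rho n)).
    assert (Hlo : Phi lo be < PI / 2).
    { apply (final_angle_nonpos phi0_range HS Hu Hp HPhi HPhi0). apply Rmin_l. }
    assert (Hi1 : INR i + 1 <= INR n) by (rewrite <- S_INR; apply le_INR; lia).
    assert (Hi0 : 0 <= INR i) by apply pos_INR.
    assert (B1 : PI / 2 <= gam + INR i * PI) by nra.
    assert (B2 : gam + INR i * PI <= INR n * PI) by nra.
    destruct (IVT_gen (fun r => Phi r be) lo (rho n) (gam + INR i * PI)) as [r [Hr1 Hr2]]; auto.
    { rewrite Rmin_left, Rmax_right by lra. lra. }
    simpl in Hr2. rewrite Rmin_left, Rmax_right in Hr1 by apply Rmin_r.
    assert (Hrn : r < rho n).
    { destruct (Req_dec r (rho n)) as [->|]; lra. }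
    destruct (proj1 (Hall r)) as [j [Hj1 Hj2]].
    { apply (final_angle_eigenvalue r i (u r) (p r) (Phi r)); auto. }
    exists j. intros _. subst r. split; auto. split; auto.
    destruct (Nat.lt_ge_cases j n) as [|Hge]; auto. exfalso.
    destruct (Nat.eq_dec j n) as [->|Hne]; [lra|].
    assert (rho n < rho j) by (apply Hinc; lia). lra. }
  set (f := fun i => proj1_sig (E i)).
  assert (Hf : forall i, (i < n)%nat -> (1 <= f i < n)%nat /\ Phi (rho (f i)) be = gam + INR i * PI)
    by (intros i; apply (proj2_sig (E i))).
  assert (ND : NoDup (map f (seq 0 n))).
  { apply NoDup_map_NoDup_ForallPairs; [|apply seq_NoDup].
    intros i j Hi Hj He. apply in_seq in Hi. apply in_seq in Hj.
    destruct (Hf i) as [_ F1]; [lia|]. destruct (Hf j) as [_ F2]; [lia|].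
    rewrite He, F2 in F1. apply INR_eq. apply (Rmult_eq_reg_r PI); lra. }
  assert (Len : (length (map f (seq 0 n)) <= length (seq 1 (n - 1)))%nat).
  { apply NoDup_incl_length; auto. intros y Hy. apply in_map_iff in Hy.
    destruct Hy as [i [<- Hi]]. apply in_seq in Hi. apply in_seq.
    destruct (Hf i) as [F1 _]; [lia|]. lia. }
  rewrite length_map, !length_seq in Len. lia.
Qed.

Lemma eigenfunction_angle (n : nat) (V : R -> R) : (1 <= n)%nat ->
  eigenfunction a0 b0 al be K G L h H (rho n) V ->
  exists s phi, s <> 0 /\
    angle al be (fun x => s * V x) (fun x => s * (K x * Derive V x)) phi /\
    phi al = phi0 /\ phi be <= INR n * PI.
Proof.
  intros Hn [HV [HL [_ [x0 [Hx0 HV0]]]]].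
  apply left_bcE in HL. apply SL_linear_system in HV.
  set (q := fun x => K x * Derive V x) in *.
  destruct (polar_coordinates _ _ _ HL) as [E1 E2].
  set (d := V al * sin phi0 + K al * Derive V al * cos phi0) in *.
  assert (Hd : d <> 0).
  { intros Hd. rewrite Hd in E1, E2. apply HV0.
    apply (SL_unique (rho n) V q (fun _ => 0) (fun _ => 0) al x0); auto.
    - apply zero_linear_system.
    - apply segment_in; auto.
    - lra.
    - unfold q. lra. }
  destruct (shooting_family phi0) as [u [p [Phi [HS [Hu [Hp [HPhi HPhi0]]]]]]].
  exists (/ d), (Phi (rho n)). split; [apply Rinv_neq_0_compat; auto|].
  split; [|split; auto].
  2: { apply (final_angle_le n u p Phi); auto. }
  assert (HdV : linear_system a0 b0 (fun x => / K x) (fun x => L x - rho n * G x)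
                  (fun x => / d * V x) (fun x => / d * q x)).
  { intros x Ix. destruct (HV x Ix) as [D1 D2]. split.
    - replace (/ K x * (/ d * q x)) with (/ d * (/ K x * q x)) by ring.
      apply is_derive_scal. exact D1.
    - replace ((L x - rho n * G x) * (/ d * V x)) with (/ d * ((L x - rho n * G x) * V x)) by ring.
      apply is_derive_scal. exact D2. }
  intros x Hx.
  destruct (SL_unique (rho n) _ _ _ _ al x (HS (rho n)) HdV Ial (segment_in x Hx)) as [F1 F2].
  - rewrite Hu, E1. field. auto.
  - rewrite Hp. unfold q. rewrite E2. field. auto.
  - destruct (HPhi (rho n) x Hx) as [A1 [A2 A3]]. unfold q in F2.
    rewrite F1, F2 in A2, A3. auto.
Qed.

End SturmLiouville.
(** * Rolle's theorem for lists of zeros with multiplicities *)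

Fixpoint chain (f : R -> R) (a : R) (l : list (R * nat)) (b : R) : Prop :=
  match l with
  | nil => True
  | (x, k) :: l' => a < x < b /\ vanish k f x /\ chain f x l' b
  end.

Fixpoint total (l : list (R * nat)) : nat :=
  match l with
  | nil => O
  | (_, k) :: l' => (k + total l')%nat
  end.

Lemma chain_weaken (f : R -> R) (a a' b : R) (l : list (R * nat)) :
  a' <= a -> chain f a l b -> chain f a' l b.
Proof.
  destruct l as [|[x k] l]; simpl; auto. intros Ha [H1 H2]. split; auto. lra.
Qed.

Section RolleChain.
Context {F D : R -> R} {S : R -> Prop} {al be : R}.
Context (HR : forall x y, al <= x -> x < y -> y <= be -> S x -> S y -> exists z, x < z < y /\ D z = 0).
Context (HV : forall x k, al < x < be -> vanish (Datatypes.S k) F x -> S x /\ vanish k D x).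

(** Between consecutive zeros lies a new one, and a zero of multiplicity [k + 1] leaves
    one of multiplicity [k]; the zero at the left end [x0] pays for the loss. *)
Lemma chain_Rolle (e : bool) : (e = true -> S be) ->
  forall l x0, al <= x0 < be -> S x0 -> chain F x0 l be ->
  exists l', chain D x0 l' be /\ total l' = (total l + Nat.b2n e)%nat.
Proof.
  intros He. induction l as [|[x k] l IH]; intros x0 Hx0 S0 HC.
  - destruct e.
    + destruct (HR x0 be) as [z [Hz Dz]]; auto; try lra.
      exists ((z, 1%nat) :: nil). simpl. auto.
    + exists nil. simpl. auto.
  - destruct HC as [Hx [Hk HC]]. destruct k as [|k].
    + destruct (IH x0) as [l' [H1 H2]]; auto.
      { apply (chain_weaken F x); auto. lra. }
      exists l'. auto.
    + destruct (HV x k) as [Sx Dk]; auto; [lra|].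
      destruct (IH x) as [l' [H1 H2]]; auto; [lra|].
      destruct (HR x0 x) as [z [Hz Dz]]; auto; try lra.
      exists ((z, 1%nat) :: (x, k) :: l'). split.
      * simpl. repeat split; auto; lra.
      * simpl. rewrite H2. lia.
Qed.

Lemma chain_Rolle_free (e : bool) : (e = true -> S be) ->
  forall l x0, al <= x0 < be -> chain F x0 l be ->
  exists l', chain D x0 l' be /\ (total l + Nat.b2n e <= total l' + 1)%nat.
Proof.
  intros He. induction l as [|[x k] l IH]; intros x0 Hx0 HC.
  - exists nil. simpl. split; auto. destruct e; simpl; lia.
  - destruct HC as [Hx [Hk HC]]. destruct k as [|k].
    + destruct (IH x0) as [l' [H1 H2]]; auto.
      { apply (chain_weaken F x); auto. lra. }
      exists l'. auto.
    + destruct (HV x k) as [Sx Dk]; auto; [lra|].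
      destruct (chain_Rolle e He l x) as [l' [H1 H2]]; auto; [lra|].
      exists ((x, k) :: l'). simpl. split; [auto|]. rewrite H2. lia.
Qed.

End RolleChain.

(** * Sturm's step *)

Section SturmStep.
Context {a0 b0 : Rbar} {K G q : R -> R}.
Local Notation I := (in_open a0 b0).
Context (CK : Cinf a0 b0 K) (CG : Cinf a0 b0 G) (Cq : Cinf a0 b0 q).
Context (K_pos : positive_on a0 b0 K) (G_pos : positive_on a0 b0 G).
Context {al be phi0 gam : R} (Ial : I al) (Ibe : I be) (al_lt_be : al < be).

(** Reduced number of zeros at least [M]. The sine of the boundary angle vanishes exactly for a
    Dirichlet condition, in which case the end point does not count. *)
Definition reduced_zeros (U : R -> R) (M : nat) : Prop :=
  exists l a b, chain U al l be /\
    ((0 < a)%nat -> sin phi0 <> 0 /\ vanish (2 * a) U al) /\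
    ((0 < b)%nat -> sin gam <> 0 /\ vanish (2 * b) U be) /\
    (M <= total l + a + b)%nat.

(** [W] is, up to the weight [G], the image of [U] under the operator [- (K U')' + q U]. *)
Definition sourced (U W : R -> R) : Prop :=
  Cinf a0 b0 U /\ Cinf a0 b0 W /\
  forall x, I x -> is_derive (fun t => K t * Derive U t) x (q x * U x - G x * W x).

Lemma sourced_flux_Cinf (U W : R -> R) : sourced U W -> Cinf a0 b0 (fun t => K t * Derive U t).
Proof. intros [HU _]. apply Cinf_mult; auto using Cinf_Derive. Qed.

(** Along the equation, two orders of vanishing of [U] correspond to the orders of vanishing of
    its image [W]; this lemma and [vanish_of_source] are the two directions. *)
Lemma vanish_source (k : nat) (U W : R -> R) (x : R) : sourced U W -> I x ->
  vanish (S (S k)) U x -> vanish k W x.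
Proof.
  intros HS Ix HV. pose proof (sourced_flux_Cinf U W HS) as CP. destruct HS as [HU [HW HD]].
  apply (vanish_cancel (a0 := a0) (b0 := b0) k G); auto.
  { apply Rgt_not_eq, G_pos; auto. }
  apply (vanish_ext (a0 := a0) (b0 := b0) k
    (fun t => q t * U t + (-1) * Derive (fun t => K t * Derive U t) t)); auto.
  { intros t It.
    replace (Derive (fun t => K t * Derive U t) t) with (q t * U t - G t * W t)
      by (symmetry; apply is_derive_unique; auto). ring. }
  apply (vanish_plus (a0 := a0) (b0 := b0)); auto using Cinf_mult, Cinf_const, Cinf_Derive.
  - apply (vanish_mult (a0 := a0) (b0 := b0)); auto. apply (vanish_le (S (S k))); auto.
  - apply (vanish_mult (a0 := a0) (b0 := b0)); auto using Cinf_const, Cinf_Derive.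
    assert (H : vanish (S k) (fun t => K t * Derive U t) x).
    { apply (vanish_mult (a0 := a0) (b0 := b0)); auto using Cinf_Derive. apply HV. }
    apply H.
Qed.

Lemma vanish_of_source (k : nat) (U W : R -> R) (x : R) : sourced U W -> I x ->
  U x = 0 -> Derive U x = 0 -> vanish k W x -> vanish (S (S k)) U x.
Proof.
  intros HS Ix U0 U1. pose proof (sourced_flux_Cinf U W HS) as CP. destruct HS as [HU [HW HD]].
  induction k as [|k IH]; intros HV.
  - simpl. auto.
  - assert (IH' : vanish (S (S k)) U x) by (apply IH; apply (vanish_le (S k)); auto).
    split; auto.
    apply (vanish_cancel (a0 := a0) (b0 := b0) _ K); auto using Cinf_Derive.
    { apply Rgt_not_eq, K_pos; auto. }
    split; [rewrite U1; ring|].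
    apply (vanish_ext (a0 := a0) (b0 := b0) (S k) (fun t => q t * U t + ((-1) * G t) * W t)); auto.
    { intros t It. symmetry. apply is_derive_unique. evar_last; [apply HD; auto|]. ring. }
    apply (vanish_plus (a0 := a0) (b0 := b0)); auto using Cinf_mult, Cinf_const.
    + apply (vanish_mult (a0 := a0) (b0 := b0)); auto. apply (vanish_le (S (S k))); auto.
    + apply (vanish_mult (a0 := a0) (b0 := b0)); auto using Cinf_mult, Cinf_const.
Qed.

Lemma wronskian_zero (t u1 p1 u2 p2 : R) :
  u1 * cos t = p1 * sin t -> u2 * cos t = p2 * sin t -> p1 * u2 - u1 * p2 = 0.
Proof.
  intros H1 H2. destruct (polar_coordinates _ _ _ H1) as [E1 E2].
  destruct (polar_coordinates _ _ _ H2) as [E3 E4].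
  set (d1 := u1 * sin t + p1 * cos t) in *. set (d2 := u2 * sin t + p2 * cos t) in *.
  rewrite E1, E2, E3, E4. ring.
Qed.

(** The quotient [U / V] and the Wronskian [K (U' V - U V')], which vanishes at both ends,
    carry the zeros of [U] to those of [W] by two applications of Rolle's theorem: one zero
    is lost in the first, two are gained from the boundary conditions, one is lost again.
    A zero of [U] of multiplicity [2 * a] at a non-Dirichlet end point leaves one of
    multiplicity [2 * a - 2] for [W], and is one more zero for the first application of
    Rolle's theorem, which makes up for the lost unit. *)
Lemma sturm_step (U W V : R -> R) (M : nat) : sourced U W -> sourced V (fun _ => 0) ->
  (forall x, al < x < be -> V x <> 0) ->
  U al * cos phi0 = K al * Derive U al * sin phi0 ->
  V al * cos phi0 = K al * Derive V al * sin phi0 ->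
  U be * cos gam = K be * Derive U be * sin gam ->
  V be * cos gam = K be * Derive V be * sin gam ->
  (sin phi0 <> 0 -> V al <> 0) -> (sin gam <> 0 -> V be <> 0) ->
  reduced_zeros U M -> reduced_zeros W M.
Proof.
  intros HU HV HV0 Ual Val Ube Vbe HVal HVbe [l [a [b [Hl [Ha [Hb HM]]]]]].
  pose proof (sourced_flux_Cinf U W HU) as CPU. pose proof (sourced_flux_Cinf V _ HV) as CPV.
  assert (CU : Cinf a0 b0 U) by apply HU. assert (CV : Cinf a0 b0 V) by apply HV.
  assert (CW : Cinf a0 b0 W) by apply HU.
  assert (HI : forall x, al <= x <= be -> I x)
    by (intros x Hx; apply (in_open_between al be); auto).
  set (Z := fun x => V x * (K x * Derive U x) + ((-1) * (K x * Derive V x)) * U x).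
  assert (CZ : Cinf a0 b0 Z) by (unfold Z; auto using Cinf_plus, Cinf_mult, Cinf_const).
  assert (DZ : forall x, I x -> is_derive Z x (((-1) * G x * V x) * W x)).
  { intros x Ix. destruct HU as [_ [_ HU]]. destruct HV as [_ [_ HV]]. unfold Z.
    evar_last.
    - apply @is_derive_plus; apply @is_derive_mult;
        [apply Derive_correct; apply (Cinf_ex_derive V x CV Ix)|apply (HU x Ix)|exact Rmult_comm
        |apply is_derive_scal; apply (HV x Ix)|apply Derive_correct; apply (Cinf_ex_derive U x CU Ix)
        |exact Rmult_comm].
    - unfold plus, mult; simpl. ring. }
  assert (Zal : Z al = 0).
  { pose proof (wronskian_zero _ _ _ _ _ Ual Val). unfold Z. lra. }
  assert (Zbe : Z be = 0).
  { pose proof (wronskian_zero _ _ _ _ _ Ube Vbe). unfold Z. lra. }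
  assert (R1 : forall x y, al <= x -> x < y -> y <= be -> (U x = 0 /\ V x <> 0) ->
            (U y = 0 /\ V y <> 0) -> exists z, x < z < y /\ Z z = 0).
  { intros x y Hx Hxy Hy [Ux Vx] [Uy Vy].
    assert (Vt : forall t, x <= t <= y -> V t <> 0).
    { intros t Ht. destruct (Req_dec t x) as [->|]; auto. destruct (Req_dec t y) as [->|]; auto.
      apply HV0. lra. }
    destruct (Rolle_interval (fun t => U t / V t) (fun t => Z t / (K t * (V t * V t))) x y)
      as [z [Hz1 Hz2]]; auto.
    - intros t Ht. assert (It : I t) by (apply HI; lra).
      pose proof (Vt t Ht). pose proof (K_pos t It). evar_last.
      + apply is_derive_div; [apply Derive_correct; apply (Cinf_ex_derive U t CU It)
          |apply Derive_correct; apply (Cinf_ex_derive V t CV It)|auto].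
      + unfold Z. field. split; auto. lra.
    - rewrite Ux, Uy. unfold Rdiv. ring.
    - exists z. split; auto. simpl in Hz2. assert (Iz : I z) by (apply HI; lra).
      assert (Vz : V z <> 0) by (apply Vt; lra). pose proof (K_pos z Iz).
      replace (Z z) with (Z z / (K z * (V z * V z)) * (K z * (V z * V z))) by (field; split; auto; lra).
      rewrite Hz2. ring. }
  assert (V1 : forall x k, al < x < be -> vanish (S k) U x ->
            (U x = 0 /\ V x <> 0) /\ vanish k Z x).
  { intros x k Hx Hk. assert (Ix : I x) by (apply HI; lra).
    split; [split; [apply Hk|auto]|]. unfold Z.
    apply (vanish_plus (a0 := a0) (b0 := b0)); auto using Cinf_mult, Cinf_const.
    - apply (vanish_mult (a0 := a0) (b0 := b0)); auto.
      apply (vanish_mult (a0 := a0) (b0 := b0)); auto using Cinf_Derive. apply Hk.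
    - apply (vanish_mult (a0 := a0) (b0 := b0)); auto using Cinf_mult, Cinf_const.
      apply (vanish_le (S k)); auto. }
  assert (R2 : forall x y, al <= x -> x < y -> y <= be -> Z x = 0 -> Z y = 0 ->
            exists z, x < z < y /\ W z = 0).
  { intros x y Hx Hxy Hy Zx Zy.
    destruct (Rolle_interval Z (fun t => ((-1) * G t * V t) * W t) x y) as [z [Hz1 Hz2]]; auto.
    - intros t Ht. apply DZ. apply HI. lra.
    - lra.
    - exists z. split; auto. simpl in Hz2.
      assert (Vz : V z <> 0) by (apply HV0; lra). pose proof (G_pos z (HI z ltac:(lra))).
      apply Rmult_integral in Hz2. destruct Hz2 as [E|E]; auto. exfalso.
      apply Rmult_integral in E. destruct E as [E|E]; auto. lra. }
  assert (V2 : forall x k, al < x < be -> vanish (S k) Z x -> Z x = 0 /\ vanish k W x).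
  { intros x k Hx Hk. assert (Ix : I x) by (apply HI; lra). split; [apply Hk|].
    apply (vanish_cancel (a0 := a0) (b0 := b0) k (fun t => (-1) * G t * V t));
      auto using Cinf_mult, Cinf_const.
    - pose proof (G_pos x Ix). pose proof (HV0 x Hx).
      apply Rmult_integral_contrapositive. split; auto. lra.
    - apply (vanish_ext (a0 := a0) (b0 := b0) k (Derive Z)); [|auto|apply Hk].
      intros t It. apply is_derive_unique. auto. }
  set (e := Nat.ltb 0 b).
  assert (He : e = true -> U be = 0 /\ V be <> 0).
  { intros E. apply Nat.ltb_lt in E. destruct (Hb E) as [B1 B2]. split; auto.
    destruct b as [|b]; [lia|]. replace (2 * S b)%nat with (S (S (2 * b))) in B2 by lia. apply B2. }
  assert (Eb : (b = (b - Nat.b2n e) + Nat.b2n e)%nat).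
  { unfold e. destruct (Nat.ltb_spec 0 b); simpl; lia. }
  assert (Hres : forall c n x, (0 < n)%nat -> I x ->
            ((0 < c)%nat -> vanish (2 * c) U x) -> (n <= c - 1)%nat -> vanish (2 * n) W x).
  { intros c n x Hn Ix Hc Hle. apply (vanish_le (2 * (c - 1))); [lia|].
    apply (vanish_source _ U); auto.
    replace (S (S (2 * (c - 1)))) with (2 * c)%nat by lia. apply Hc. lia. }
  assert (Hb' : (0 < b - Nat.b2n e)%nat -> sin gam <> 0 /\ vanish (2 * (b - Nat.b2n e)) W be).
  { intros Hlt. assert (Hb0 : (0 < b)%nat) by lia. split; [apply Hb; auto|].
    apply (Hres b); auto.
    - apply Hb.
    - unfold e. destruct (Nat.ltb_spec 0 b); simpl; lia. }
  destruct a as [|a].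
  - destruct (chain_Rolle_free R1 V1 e He l al) as [lz [HZ1 HZ2]]; auto; [lra|].
    destruct (chain_Rolle (S := fun x => Z x = 0) R2 V2 true (fun _ => Zbe) lz al)
      as [lw [HW1 HW2]]; auto; [lra|].
    exists lw, O, (b - Nat.b2n e)%nat. split; auto. split; [lia|]. split; auto.
    simpl in HW2. lia.
  - destruct Ha as [Ha1 Ha2]; [lia|].
    assert (Sal : U al = 0 /\ V al <> 0).
    { split; auto. replace (2 * S a)%nat with (S (S (2 * a))) in Ha2 by lia. apply Ha2. }
    destruct (chain_Rolle R1 V1 e He l al) as [lz [HZ1 HZ2]]; auto; [lra|].
    destruct (chain_Rolle (S := fun x => Z x = 0) R2 V2 true (fun _ => Zbe) lz al)
      as [lw [HW1 HW2]]; auto; [lra|].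
    exists lw, a, (b - Nat.b2n e)%nat. split; auto. split.
    { intros Hlt. split; auto. apply (Hres (S a)); auto. lia. }
    split; auto. simpl in HW2. lia.
Qed.

End SturmStep.
(** * Linear combinations of eigenfunctions: the upper bound *)

Fixpoint comb (A : nat -> R) (F : nat -> R -> R) (N : nat) (x : R) : R :=
  match N with
  | O => 0
  | S N' => comb A F N' x + A N * F N x
  end.

Lemma comb_ext (A B : nat -> R) (F E : nat -> R -> R) (N : nat) (x : R) :
  (forall p, (1 <= p <= N)%nat -> A p * F p x = B p * E p x) -> comb A F N x = comb B E N x.
Proof.
  induction N as [|N IH]; simpl; auto. intros H. rewrite IH.
  - rewrite (H (S N)); auto. lia.
  - intros p Hp. apply H. lia.
Qed.

Lemma comb_scal (A : nat -> R) (F : nat -> R -> R) (c : R) (N : nat) (x : R) :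
  comb (fun p => c * A p) F N x = c * comb A F N x.
Proof. induction N as [|N IH]; simpl; [ring|]. rewrite IH. ring. Qed.

Lemma comb_proportional (A : nat -> R) (F E : nat -> R -> R) (c s : R) (N : nat) (x : R) :
  (forall p, (1 <= p <= N)%nat -> F p x * c = E p x * s) ->
  comb A F N x * c = comb A E N x * s.
Proof.
  induction N as [|N IH]; simpl; intros H; [ring|].
  rewrite !Rmult_plus_distr_r, IH, !Rmult_assoc, H; auto; [lia|]. intros p Hp. apply H. lia.
Qed.

Lemma comb_is_derive (A : nat -> R) (F dF : nat -> R -> R) (N : nat) (x : R) :
  (forall p, (1 <= p <= N)%nat -> is_derive (F p) x (dF p x)) ->
  is_derive (comb A F N) x (comb A dF N x).
Proof.
  induction N as [|N IH]; intros H.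
  - apply @is_derive_const.
  - apply (is_derive_plus (comb A F N) (fun t => A (S N) * F (S N) t)).
    + apply IH. intros p Hp. apply H. lia.
    + apply is_derive_scal. apply H. lia.
Qed.

Lemma comb_Cinf {a0 b0 : Rbar} (A : nat -> R) (F : nat -> R -> R) (N : nat) :
  (forall p, (1 <= p <= N)%nat -> Cinf a0 b0 (F p)) -> Cinf a0 b0 (comb A F N).
Proof.
  induction N as [|N IH]; intros H.
  - apply (Cinf_const 0).
  - apply (Cinf_plus (comb A F N) (fun t => A (S N) * F (S N) t)).
    + apply IH. intros p Hp. apply H. lia.
    + apply (Cinf_mult (fun _ => A (S N))); [apply Cinf_const|apply H; lia].
Qed.

Lemma comb_geometric_small (A q : nat -> R) (F : nat -> R -> R) (al be : R) (N : nat) :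
  al <= be ->
  (forall p, (1 <= p <= N)%nat -> 0 <= q p < 1) ->
  (forall p x, (1 <= p <= N)%nat -> al <= x <= be -> continuous (F p) x) ->
  forall eps, 0 < eps -> exists k0, forall k, (k0 <= k)%nat -> forall x, al <= x <= be ->
    Rabs (comb (fun p => q p ^ k * A p) F N x) < eps.
Proof.
  intros Hab. induction N as [|N IH]; intros Hq HF eps Heps.
  - exists O. intros. simpl. rewrite Rabs_R0. auto.
  - destruct (IH ltac:(intros; apply Hq; lia) ltac:(intros; apply HF; auto; lia) (eps / 2))
      as [k1 Hk1]; [lra|].
    destruct (continuous_bounded (F (S N)) al be) as [B [HB FB]]; auto.
    { intros x Hx. apply HF; auto. lia. }
    assert (Hlim : is_lim_seq (fun k => q (S N) ^ k) 0).
    { apply is_lim_seq_geom. destruct (Hq (S N)) as [q0 q1]; [lia|]. rewrite Rabs_pos_eq; auto. }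
    set (C := (Rabs (A (S N)) + 1) * B).
    assert (HC : 0 < C).
    { apply Rmult_lt_0_compat; auto. pose proof (Rabs_pos (A (S N))). lra. }
    apply is_lim_seq_spec in Hlim.
    assert (Hd : 0 < eps / 2 / C) by (apply Rdiv_lt_0_compat; lra).
    destruct (Hlim (mkposreal _ Hd)) as [k2 Hk2].
    exists (Nat.max k1 k2). intros k Hk x Hx. simpl.
    eapply Rle_lt_trans; [apply Rabs_triang|].
    assert (H1 := Hk1 k ltac:(lia) x Hx).
    assert (H2 := Hk2 k ltac:(lia)). rewrite Rminus_0_r in H2. simpl in H2.
    assert (H3 : Rabs (q (S N) ^ k * A (S N) * F (S N) x) <= eps / 2 / C * C).
    { rewrite Rmult_assoc, Rabs_mult. apply Rmult_le_compat; try apply Rabs_pos; [lra|].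
      rewrite Rabs_mult. unfold C. apply Rmult_le_compat; try apply Rabs_pos; [lra|auto]. }
    replace (eps / 2 / C * C) with (eps / 2) in H3 by (field; lra). lra.
Qed.

Lemma chain_simple_zeros (f : R -> R) (b : R) (l : list (R * nat)) : forall a,
  chain f a l b -> (forall x, a < x < b -> ~ vanish 2 f x) ->
  exists zs, StronglySorted Rlt zs /\ (forall x, In x zs -> a < x < b /\ f x = 0) /\
    length zs = total l.
Proof.
  induction l as [|[x k] l IH]; simpl; intros a HC H2.
  - exists nil. split; [constructor|]. split; auto. intros x [].
  - destruct HC as [Hx [Hk HC]].
    destruct (IH x) as [zs [S1 [S2 S3]]]; auto.
    { intros y Hy. apply H2. lra. }
    destruct k as [|[|k]].
    + exists zs. split; auto. split; auto. intros y Hy. destruct (S2 y Hy). split; auto. lra.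
    + exists (x :: zs). split; [|split].
      * constructor; auto. apply Forall_forall. intros y Hy. apply S2; auto.
      * intros y [<-|Hy]; [split; [lra|apply Hk]|]. destruct (S2 y Hy). split; auto. lra.
      * simpl. auto.
    + exfalso. apply (H2 x); auto. apply (vanish_le (S (S k)) 2); auto. lia.
Qed.

Section Combination.
Context {a0 b0 : Rbar} {K G L : R -> R}.
Local Notation I := (in_open a0 b0).
Context (CK : Cinf a0 b0 K) (CG : Cinf a0 b0 G) (CL : Cinf a0 b0 L).
Context (K_pos : positive_on a0 b0 K) (G_pos : positive_on a0 b0 G) (L_pos : positive_on a0 b0 L).
Context {al be : R} (Ial : I al) (Ibe : I be) (al_lt_be : al < be).
Context {h H : Rbar} {rho : nat -> R}.
Context (rho_seq : eigenvalue_sequence a0 b0 al be K G L h H rho).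
Context {phi0 gam : R} (phi0_range : 0 <= phi0 <= PI / 2) (gam_range : PI / 2 <= gam <= PI).
Context (left_bcE : forall V, left_bc al K h V <-> V al * cos phi0 = K al * Derive V al * sin phi0).
Context (right_bcE : forall V, right_bc be K H V <-> V be * cos gam = K be * Derive V be * sin gam).
Context {V : nat -> R -> R}.
Context (V_eigen : forall j, (1 <= j)%nat -> eigenfunction a0 b0 al be K G L h H (rho j) (V j)).

Let lam (p : nat) : R := rho p - rho 1%nat.
Let Q (p : nat) (x : R) : R := K x * Derive (V p) x.

Lemma V_system (p : nat) : (1 <= p)%nat ->
  linear_system a0 b0 (fun x => / K x) (fun x => L x - rho p * G x) (V p) (Q p).
Proof. intros Hp. apply SL_linear_system; auto. apply V_eigen; auto. Qed.

Lemma V_Cinf (p : nat) : (1 <= p)%nat -> Cinf a0 b0 (V p).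
Proof. intros Hp. apply (SL_Cinf CK CG CL K_pos (rho p)). apply V_eigen; auto. Qed.

Lemma Q_Cinf (p : nat) : (1 <= p)%nat -> Cinf a0 b0 (Q p).
Proof. intros Hp. apply Cinf_mult; auto. apply Cinf_Derive. apply V_Cinf; auto. Qed.

Lemma V_norm_pos (p : nat) (x : R) : (1 <= p)%nat -> I x -> 0 < V p x * V p x + Q p x * Q p x.
Proof.
  intros Hp Ix. destruct (V_eigen p Hp) as [_ [_ [_ [x0 [Hx0 HV0]]]]].
  apply (solution_norm_pos CK CG CL K_pos (rho p) (V p) (Q p) x0 x); auto using V_system.
  - apply (in_open_between al be); auto.
  - pose proof (Rle_0_sqr (Q p x0)) as H2. pose proof (Rsqr_pos_lt _ HV0) as H1.
    unfold Rsqr in H1, H2. lra.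
Qed.

Lemma V_left (p : nat) : (1 <= p)%nat -> V p al * cos phi0 = Q p al * sin phi0.
Proof. intros Hp. apply left_bcE. apply V_eigen; auto. Qed.

Lemma V_right (p : nat) : (1 <= p)%nat -> V p be * cos gam = Q p be * sin gam.
Proof. intros Hp. apply right_bcE. apply V_eigen; auto. Qed.

Lemma V_end_neq0 (p : nat) (x t : R) : (1 <= p)%nat -> I x ->
  V p x * cos t = Q p x * sin t -> sin t <> 0 -> V p x <> 0.
Proof.
  intros Hp Ix E Hs E0. pose proof (V_norm_pos p x Hp Ix) as P.
  rewrite E0 in E, P. assert (Q p x * sin t = 0) by lra.
  apply Rmult_integral in H0. destruct H0 as [H0|H0]; auto. rewrite H0 in P. lra.
Qed.

(** A zero inside would push the final angle beyond [PI]. *)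
Lemma V1_neq0 (x : R) : al < x < be -> V 1%nat x <> 0.
Proof.
  intros Hx E.
  destruct (eigenfunction_angle CK CG CL K_pos G_pos L_pos Ial Ibe al_lt_be rho_seq phi0_range
    gam_range left_bcE right_bcE 1 (V 1%nat)) as [s [phi [Hs [HA [H1 H2]]]]]; auto.
  assert (C : IZR (0 + Z.of_nat (length (x :: nil))) * PI < phi be).
  { apply (angle_counts_zeros al be al_lt_be _ _ phi (fun x => / K x) HA) with (a := al); auto.
    - intros t Ht. assert (It : I t) by (apply (in_open_between al be); auto).
      destruct (V_system 1 (Nat.le_refl 1) t It) as [D1 D2]. split; [|split].
      + replace (/ K t * (s * (K t * Derive (V 1%nat) t)))
          with (s * (/ K t * Q 1%nat t)) by (unfold Q; ring).
        apply is_derive_scal. exact D1.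
      + eexists. apply is_derive_scal. exact D2.
      + apply Rinv_0_lt_compat, K_pos; auto.
    - lra.
    - rewrite H1. simpl. lra.
    - repeat constructor.
    - intros y [<-|[]]. split; auto. rewrite E. ring. }
  simpl in C, H2. lra.
Qed.

(** Coefficients after [k] applications of the operator whose eigenvalues are [rho p - rho 1]. *)
Definition shifted (k : nat) (A : nat -> R) (p : nat) : R := lam p ^ k * A p.

Lemma comb_derivative (A : nat -> R) (N : nat) (x : R) : I x ->
  K x * Derive (comb A V N) x = comb A Q N x.
Proof.
  intros Ix.
  assert (D : is_derive (comb A V N) x (comb A (fun p t => / K t * Q p t) N x)).
  { apply comb_is_derive. intros p Hp. apply V_system; auto. lia. }
  rewrite (is_derive_unique _ _ _ D). induction N as [|N IH]; simpl; [ring|].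
  rewrite Rmult_plus_distr_l, IH.
  - field. apply Rgt_not_eq, K_pos; auto.
  - apply comb_is_derive. intros p Hp. apply V_system; auto. lia.
Qed.

Lemma comb_sourced (A : nat -> R) (N : nat) :
  sourced (a0 := a0) (b0 := b0) (K := K) (G := G) (q := fun x => L x - rho 1%nat * G x)
    (comb A V N) (comb (shifted 1 A) V N).
Proof.
  assert (HC : forall B, Cinf a0 b0 (comb B V N)).
  { intros B. apply comb_Cinf. intros p Hp. apply V_Cinf. lia. }
  split; auto. split; auto. intros x Ix.
  apply (is_derive_ext_loc (comb A Q N)).
  { apply (locally_eq_on (a0 := a0) (b0 := b0)); auto.
    intros t It. symmetry. apply comb_derivative; auto. }
  replace ((L x - rho 1%nat * G x) * comb A V N x - G x * comb (shifted 1 A) V N x)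
    with (comb A (fun p t => (L t - rho p * G t) * V p t) N x).
  - apply comb_is_derive. intros p Hp. apply V_system; auto. lia.
  - clear HC. induction N as [|N IH]; simpl; [ring|]. rewrite IH. unfold shifted, lam. simpl. ring.
Qed.

Lemma shifted_S (k : nat) (A : nat -> R) (N : nat) (x : R) :
  comb (shifted 1 (shifted k A)) V N x = comb (shifted (S k) A) V N x.
Proof. apply comb_ext. intros p _. unfold shifted. simpl. ring. Qed.

Lemma shifted_0 (A : nat -> R) (N : nat) (x : R) : comb (shifted 0 A) V N x = comb A V N x.
Proof. apply comb_ext. intros p _. unfold shifted. simpl. ring. Qed.

Local Notation zeros := (reduced_zeros (al := al) (be := be) (phi0 := phi0) (gam := gam)).

Lemma chain_ext (f g : R -> R) (b : R) (l : list (R * nat)) :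
  I b -> (forall x, f x = g x) -> forall a, I a -> chain f a l b -> chain g a l b.
Proof.
  intros Ib E. induction l as [|[x k] l IH]; simpl; auto.
  intros a Ia [H1 [H2 H3]].
  assert (Ix : I x) by (apply (in_open_between a b); auto; lra).
  split; auto. split; auto. apply (vanish_ext (a0 := a0) (b0 := b0) k f); auto.
Qed.

Lemma reduced_zeros_ext (f g : R -> R) (M : nat) :
  (forall x, f x = g x) -> zeros f M -> zeros g M.
Proof.
  intros E [l [a [b [H1 [H2 [H3 H4]]]]]]. exists l, a, b.
  split; [apply (chain_ext f); auto|]. split; [|split]; auto; intros Hn.
  - destruct (H2 Hn). split; auto. apply (vanish_ext (a0 := a0) (b0 := b0) _ f); auto.
  - destruct (H3 Hn). split; auto. apply (vanish_ext (a0 := a0) (b0 := b0) _ f); auto.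
Qed.

Lemma comb_left (A : nat -> R) (N : nat) :
  comb A V N al * cos phi0 = K al * Derive (comb A V N) al * sin phi0.
Proof.
  rewrite comb_derivative by auto. apply comb_proportional.
  intros p Hp. apply V_left. lia.
Qed.

Lemma comb_right (A : nat -> R) (N : nat) :
  comb A V N be * cos gam = K be * Derive (comb A V N) be * sin gam.
Proof.
  rewrite comb_derivative by auto. apply comb_proportional.
  intros p Hp. apply V_right. lia.
Qed.

Lemma reduced_zeros_shifted (k : nat) (A : nat -> R) (N M : nat) :
  zeros (comb A V N) M -> zeros (comb (shifted k A) V N) M.
Proof.
  intros HZ. induction k as [|k IH].
  - apply (reduced_zeros_ext (comb A V N)); auto. intros x. symmetry. apply shifted_0.
  - apply (reduced_zeros_ext (comb (shifted 1 (shifted k A)) V N)); [apply shifted_S|].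
    assert (HV1 : sourced (a0 := a0) (b0 := b0) (K := K) (G := G)
                    (q := fun x => L x - rho 1%nat * G x) (V 1%nat) (fun _ => 0)).
    { split; [apply V_Cinf; auto|]. split; [apply Cinf_const|]. intros x Ix.
      rewrite Rmult_0_r, Rminus_0_r. apply V_system; auto. }
    apply (sturm_step CK CG (Cinf_potential CG CL (rho 1%nat)) K_pos G_pos Ial Ibe al_lt_be
             _ _ (V 1%nat) M (comb_sourced (shifted k A) N) HV1 V1_neq0
             (comb_left _ N) (V_left 1 (Nat.le_refl 1)) (comb_right _ N) (V_right 1 (Nat.le_refl 1)));
      auto.
    + intros Hs. apply (V_end_neq0 1 al phi0); auto. apply V_left; auto.
    + intros Hs. apply (V_end_neq0 1 be gam); auto. apply V_right; auto.
Qed.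

(** The component along the last eigenfunction dominates after enough applications of the
    operator. *)
Lemma shifted_near_last (A : nat -> R) (N : nat) : (1 <= N)%nat -> A N <> 0 ->
  exists k s, forall x, al <= x <= be ->
    0 < Q N x * (s * comb (shifted k A) Q N x) + V N x * (s * comb (shifted k A) V N x).
Proof.
  intros HN HA. destruct rho_seq as [Hinc _].
  set (w := fun p x => Q N x * Q p x + V N x * V p x).
  assert (Hw : forall B M x, Q N x * comb B Q M x + V N x * comb B V M x = comb B w M x).
  { intros B M x. induction M as [|M IH]; simpl; [ring|]. rewrite <- IH. unfold w. ring. }
  assert (Hpos : forall x, al <= x <= be -> 0 < w N x).
  { intros x Hx. pose proof (V_norm_pos N x HN (in_open_between al be x Ial Ibe Hx)). unfold w. lra. }
  assert (Hdot : forall k s x, Q N x * (s * comb (shifted k A) Q N x)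
                   + V N x * (s * comb (shifted k A) V N x) = s * comb (shifted k A) w N x).
  { intros k s x. rewrite <- Hw. ring. }
  destruct N as [|N]; [lia|]. destruct N as [|N].
  - exists O, (/ A 1%nat). intros x Hx. rewrite Hdot. simpl. unfold shifted. simpl.
    specialize (Hpos x Hx).
    replace (/ A 1%nat * (0 + 1 * A 1%nat * w 1%nat x)) with (w 1%nat x) by (field; auto). auto.
  - assert (Hl : 0 < lam (S (S N))).
    { unfold lam. specialize (Hinc 1%nat (S (S N))). assert (rho 1%nat < rho (S (S N))) by (apply Hinc; lia).
      lra. }
    assert (Cw : forall p x, (1 <= p)%nat -> al <= x <= be -> continuous (w p) x).
    { intros p x Hp Hx. assert (Ix := in_open_between al be x Ial Ibe Hx).
      apply (Cinf_continuous (a0 := a0) (b0 := b0)); auto.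
      apply Cinf_plus; apply Cinf_mult; auto using V_Cinf, Q_Cinf. }
    destruct (continuous_pos_min (w (S (S N))) al be) as [m [Hm Hmin]]; auto; [lra|].
    destruct (comb_geometric_small (fun p => A p / A (S (S N))) (fun p => lam p / lam (S (S N)))
                w al be (S N) (Rlt_le _ _ al_lt_be)) with (eps := m) as [k Hk]; auto.
    { intros p Hp. assert (rho p < rho (S (S N))) by (apply Hinc; lia).
      assert (0 <= lam p).
      { unfold lam. destruct (Nat.eq_dec p 1) as [->|]; [lra|].
        assert (rho 1%nat < rho p) by (apply Hinc; lia). lra. }
      assert (lam p < lam (S (S N))) by (unfold lam; lra). split.
      - apply Rmult_le_pos; auto. apply Rlt_le, Rinv_0_lt_compat; auto.
      - apply (Rmult_lt_reg_r (lam (S (S N)))); auto.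
        replace (lam p / lam (S (S N)) * lam (S (S N))) with (lam p) by (field; lra). lra. }
    { intros p x Hp. apply Cw. lia. }
    exists k, (/ (lam (S (S N)) ^ k * A (S (S N)))). intros x Hx. rewrite Hdot, <- comb_scal.
    assert (Hlk : lam (S (S N)) ^ k <> 0) by (apply pow_nonzero; lra).
    change (comb ?B w (S (S N)) x) with (comb B w (S N) x + B (S (S N)) * w (S (S N)) x).
    specialize (Hk k (Nat.le_refl k) x Hx). specialize (Hmin x Hx).
    rewrite (comb_ext _ (fun p => (lam p / lam (S (S N))) ^ k * (A p / A (S (S N)))) w w (S N) x).
    + apply Rabs_def2 in Hk. unfold shifted.
      replace (/ (lam (S (S N)) ^ k * A (S (S N))) * (lam (S (S N)) ^ k * A (S (S N))))
        with 1 by (field; auto). lra.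
    + intros p Hp. unfold shifted, Rdiv. rewrite Rpow_mult_distr, pow_inv.
      field. auto.
Qed.

Lemma vanish_shifted (k j : nat) (A : nat -> R) (N : nat) (x : R) : I x ->
  vanish (2 * k + j) (comb A V N) x -> vanish j (comb (shifted k A) V N) x.
Proof.
  intros Ix. revert j. induction k as [|k IH]; intros j Hv.
  - apply (vanish_ext (a0 := a0) (b0 := b0) j (comb A V N)); auto.
    intros t _. symmetry. apply shifted_0.
  - apply (vanish_ext (a0 := a0) (b0 := b0) j (comb (shifted 1 (shifted k A)) V N)); auto.
    { intros t _. apply shifted_S. }
    apply (vanish_source CK CG (Cinf_potential CG CL (rho 1%nat)) G_pos j (comb (shifted k A) V N)); auto.
    + apply comb_sourced.
    + apply IH. replace (2 * k + S (S j))%nat with (2 * S k + j)%nat by lia. auto.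
Qed.

Lemma no_double_zero (A : nat -> R) (N k : nat) (s x : R) : al <= x <= be ->
  0 < Q N x * (s * comb (shifted k A) Q N x) + V N x * (s * comb (shifted k A) V N x) ->
  ~ vanish 2 (comb (shifted k A) V N) x.
Proof.
  intros Hx Hpos [E1 [E2 _]]. assert (Ix := in_open_between al be x Ial Ibe Hx).
  rewrite <- comb_derivative, E1, E2 in Hpos by auto. lra.
Qed.

Lemma last_nonzero (A : nat -> R) (N : nat) : (exists p, (1 <= p <= N)%nat /\ A p <> 0) ->
  exists M, (1 <= M <= N)%nat /\ A M <> 0 /\ forall x, comb A V M x = comb A V N x.
Proof.
  induction N as [|N IH]; intros [p [Hp HA]]; [lia|].
  destruct (Req_dec (A (S N)) 0) as [E|E].
  - destruct IH as [M [H1 [H2 H3]]].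
    { exists p. split; auto. destruct (Nat.eq_dec p (S N)) as [->|]; [tauto|lia]. }
    exists M. split; [lia|]. split; auto. intros x. simpl. rewrite H3, E. ring.
  - exists (S N). split; [lia|]. auto.
Qed.

Lemma comb_finite_order (A : nat -> R) (N : nat) (x : R) :
  (exists p, (1 <= p <= N)%nat /\ A p <> 0) -> al <= x <= be ->
  exists k, ~ vanish k (comb A V N) x.
Proof.
  intros HA Hx. destruct (last_nonzero A N HA) as [M [HM [AM E]]].
  destruct (shifted_near_last A M) as [k [s Hk]]; auto; [lia|].
  exists (2 * k + 2)%nat. intros Hv.
  assert (Ix := in_open_between al be x Ial Ibe Hx).
  apply (no_double_zero A M k s x); auto.
  apply vanish_shifted; auto. apply (vanish_ext (a0 := a0) (b0 := b0) _ (comb A V N)); auto.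
Qed.

(** Repeated use of Sturm's step replaces the combination by one close to the last eigenfunction.
    That one has no multiple zero, and its angle equals that of the eigenfunction at both end
    points: the boundary conditions are the same and the two vectors are never opposite. So the
    angle bounds its number of zeros. *)
Lemma comb_zeros_lt (A : nat -> R) (N M : nat) :
  (exists p, (1 <= p <= N)%nat /\ A p <> 0) -> zeros (comb A V N) M -> (M < N)%nat.
Proof.
  intros HA HZ. destruct (last_nonzero A N HA) as [N' [HN [AN E]]].
  cut (M < N')%nat; [lia|].
  assert (HZ' : zeros (comb A V N') M) by (apply (reduced_zeros_ext (comb A V N)); auto).
  clear HZ E HA. destruct HN as [HN _].
  destruct (shifted_near_last A N') as [k [s Hk]]; auto.
  apply (reduced_zeros_shifted k) in HZ'. set (B := shifted k A) in *.
  destruct HZ' as [l [a [b [Hl [Ha [Hb HM]]]]]].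
  assert (HI : forall x, al <= x <= be -> I x) by (intros; apply (in_open_between al be); auto).
  assert (ND : forall x, al <= x <= be -> ~ vanish 2 (comb B V N') x).
  { intros x Hx. apply (no_double_zero A N' k s); auto. }
  assert (a = O).
  { destruct a as [|a]; auto. exfalso. destruct Ha as [_ Ha]; [lia|].
    apply (ND al); [lra|]. apply (vanish_le (2 * S a)); auto. lia. }
  assert (b = O).
  { destruct b as [|b]; auto. exfalso. destruct Hb as [_ Hb]; [lia|].
    apply (ND be); [lra|]. apply (vanish_le (2 * S b)); auto. lia. }
  subst a b. rewrite !Nat.add_0_r in HM.
  destruct (chain_simple_zeros _ _ _ _ Hl) as [zs [S1 [S2 S3]]].
  { intros x Hx. apply ND. lra. }
  rewrite <- S3 in HM. apply Nat.le_lt_trans with (length zs); auto.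
  destruct (eigenfunction_angle CK CG CL K_pos G_pos L_pos Ial Ibe al_lt_be rho_seq phi0_range
    gam_range left_bcE right_bcE N' (V N')) as [s0 [phi [Hs0 [HA [H1 H2]]]]]; auto.
  set (u := fun x => s0 * s * comb B V N' x). set (p := fun x => s0 * s * comb B Q N' x).
  assert (Du : forall x, I x -> is_derive u x (/ K x * p x)).
  { intros x Ix. unfold u, p.
    replace (/ K x * (s0 * s * comb B Q N' x)) with (s0 * s * comb B (fun p t => / K t * Q p t) N' x).
    - apply is_derive_scal. apply comb_is_derive. intros j Hj. apply V_system; auto. lia.
    - rewrite (comb_ext _ (fun j => / K x * B j) _ Q).
      + rewrite comb_scal. ring.
      + intros; ring. }
  assert (Dp : forall x, I x -> ex_derive p x).
  { intros x Ix. apply ex_derive_scal. apply (Cinf_ex_derive (a0 := a0) (b0 := b0)); auto.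
    apply comb_Cinf. intros j Hj. apply Q_Cinf. lia. }
  pose proof (angle_perturb al be _ _ u p phi HA) as HP.
  set (psi := fun x => phi x + atan ((u x * (s0 * (K x * Derive (V N') x)) - p x * (s0 * V N' x)) /
            (s0 * (K x * Derive (V N') x) * p x + s0 * V N' x * u x))) in HP.
  assert (HP' : angle al be u p psi).
  { apply HP.
    - intros x Hx. assert (Ix := HI x Hx). destruct (V_system N' HN x Ix) as [D1 D2].
      split; [|split; [|split]].
      + eexists. apply is_derive_scal. exact D1.
      + eexists. apply is_derive_scal. exact D2.
      + eexists. apply Du; auto.
      + apply Dp; auto.
    - intros x Hx. unfold p, u. specialize (Hk x Hx). fold B in Hk.
      replace (s0 * (K x * Derive (V N') x) * (s0 * s * comb B Q N' x)
                + s0 * V N' x * (s0 * s * comb B V N' x))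
        with (s0 * s0 * (Q N' x * (s * comb B Q N' x) + V N' x * (s * comb B V N' x)))
        by (change (K x * Derive (V N') x) with (Q N' x); ring).
      apply Rmult_lt_0_compat; auto. apply Rsqr_pos_lt in Hs0. exact Hs0. }
  assert (Same : forall x t, I x -> comb B V N' x * cos t = comb B Q N' x * sin t ->
            V N' x * cos t = Q N' x * sin t -> psi x = phi x).
  { intros x t Ix E1 E2. unfold psi, u, p.
    pose proof (wronskian_zero t _ _ _ _ E1 E2) as W0.
    replace (s0 * s * comb B V N' x * (s0 * (K x * Derive (V N') x))
             - s0 * s * comb B Q N' x * (s0 * V N' x))
      with (- (s0 * s * s0) * (comb B Q N' x * V N' x - comb B V N' x * Q N' x))
      by (change (K x * Derive (V N') x) with (Q N' x); ring).
    rewrite W0, Rmult_0_r. unfold Rdiv. rewrite Rmult_0_l, atan_0. ring. }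
  assert (Pal : psi al = phi0).
  { rewrite (Same al phi0); auto; [|apply V_left; auto].
    rewrite <- comb_derivative by auto. apply comb_left. }
  assert (Pbe : psi be = phi be).
  { apply (Same be gam); auto; [|apply V_right; auto].
    rewrite <- comb_derivative by auto. apply comb_right. }
  assert (C : IZR (0 + Z.of_nat (length zs)) * PI < psi be).
  { apply (angle_counts_zeros al be al_lt_be u p psi (fun x => / K x) HP') with (a := al); auto.
    - intros x Hx. split; [|split]; auto. apply Rinv_0_lt_compat, K_pos; auto.
    - lra.
    - rewrite Pal. simpl. lra.
    - intros x Hx. destruct (S2 x Hx) as [Z1 Z2]. split; auto. unfold u. rewrite Z2. ring. }
  rewrite Pbe, Z.add_0_l, <- INR_IZR_INZ in C.
  apply INR_lt. apply (Rmult_lt_reg_r PI); [apply PI_RGT_0|]. lra.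
Qed.

(** At a non-Dirichlet end point [U = 0] forces [U' = 0], and the same holds for the images of
    [U] under the operator, to which the even orders are reduced. *)
Lemma comb_even_order (x t : R) (N a : nat) :
  I x -> sin t <> 0 ->
  (forall A, comb A V N x * cos t = K x * Derive (comb A V N) x * sin t) ->
  forall A, vanish (2 * a + 1) (comb A V N) x -> vanish (2 * a + 2) (comb A V N) x.
Proof.
  intros Ix Hs Hbc.
  assert (D0 : forall A, comb A V N x = 0 -> Derive (comb A V N) x = 0).
  { intros A E. specialize (Hbc A). rewrite E in Hbc. pose proof (K_pos x Ix).
    assert (E2 : K x * Derive (comb A V N) x * sin t = 0) by lra.
    apply Rmult_integral in E2. destruct E2 as [E2|E2]; [|tauto].
    apply Rmult_integral in E2. destruct E2 as [E2|E2]; auto. lra. }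
  induction a as [|a IH]; intros A HV.
  - destruct HV as [H1 _]. simpl. auto.
  - assert (E1 : comb A V N x = 0).
    { apply (vanish_le (2 * S a + 1) 1) in HV; [apply HV|lia]. }
    replace (2 * S a + 2)%nat with (S (S (2 * a + 2))) by lia.
    apply (vanish_of_source CK CG (Cinf_potential CG CL (rho 1%nat)) K_pos _ _
      (comb (shifted 1 A) V N)); auto.
    + apply comb_sourced.
    + apply IH. apply (vanish_source CK CG (Cinf_potential CG CL (rho 1%nat)) G_pos _ (comb A V N)); auto.
      * apply comb_sourced.
      * replace (S (S (2 * a + 1))) with (2 * S a + 1)%nat by lia. auto.
Qed.

End Combination.
(** * Signs near zeros *)

Lemma sign_near_zero {a0 b0 : Rbar} (k : nat) : forall f x, Cinf a0 b0 f -> in_open a0 b0 x ->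
  vanish k f x -> ~ vanish (S k) f x ->
  exists d s, 0 < d /\ 0 <= s * f x /\
    (forall t, x < t < x + d -> 0 < s * f t) /\
    (forall t, x - d < t < x -> 0 < s * (-1) ^ k * f t).
Proof.
  induction k as [|k IH]; intros f x Cf Ix Hk Hn.
  - assert (F0 : f x <> 0) by (intros E; apply Hn; simpl; auto).
    assert (P : 0 < f x * f x) by (apply Rsqr_pos_lt in F0; exact F0).
    assert (L : locally x (fun t => 0 < f x * f t)).
    { assert (C : continuous (fun t => f x * f t) x).
      { apply (continuous_mult (K := R_AbsRing)); [apply continuous_const|].
        apply (Cinf_continuous (a0 := a0) (b0 := b0)); auto. }
      apply (C (fun v => 0 < v)). apply (open_gt 0). auto. }
    destruct L as [d Hd]. exists d, (f x). split; [apply cond_pos|]. split; [lra|].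
    assert (Hd' : forall t, Rabs (t - x) < d -> 0 < f x * f t) by (intros t Ht; apply Hd; exact Ht).
    split; intros t Ht; simpl; rewrite ?Rmult_1_r; apply Hd'; apply Rabs_def1; lra.
  - destruct Hk as [F0 Hk].
    destruct (IH (Derive f) x) as [d [s [Hd [_ [H1 H2]]]]]; auto using Cinf_Derive.
    { intros E. apply Hn. split; auto. }
    destruct (in_open_margin x Ix) as [e [He [I1 I2]]].
    pose proof (Rmin_l d e) as M1. pose proof (Rmin_r d e) as M2.
    assert (Mean : forall a b, x - e <= a -> a < b -> b <= x + e ->
              exists c, f b - f a = Derive f c * (b - a) /\ a < c < b).
    { intros a b Ha Hab Hb. apply (MVT_cor2 f (Derive f) a b); auto.
      intros c Hc. apply is_derive_Reals, Derive_correct.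
      apply (Cinf_ex_derive (a0 := a0) (b0 := b0)); auto.
      apply (in_open_between (x - e) (x + e)); auto. lra. }
    exists (Rmin d e), s. split; [apply Rmin_glb_lt; auto|]. split; [rewrite F0; lra|].
    split; intros t Ht.
    + destruct (Mean x t) as [c [Hc1 Hc2]]; try lra. rewrite F0 in Hc1.
      replace (f t) with (Derive f c * (t - x)) by lra. rewrite <- Rmult_assoc.
      apply Rmult_lt_0_compat; [apply H1; lra|lra].
    + destruct (Mean t x) as [c [Hc1 Hc2]]; try lra. rewrite F0 in Hc1.
      replace (f t) with (- (Derive f c * (x - t))) by lra.
      replace (s * (-1) ^ S k * - (Derive f c * (x - t)))
        with (s * (-1) ^ k * Derive f c * (x - t)) by (simpl; ring).
      apply Rmult_lt_0_compat; [apply H2; lra|lra].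
Qed.

(** Connectedness: the supremum of the points up to which the sign has not changed can be
    pushed further. *)
Lemma locally_same_sign (F : R -> R) (a b : R) :
  (forall x, a < x < b -> exists d s, 0 < d /\ 0 <= s * F x /\
     forall t, t <> x -> x - d < t < x + d -> 0 < s * F t) ->
  forall x y, a < x -> x < y -> y < b -> 0 <= F x * F y.
Proof.
  intros HF x y Hx Hxy Hy. destruct (Rle_dec 0 (F x * F y)) as [|Hneg]; auto. exfalso.
  apply Rnot_le_lt in Hneg.
  assert (Fx : F x <> 0) by (intros E; rewrite E in Hneg; lra).
  assert (Pxx : 0 < F x * F x) by (apply Rsqr_pos_lt in Fx; exact Fx).
  set (T := fun t => x <= t <= y /\ forall u, x <= u <= t -> 0 <= F x * F u).
  assert (Tx : T x).
  { split; [lra|]. intros u Hu. replace u with x by lra. lra. }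
  destruct (completeness T) as [m [M1 M2]].
  { exists y. intros t [Ht _]. lra. }
  { exists x. auto. }
  assert (Hxm : x <= m) by (apply M1; auto).
  assert (Hmy : m <= y) by (apply M2; intros t [Ht _]; lra).
  assert (Below : forall u, x <= u < m -> 0 <= F x * F u).
  { intros u Hu. destruct (Rle_dec 0 (F x * F u)) as [|Hn]; auto. exfalso.
    assert (m <= u); [|lra]. apply M2. intros t [Ht1 Ht2].
    destruct (Rle_dec t u) as [|Htu]; auto. exfalso. apply Hn, Ht2. lra. }
  destruct (HF m) as [d [s [Hd [Hs Hnear]]]]; [lra|].
  assert (Hsx : 0 < F x * s).
  { destruct (Req_dec m x) as [->|Hne].
    - assert (s <> 0).
      { intros ->. specialize (Hnear (x + d / 2)). lra. }
      assert (s * F x <> 0) by (apply Rmult_integral_contrapositive; auto). lra.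
    - set (u := m - Rmin (d / 2) (m - x)).
      pose proof (Rmin_l (d / 2) (m - x)). pose proof (Rmin_r (d / 2) (m - x)).
      assert (0 < Rmin (d / 2) (m - x)) by (apply Rmin_glb_lt; lra).
      assert (U1 : 0 <= F x * F u) by (apply Below; unfold u; lra).
      assert (U2 : 0 < s * F u) by (apply Hnear; unfold u; lra).
      assert (s <> 0) by (intros E; rewrite E in U2; lra).
      assert (Pss : 0 < F u * F u).
      { assert (Fu : F u <> 0) by (intros E; rewrite E in U2; lra).
        apply Rsqr_pos_lt in Fu. exact Fu. }
      assert (0 <= F x * s * (F u * F u)).
      { replace (F x * s * (F u * F u)) with (F x * F u * (s * F u)) by ring.
        apply Rmult_le_pos; lra. }
      assert (F x * s <> 0) by (apply Rmult_integral_contrapositive; auto).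
      destruct (Rlt_dec 0 (F x * s)) as [|Hn]; auto. exfalso. nra. }
  assert (Pos : forall u, 0 <= s * F u -> 0 <= F x * F u).
  { intros u Hu. assert (0 < s * s).
    { assert (s <> 0) by (intros E; rewrite E in Hsx; lra). apply Rsqr_pos_lt in H. exact H. }
    assert (0 <= F x * F u * (s * s)).
    { replace (F x * F u * (s * s)) with (F x * s * (s * F u)) by ring. apply Rmult_le_pos; lra. }
    destruct (Rle_dec 0 (F x * F u)); auto. exfalso. nra. }
  destruct (Req_dec m y) as [->|Hne].
  - specialize (Pos y Hs). lra.
  - set (v := m + Rmin (d / 2) (y - m)).
    pose proof (Rmin_l (d / 2) (y - m)). pose proof (Rmin_r (d / 2) (y - m)).
    assert (0 < Rmin (d / 2) (y - m)) by (apply Rmin_glb_lt; lra).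
    assert (v <= m); [|unfold v in *; lra]. apply M1. split; [unfold v; lra|].
    intros u Hu. destruct (Rlt_dec u m) as [Hum|Hum]; [apply Below; lra|].
    apply Pos. destruct (Req_dec u m) as [->|Hn]; auto. apply Rlt_le, Hnear; auto.
    unfold v in Hu. lra.
Qed.

(** * Sorted lists of zeros *)

Lemma sorted_insert (x : R) (zs : list R) : StronglySorted Rlt zs -> ~ In x zs ->
  exists zs', StronglySorted Rlt zs' /\ length zs' = S (length zs) /\
    forall y, In y zs' <-> y = x \/ In y zs.
Proof.
  induction zs as [|z zs IH]; intros HS Hx.
  - exists (x :: nil). split; [repeat constructor|]. split; auto. intros y. simpl.
    split; intros [Hy|Hy]; auto.
  - inversion HS as [|? ? HS' HF]; subst. rewrite Forall_forall in HF.
    destruct (Rlt_dec x z) as [Hlt|Hlt].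
    + exists (x :: z :: zs). split; [|split; auto].
      * constructor; auto. constructor; auto. apply Forall_forall. intros y Hy.
        apply Rlt_trans with z; auto.
      * intros y. simpl. split; intros [Hy|Hy]; auto.
    + destruct IH as [zs' [H1 [H2 H3]]]; auto.
      { intros E. apply Hx. right. auto. }
      exists (z :: zs'). split; [|split].
      * constructor; auto. apply Forall_forall. intros y Hy. apply H3 in Hy.
        destruct Hy as [->|Hy]; auto.
        assert (z <> x) by (intros ->; apply Hx; left; auto). lra.
      * simpl. lia.
      * intros y. simpl. rewrite H3. tauto.
Qed.

(** A list that misses a point of the set can be lengthened, so a longest list is complete. *)
Lemma bounded_set_list (P : R -> Prop) (n : nat) :
  (forall zs, StronglySorted Rlt zs -> (forall x, In x zs -> P x) -> (length zs <= n)%nat) ->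
  exists zs, StronglySorted Rlt zs /\ forall x, In x zs <-> P x.
Proof.
  intros Hb.
  assert (E : forall k, (exists zs, StronglySorted Rlt zs /\ forall x, In x zs <-> P x) \/
    exists zs, StronglySorted Rlt zs /\ (forall x, In x zs -> P x) /\ length zs = k).
  { induction k as [|k IH].
    - right. exists nil. split; [constructor|]. split; auto. intros x [].
    - destruct IH as [IH|[zs [H1 [H2 H3]]]]; auto.
      destruct (excluded_middle_informative (exists x, P x /\ ~ In x zs)) as [[x [Px Hx]]|Hno].
      + right. destruct (sorted_insert x zs H1 Hx) as [zs' [G1 [G2 G3]]].
        exists zs'. split; auto. split; [|lia]. intros y Hy. apply G3 in Hy.
        destruct Hy as [->|Hy]; auto.
      + left. exists zs. split; auto. intros x. split; auto. intros Px.
        destruct (excluded_middle_informative (In x zs)); auto. exfalso. eauto. }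
  destruct (E (S n)) as [|[zs [H1 [H2 H3]]]]; auto.
  specialize (Hb zs H1 H2). lia.
Qed.

Lemma sorted_filter (b : R -> bool) (zs : list R) :
  StronglySorted Rlt zs -> StronglySorted Rlt (filter b zs).
Proof.
  induction zs as [|z zs IH]; simpl; auto. intros HS. inversion HS as [|? ? HS' HF]; subst.
  destruct (b z); auto. constructor; auto. apply Forall_forall. intros y Hy.
  apply filter_In in Hy. rewrite Forall_forall in HF. apply HF. tauto.
Qed.

Lemma sorted_chain (f : R -> R) (mu : R -> nat) (b : R) (zs : list R) : forall a,
  StronglySorted Rlt zs -> (forall x, In x zs -> a < x < b /\ vanish (mu x) f x) ->
  chain f a (map (fun x => (x, mu x)) zs) b.
Proof.
  induction zs as [|z zs IH]; simpl; auto. intros a HS Hz.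
  inversion HS as [|? ? HS' HF]; subst. rewrite Forall_forall in HF.
  destruct (Hz z) as [H1 H2]; auto. split; auto. split; auto. apply IH; auto.
  intros x Hx. destruct (Hz x) as [H3 H4]; auto. split; auto. split; [auto|lra].
Qed.

Lemma total_one (zs : list R) : total (map (fun x => (x, 1%nat)) zs) = length zs.
Proof. induction zs as [|z zs IH]; simpl; auto. Qed.

Lemma total_one_double (x : R) (zs : list R) : In x zs ->
  (S (length zs) <= total (map (fun y => (y, if Req_dec_T y x then 2 else 1)) zs))%nat.
Proof.
  assert (Ge : forall l, (length l <= total (map (fun y => (y, if Req_dec_T y x then 2 else 1)) l))%nat).
  { induction l as [|y l IHl]; simpl; auto. destruct (Req_dec_T y x); lia. }
  induction zs as [|z zs IH]; simpl; [tauto|]. intros [->|Hz].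
  - specialize (Ge zs). destruct (Req_dec_T x x); [lia|tauto].
  - specialize (IH Hz). destruct (Req_dec_T z x); lia.
Qed.

Lemma N_m_total (zs : list R) (mu : R -> nat) :
  N_m zs mu = INR (total (map (fun x => (x, mu x)) zs)).
Proof.
  unfold N_m, sum_over. induction zs as [|z zs IH]; simpl; auto. rewrite IH, plus_INR. auto.
Qed.

Lemma pow_m1 (k : nat) : (-1) ^ k = if Nat.odd k then -1 else 1.
Proof.
  induction k as [|k IH]; simpl pow; auto. rewrite IH, Nat.odd_succ, <- Nat.negb_odd.
  destruct (Nat.odd k); simpl; ring.
Qed.

Lemma N_v_length (zs : list R) (mu : R -> nat) :
  N_v zs mu = INR (length (filter (fun x => Nat.odd (mu x)) zs)).
Proof.
  unfold N_v, sum_over. induction zs as [|z zs IH]; simpl map; simpl fold_right; simpl filter; auto.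
  rewrite IH, pow_m1. destruct (Nat.odd (mu z)); simpl length; rewrite ?S_INR; lra.
Qed.

Lemma N_v_le_N_m (zs : list R) (mu : R -> nat) : N_v zs mu <= N_m zs mu.
Proof.
  unfold N_v, N_m, sum_over. induction zs as [|z zs IH]; simpl map; simpl fold_right; [lra|].
  rewrite pow_m1. pose proof (pos_INR (mu z)). destruct (Nat.odd (mu z)) eqn:E; [|lra].
  destruct (mu z) as [|k]; [discriminate|]. rewrite S_INR. pose proof (pos_INR k). lra.
Qed.

Lemma exact_order (f : R -> R) (x : R) (k : nat) : ~ vanish k f x ->
  exists j, vanish j f x /\ ~ vanish (S j) f x.
Proof.
  induction k as [|k IH]; intros Hk; [simpl in Hk; tauto|].
  destruct (excluded_middle_informative (vanish k f x)) as [E|E]; auto. exists k. auto.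
Qed.

Lemma exact_order_multiplicity (f : R -> R) (x : R) (k : nat) :
  vanish k f x -> ~ vanish (S k) f x -> has_multiplicity f x k.
Proof.
  intros H1 H2. rewrite vanish_Derive_n in H1, H2. split; auto.
  intros E. apply H2. intros j Hj. destruct (Nat.eq_dec j k) as [->|]; auto. apply H1. lia.
Qed.

(** * A combination vanishing at prescribed points *)

Lemma comb_replace (B : nat -> R) (F : nat -> R -> R) (E : R -> R) (q m : nat) (y : R) :
  (1 <= q <= m)%nat ->
  comb (fun p => if Nat.eq_dec p q then 0 else B p) F m y + B q * E y
  = comb B (fun p => if Nat.eq_dec p q then E else F p) m y.
Proof.
  induction m as [|m IH]; intros Hq; [lia|]. cbn [comb].
  destruct (Nat.eq_dec (S m) q) as [<-|Hne].
  - rewrite (comb_ext _ B F (fun p => if Nat.eq_dec p (S m) then E else F p)); [ring|].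
    intros p Hp. destruct (Nat.eq_dec p (S m)); [lia|auto].
  - rewrite <- IH by lia. ring.
Qed.

(** More functions than points: a non-trivial combination vanishes at all the points. For one
    more point [x], two combinations vanish at the others, the second one avoiding an index
    used by the first, and a combination of the two also vanishes at [x]. *)
Lemma comb_vanishing_exists (pts : list R) : forall F : nat -> R -> R,
  exists B, (exists p, (1 <= p <= S (length pts))%nat /\ B p <> 0) /\
    forall x, In x pts -> comb B F (S (length pts)) x = 0.
Proof.
  induction pts as [|x pts IH]; intros F.
  - exists (fun _ => 1). split; [exists 1%nat; simpl; split; [lia|lra]|]. intros x [].
  - simpl length. set (m := S (length pts)) in *.
    destruct (IH F) as [B1 [[q [Hq Bq]] Z1]].
    destruct (Req_dec (comb B1 F m x) 0) as [Ex|Ex].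
    + exists (fun p => if Nat.eq_dec p (S m) then 0 else B1 p). split.
      * exists q. split; [lia|]. destruct (Nat.eq_dec q (S m)); [lia|auto].
      * assert (E : forall y, comb (fun p => if Nat.eq_dec p (S m) then 0 else B1 p) F (S m) y
                     = comb B1 F m y).
        { intros y. cbn [comb]. destruct (Nat.eq_dec (S m) (S m)); [|tauto].
          rewrite (comb_ext _ B1 F F); [ring|]. intros p Hp.
          destruct (Nat.eq_dec p (S m)); [lia|auto]. }
        intros y [<-|Hy]; rewrite E; auto.
    + destruct (IH (fun p => if Nat.eq_dec p q then F (S m) else F p)) as [B2 [[r [Hr Br]] Z2]].
      set (g := comb B2 (fun p => if Nat.eq_dec p q then F (S m) else F p) m) in *.
      set (c := g x / comb B1 F m x).
      set (B := fun p => if Nat.eq_dec p (S m) then B2 q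
                         else (if Nat.eq_dec p q then 0 else B2 p) + (- c) * B1 p).
      assert (E : forall y, comb B F (S m) y = g y - c * comb B1 F m y).
      { intros y. cbn [comb]. unfold B at 2. destruct (Nat.eq_dec (S m) (S m)); [|tauto].
        unfold g. rewrite <- comb_replace by auto.
        assert (Hm : forall j, (j <= m)%nat -> comb B F j y
                 = comb (fun p => if Nat.eq_dec p q then 0 else B2 p) F j y - c * comb B1 F j y).
        { induction j as [|j IHj]; cbn [comb]; intros Hj; [ring|]. rewrite IHj by lia. unfold B.
          destruct (Nat.eq_dec (S j) (S m)); [lia|]. ring. }
        rewrite Hm by lia. ring. }
      exists B. split.
      * destruct (Req_dec c 0) as [C0|C0].
        -- destruct (Nat.eq_dec r q) as [->|Hrq].
           ++ exists (S m). split; [lia|]. unfold B. destruct (Nat.eq_dec (S m) (S m)); tauto.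
           ++ exists r. split; [lia|]. unfold B. destruct (Nat.eq_dec r (S m)); [lia|].
              destruct (Nat.eq_dec r q); [tauto|]. rewrite C0. lra.
        -- exists q. split; [lia|]. unfold B. destruct (Nat.eq_dec q (S m)); [lia|].
           destruct (Nat.eq_dec q q); [|tauto]. rewrite Rplus_0_l.
           apply Rmult_integral_contrapositive. split; auto. lra.
      * intros y [<-|Hy]; rewrite E.
        -- unfold c. field. auto.
        -- rewrite Z1, Z2 by auto. ring.
Qed.

(** * Orthogonality *)

Section NullPrimitive.
Context {a0 b0 : Rbar} {al be : R}.
Local Notation I := (in_open a0 b0).

(** The integral of [f] over the segment is zero. A primitive as witness dispenses with
    integrability arguments, and orthogonality provides one: the Wronskian. *)
Definition null_integral (f : R -> R) : Prop :=
  exists P : R -> R, (forall x, I x -> is_derive P x (f x)) /\ P al = 0 /\ P be = 0.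

Lemma null_integral_ext (f g : R -> R) :
  (forall x, I x -> f x = g x) -> null_integral f -> null_integral g.
Proof.
  intros E [P [H1 H2]]. exists P. split; auto. intros x Ix. rewrite <- E; auto.
Qed.

Lemma null_integral_comb (A : nat -> R) (F : nat -> R -> R) (N : nat) :
  (forall p, (1 <= p <= N)%nat -> A p <> 0 -> null_integral (F p)) -> null_integral (comb A F N).
Proof.
  induction N as [|N IH]; intros HF.
  - exists (fun _ => 0). split; auto. intros x _. apply @is_derive_const.
  - destruct IH as [P [H1 [H2 H3]]].
    { intros p Hp. apply HF. lia. }
    destruct (Req_dec (A (S N)) 0) as [E|E].
    + exists P. split; auto. intros x Ix. simpl. rewrite E, Rmult_0_l, Rplus_0_r. auto.
    + destruct (HF (S N)) as [Q [G1 [G2 G3]]]; auto; [lia|].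
      exists (fun x => P x + A (S N) * Q x).
      split; [|rewrite H2, H3, G2, G3; split; ring].
      intros x Ix. apply (is_derive_plus P (fun x => A (S N) * Q x)); auto.
      apply is_derive_scal. auto.
Qed.

Lemma null_integral_nonneg (f : R -> R) (s : R) : I al -> I be -> al < be ->
  null_integral f -> (forall x, al < x < be -> 0 <= s * f x) ->
  forall x, al < x < be -> s * f x = 0.
Proof.
  intros Ial Ibe Hab [P [HP [P1 P2]]] Hf x Hx.
  assert (Mono : forall y z, al <= y -> y < z -> z <= be -> s * P y <= s * P z).
  { intros y z Hy Hyz Hz.
    destruct (MVT_cor2 P f y z) as [c [E Hc]]; auto.
    - intros c Hc. apply is_derive_Reals, HP. apply (in_open_between al be); auto. lra.
    - assert (H0 : 0 <= s * f c * (z - y)) by (apply Rmult_le_pos; [apply Hf; lra|lra]).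
      replace (s * f c * (z - y)) with (s * P z - s * P y)
        in H0 by (rewrite Rmult_assoc, <- E; ring). lra. }
  assert (Z : forall y, al <= y <= be -> s * P y = 0).
  { intros y Hy. destruct (Req_dec y al) as [->|]; [rewrite P1; ring|].
    destruct (Req_dec y be) as [->|]; [rewrite P2; ring|].
    pose proof (Mono al y ltac:(lra) ltac:(lra) ltac:(lra)) as Q1.
    pose proof (Mono y be ltac:(lra) ltac:(lra) ltac:(lra)) as Q2.
    rewrite P1, Rmult_0_r in Q1. rewrite P2, Rmult_0_r in Q2. lra. }
  assert (Ix : I x) by (apply (in_open_between al be); auto; lra).
  assert (D : is_derive (fun t => s * P t) x (s * f x)) by (apply is_derive_scal; auto).
  rewrite <- (is_derive_unique _ _ _ D).
  apply (Derive_zero_on_segment (fun t => s * P t) al be); auto; [lra|]. eexists. exact D.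
Qed.

End NullPrimitive.
(** * The lower bound *)

Section LowerBound.
Context {a0 b0 : Rbar} {K G L : R -> R}.
Local Notation I := (in_open a0 b0).
Context (CK : Cinf a0 b0 K) (CG : Cinf a0 b0 G) (CL : Cinf a0 b0 L).
Context (K_pos : positive_on a0 b0 K) (G_pos : positive_on a0 b0 G) (L_pos : positive_on a0 b0 L).
Context {al be : R} (Ial : I al) (Ibe : I be) (al_lt_be : al < be).
Context {h H : Rbar} {rho : nat -> R}.
Context (rho_seq : eigenvalue_sequence a0 b0 al be K G L h H rho).
Context {phi0 gam : R} (phi0_range : 0 <= phi0 <= PI / 2) (gam_range : PI / 2 <= gam <= PI).
Context (left_bcE : forall V, left_bc al K h V <-> V al * cos phi0 = K al * Derive V al * sin phi0).
Context (right_bcE : forall V, right_bc be K H V <-> V be * cos gam = K be * Derive V be * sin gam).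
Context {V : nat -> R -> R}.
Context (V_eigen : forall j, (1 <= j)%nat -> eigenfunction a0 b0 al be K G L h H (rho j) (V j)).

Lemma eigenfunctions_orthogonal (p q : nat) : (1 <= p)%nat -> (1 <= q)%nat -> p <> q ->
  null_integral (a0 := a0) (b0 := b0) (al := al) (be := be) (fun x => G x * (V p x * V q x)).
Proof.
  intros Hp Hq Hpq. destruct rho_seq as [Hinc _].
  assert (Hrho : rho q - rho p <> 0).
  { destruct (Nat.lt_total p q) as [Hlt|[Heq|Hlt]]; [|tauto|].
    - assert (rho p < rho q) by (apply Hinc; auto). lra.
    - assert (rho q < rho p) by (apply Hinc; auto). lra. }
  pose proof (V_system K_pos V_eigen p Hp) as Sp. pose proof (V_system K_pos V_eigen q Hq) as Sq.
  exists (fun x => / (rho q - rho p) * (K x * Derive (V p) x * V q x - V p x * (K x * Derive (V q) x))).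
  split; [|split].
  - intros x Ix. destruct (Sp x Ix) as [D1 D2]. destruct (Sq x Ix) as [D3 D4].
    pose proof (K_pos x Ix) as Kx. evar_last.
    + apply is_derive_scal. apply @is_derive_minus; apply @is_derive_mult;
        [exact D2|exact D3|exact Rmult_comm|exact D1|exact D4|exact Rmult_comm].
    + unfold minus, plus, opp, mult; simpl. field. split; auto. lra.
  - rewrite (wronskian_zero phi0); [ring| |]; apply (V_left left_bcE V_eigen); auto.
  - rewrite (wronskian_zero gam); [ring| |]; apply (V_right right_bcE V_eigen); auto.
Qed.

Lemma combs_orthogonal (A B : nat -> R) (N M : nat) :
  (forall p q, (1 <= p <= N)%nat -> (1 <= q <= M)%nat -> A p <> 0 -> B q <> 0 -> p <> q) ->
  null_integral (a0 := a0) (b0 := b0) (al := al) (be := be)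
    (fun x => G x * (comb A V N x * comb B V M x)).
Proof.
  intros Hpq.
  apply (null_integral_ext (comb A (fun p x => comb B (fun q x => G x * (V p x * V q x)) M x) N)).
  - intros x _.
    assert (E : forall p, comb B (fun q x => G x * (V p x * V q x)) M x
              = V p x * (G x * comb B V M x)).
    { intros p. induction M as [|M IH]; simpl; [ring|]. rewrite IH; [ring|].
      intros p' q' Hp' Hq'. apply Hpq; auto. lia. }
    rewrite (comb_ext A (fun p => G x * comb B V M x * A p) _ V).
    + rewrite comb_scal. ring.
    + intros p _. rewrite E. ring.
  - apply null_integral_comb. intros p Hp Ap. apply null_integral_comb. intros q Hq Bq.
    apply eigenfunctions_orthogonal; try lia. apply Hpq; auto.
Qed.

(** With fewer than [m - 1] sign changes, some [W] spanned by [V 1, ..., V (m - 1)] would change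
    sign exactly at the same points: its zeros there are simple and there are no others, by the
    upper bound. Then [W * Y] has a constant sign, against the orthogonality of [W] and [Y]. *)
Lemma sign_changes_ge (A : nat -> R) (m n : nat) (zs : list R) (mu : R -> nat) :
  (forall p, (p < m)%nat -> A p = 0) ->
  StronglySorted Rlt zs ->
  (forall x, In x zs <-> al < x < be /\ comb A V n x = 0) ->
  (forall x, al < x < be -> vanish (mu x) (comb A V n) x /\ ~ vanish (S (mu x)) (comb A V n) x) ->
  (m <= S (length (filter (fun x => Nat.odd (mu x)) zs)))%nat.
Proof.
  intros HA HS Hzs Hmu. set (zo := filter (fun x => Nat.odd (mu x)) zs).
  destruct (Nat.le_gt_cases m (S (length zo))) as [|Hlt]; auto. exfalso.
  set (Y := comb A V n) in *.
  assert (CC : forall C N, Cinf a0 b0 (comb C V N)).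
  { intros C N. apply comb_Cinf. intros p Hp. apply (V_Cinf CK CG CL K_pos V_eigen). lia. }
  assert (HI : forall x, al <= x <= be -> I x) by (intros; apply (in_open_between al be); auto).
  assert (So : StronglySorted Rlt zo) by (apply sorted_filter; auto).
  assert (Ho : forall x, In x zo -> al < x < be).
  { intros x Hx. apply filter_In in Hx. destruct Hx as [Hx _]. apply Hzs in Hx. tauto. }
  assert (Hodd : forall x, al < x < be -> (In x zo <-> Nat.odd (mu x) = true)).
  { intros x Hx. unfold zo. rewrite filter_In. split; [tauto|]. intros E. split; auto.
    apply Hzs. split; auto. destruct (Hmu x Hx) as [E1 _].
    destruct (mu x); [discriminate|]. apply E1. }
  destruct (comb_vanishing_exists zo V) as [B [HB ZB]].
  set (W := comb B V (S (length zo))) in *.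
  assert (Bound : forall l M, chain W al l be -> (M <= total l)%nat -> (M < S (length zo))%nat).
  { intros l M Hl HM.
    apply (comb_zeros_lt CK CG CL K_pos G_pos L_pos Ial Ibe al_lt_be rho_seq phi0_range gam_range
             left_bcE right_bcE V_eigen B); auto.
    exists l, O, O. split; auto. repeat split; lia. }
  assert (W_simple : forall x, In x zo -> ~ vanish 2 W x).
  { intros x Hx H2. apply (Nat.lt_irrefl (S (length zo))).
    apply (Bound (map (fun y => (y, if Req_dec_T y x then 2%nat else 1%nat)) zo)).
    - apply (sorted_chain W (fun y => if Req_dec_T y x then 2%nat else 1%nat)); auto.
      intros y Hy. split; auto. destruct (Req_dec_T y x) as [->|]; auto.
      split; [apply ZB; auto|exact Logic.I].
    - apply total_one_double. auto. }
  assert (W_other : forall x, al < x < be -> ~ In x zo -> W x <> 0).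
  { intros x Hx Hn E. destruct (sorted_insert x zo So Hn) as [l [L1 [L2 L3]]].
    apply (Nat.lt_irrefl (S (length zo))).
    apply (Bound (map (fun y => (y, 1%nat)) l)).
    - apply (sorted_chain W (fun _ => 1%nat)); auto.
      intros y Hy. apply L3 in Hy. destruct Hy as [->|Hy].
      + split; auto. split; [auto|exact Logic.I].
      + split; [auto|]. split; [apply ZB; auto|exact Logic.I].
    - rewrite total_one. lia. }
  assert (Local : forall x, al < x < be -> exists d s, 0 < d /\ 0 <= s * (W x * Y x) /\
     forall t, t <> x -> x - d < t < x + d -> 0 < s * (W t * Y t)).
  { intros x Hx. assert (Ix : I x) by (apply HI; lra).
    destruct (Hmu x Hx) as [Y1 Y2].
    assert (HW : exists k, vanish k W x /\ ~ vanish (S k) W x /\ (-1) ^ k * (-1) ^ mu x = 1).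
    { rewrite pow_m1. destruct (excluded_middle_informative (In x zo)) as [E|E].
      - exists 1%nat. split; [split; [apply ZB; auto|exact Logic.I]|]. split; auto.
        apply Hodd in E; auto. rewrite pow_m1, E. simpl. ring.
      - exists O. split; [exact Logic.I|]. split; [intros [E1 _]; apply (W_other x); auto|].
        rewrite pow_m1. destruct (Nat.odd (mu x)) eqn:E2; [|simpl; ring].
        exfalso. apply E, Hodd; auto. }
    destruct HW as [k [W1 [W2 Hpar]]].
    destruct (sign_near_zero (a0 := a0) (b0 := b0) k W x (CC _ _) Ix W1 W2)
      as [d1 [s1 [D1 [S1 [R1 L1]]]]].
    destruct (sign_near_zero (a0 := a0) (b0 := b0) (mu x) Y x (CC _ _) Ix Y1 Y2)
      as [d2 [s2 [D2 [S2 [R2 L2]]]]].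
    pose proof (Rmin_l d1 d2) as M1. pose proof (Rmin_r d1 d2) as M2.
    exists (Rmin d1 d2), (s1 * s2). split; [apply Rmin_glb_lt; auto|]. split.
    - replace (s1 * s2 * (W x * Y x)) with (s1 * W x * (s2 * Y x)) by ring.
      apply Rmult_le_pos; auto.
    - intros t Hne Ht. destruct (Rlt_dec x t) as [Hxt|Hxt].
      + replace (s1 * s2 * (W t * Y t)) with (s1 * W t * (s2 * Y t)) by ring.
        apply Rmult_lt_0_compat; [apply R1|apply R2]; lra.
      + replace (s1 * s2 * (W t * Y t)) with ((-1) ^ k * (-1) ^ mu x * (s1 * s2 * (W t * Y t)))
          by (rewrite Hpar; ring).
        replace ((-1) ^ k * (-1) ^ mu x * (s1 * s2 * (W t * Y t)))
          with (s1 * (-1) ^ k * W t * (s2 * (-1) ^ mu x * Y t)) by ring.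
        apply Rmult_lt_0_compat; [apply L1|apply L2]; lra. }
  assert (Ex : exists t, al < t < be /\ W t * Y t <> 0).
  { destruct (Local ((al + be) / 2)) as [d [s [Hd [_ Hs]]]]; [lra|].
    set (t := (al + be) / 2 + Rmin (d / 2) ((be - al) / 4)).
    pose proof (Rmin_l (d / 2) ((be - al) / 4)). pose proof (Rmin_r (d / 2) ((be - al) / 4)).
    assert (0 < Rmin (d / 2) ((be - al) / 4)) by (apply Rmin_glb_lt; lra).
    exists t. split; [unfold t; lra|]. intros E.
    assert (P : 0 < s * (W t * Y t)) by (apply Hs; unfold t; lra).
    rewrite E in P. lra. }
  destruct Ex as [t [Ht Hne]].
  assert (Sign : forall x, al < x < be -> 0 <= (W t * Y t) * (W x * Y x)).
  { pose proof (locally_same_sign (fun x => W x * Y x) al be Local) as HL. simpl in HL.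
    intros x Hx. destruct (Rtotal_order t x) as [Hlt'|[->|Hgt]].
    - apply HL; lra.
    - apply Rle_0_sqr.
    - rewrite Rmult_comm. apply HL; lra. }
  assert (Orth : null_integral (a0 := a0) (b0 := b0) (al := al) (be := be)
                   (fun x => G x * (W x * Y x))).
  { apply combs_orthogonal. intros p q Hp Hq _ Aq ->. apply Aq, HA. lia. }
  assert (Z := null_integral_nonneg _ (W t * Y t) Ial Ibe al_lt_be Orth).
  assert (Gt : 0 < G t) by (apply G_pos, HI; lra).
  assert (E : W t * Y t * (G t * (W t * Y t)) = 0).
  { apply Z; auto. intros x Hx. assert (0 < G x) by (apply G_pos, HI; lra).
    replace (W t * Y t * (G x * (W x * Y x))) with (G x * (W t * Y t * (W x * Y x))) by ring.
    apply Rmult_le_pos; [lra|auto]. }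
  apply Rmult_integral in E. destruct E as [E|E]; auto.
  apply Rmult_integral in E. destruct E as [E|E]; auto. lra.
Qed.

End LowerBound.

Lemma comb_sum_n_m (A : nat -> R) (V : nat -> R -> R) (m n : nat) (x : R) : (1 <= m)%nat ->
  sum_n_m (fun p => A p * V p x) m n
  = comb (fun p => if Compare_dec.le_dec m p then A p else 0) V n x.
Proof.
  intros Hm. induction n as [|n IH].
  - rewrite sum_n_m_zero by lia. reflexivity.
  - cbn [comb]. rewrite <- IH. destruct (Compare_dec.le_dec m (S n)) as [Hle|Hgt].
    + rewrite sum_n_Sm by auto. reflexivity.
    + rewrite !sum_n_m_zero by lia. unfold zero; simpl. ring.
Qed.

Theorem theorem2p15
  (a0 b0 : Rbar) (alpha beta : R)
  (h_alpha : in_open a0 b0 alpha) (h_beta : in_open a0 b0 beta)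
  (h_lt : alpha < beta)
  (K G L : R -> R)
  (K_smooth : smooth_on a0 b0 K) (G_smooth : smooth_on a0 b0 G)
  (L_smooth : smooth_on a0 b0 L)
  (K_pos : positive_on a0 b0 K) (G_pos : positive_on a0 b0 G)
  (L_pos : positive_on a0 b0 L)
  (h H : Rbar) (h_ge0 : Rbar_le 0 h) (H_ge0 : Rbar_le 0 H)
  (rho : nat -> R)
  (rho_seq : eigenvalue_sequence a0 b0 alpha beta K G L h H rho)
  (V : nat -> R -> R)
  (V_eigen : forall j : nat, (1 <= j)%nat ->
     eigenfunction a0 b0 alpha beta K G L h H (rho j) (V j))
  (m n : nat) (m_ge1 : (1 <= m)%nat) (m_le_n : (m <= n)%nat)
  (A : nat -> R) (A_neq0 : sum_n_m (fun p => A p ^ 2) m n <> 0) :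
  let Y : R -> R := fun x => sum_n_m (fun p => A p * V p x) m n in
  exists (zs : list R) (mu : R -> nat),
    zeros_between alpha beta Y zs /\
    (forall x : R, alpha <= x <= beta -> has_multiplicity Y x (mu x)) /\
    N_v zs mu <= N_m zs mu <= N_m_bar alpha beta h H zs mu /\
    INR m - 1 <= N_v zs mu /\
    N_m_bar alpha beta h H zs mu <= INR n - 1.
Proof.
  intros Y.
  assert (CK : Cinf a0 b0 K) by (intros k; apply smooth_Ck; auto).
  assert (CG : Cinf a0 b0 G) by (intros k; apply smooth_Ck; auto).
  assert (CL : Cinf a0 b0 L) by (intros k; apply smooth_Ck; auto).
  destruct (left_bc_angle alpha h h_ge0) as [phi0 [phi0_range [Robin_l LB]]].
  destruct (right_bc_angle beta H H_ge0) as [gam [gam_range [Robin_r RB]]].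
  specialize (LB K). specialize (RB K).
  set (A' := fun p => if Compare_dec.le_dec m p then A p else 0).
  assert (EY : Y = comb A' V n).
  { apply functional_extensionality. intros x. apply comb_sum_n_m; auto. }
  assert (HA : exists p, (1 <= p <= n)%nat /\ A' p <> 0).
  { destruct (excluded_middle_informative (exists p, (m <= p <= n)%nat /\ A p <> 0))
      as [[p [Hp Ap]]|Hno].
    - exists p. split; [lia|]. unfold A'. destruct (Compare_dec.le_dec m p); [auto|lia].
    - exfalso. apply A_neq0. rewrite (sum_n_m_ext_loc _ (fun _ => zero)).
      + exact (@sum_n_m_const_zero _ m n).
      + intros p Hp. destruct (Req_dec (A p) 0) as [E|E].
        * rewrite E. unfold zero; simpl. ring.
        * exfalso. apply Hno. eauto. }
  clearbody Y. subst Y.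
  assert (Bound : forall M, reduced_zeros (al := alpha) (be := beta) (phi0 := phi0) (gam := gam)
             (comb A' V n) M -> (M < n)%nat).
  { intros M. apply (comb_zeros_lt CK CG CL K_pos G_pos L_pos h_alpha h_beta h_lt rho_seq
      phi0_range gam_range LB RB V_eigen A' n M HA). }
  assert (Mu : forall x, { k | alpha <= x <= beta ->
             vanish k (comb A' V n) x /\ ~ vanish (S k) (comb A' V n) x }).
  { intros x. apply constructive_indefinite_description.
    destruct (excluded_middle_informative (alpha <= x <= beta)) as [Hx|Hx].
    - destruct (comb_finite_order CK CG CL K_pos G_pos h_alpha h_beta h_lt rho_seq phi0_range gam_range
        V_eigen A' n x HA Hx)
        as [k Hk].
      destruct (exact_order _ _ _ Hk) as [j Hj]. exists j. auto.
    - exists O. tauto. }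
  set (mu := fun x => proj1_sig (Mu x)).
  assert (Hmu : forall x, alpha <= x <= beta ->
            vanish (mu x) (comb A' V n) x /\ ~ vanish (S (mu x)) (comb A' V n) x)
    by (intros x; apply (proj2_sig (Mu x))).
  clearbody mu.
  destruct (bounded_set_list (fun x => alpha < x < beta /\ comb A' V n x = 0) n) as [zs [Hs Hz]].
  { intros zs Hs Hz. apply Nat.lt_le_incl, Bound. exists (map (fun x => (x, 1%nat)) zs), O, O.
    split; [|rewrite total_one; repeat split; lia].
    apply (sorted_chain _ (fun _ => 1%nat)); auto. intros x Hx. destruct (Hz x Hx) as [H1 H2].
    split; auto. split; [auto|exact Logic.I]. }
  exists zs, mu. split; [split; auto|]. split; [|split; [|split]].
  - intros x Hx. destruct (Hmu x Hx). apply exact_order_multiplicity; auto.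
  - split; [apply N_v_le_N_m|]. unfold N_m_bar.
    assert (P : forall c k, 0 <= reduced_mult c k).
    { intros [c| |] k; simpl; try lra. pose proof (pos_INR k). lra. }
    pose proof (P h (mu alpha)). pose proof (P H (mu beta)). lra.
  - rewrite N_v_length.
    assert (Hge : (m <= S (length (filter (fun x => Nat.odd (mu x)) zs)))%nat).
    { apply (sign_changes_ge CK CG CL K_pos G_pos L_pos h_alpha h_beta h_lt rho_seq
        phi0_range gam_range LB RB V_eigen A' m n); auto.
      - intros p Hp. unfold A'. destruct (Compare_dec.le_dec m p); [lia|auto].
      - intros x Hx. apply Hmu. lra. }
    apply le_INR in Hge. rewrite S_INR in Hge. lra.
  - assert (End : forall c t x, in_open a0 b0 x -> alpha <= x <= beta ->
      (forall r, c = Finite r -> sin t <> 0) ->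
      (forall B, comb B V n x * cos t = K x * Derive (comb B V n) x * sin t) ->
      exists a, reduced_mult c (mu x) = INR a /\
        ((0 < a)%nat -> sin t <> 0 /\ vanish (2 * a) (comb A' V n) x)).
    { intros c t x Ix Hx Hc Hbc. destruct c as [r| |].
      2, 3: exists O; split; [reflexivity|lia].
      assert (Hs0 : sin t <> 0) by (apply (Hc r); auto). destruct (Hmu x Hx) as [M1 M2].
      destruct (Nat.Even_or_Odd (mu x)) as [[a Ha]|[a Ha]].
      - exists a. rewrite Ha in M1 |- *. split; auto. simpl. rewrite Nat.add_0_r, plus_INR. field.
      - exfalso. apply M2. rewrite Ha in M1 |- *. replace (S (2 * a + 1)) with (2 * a + 2)%nat by lia.
        apply (comb_even_order CK CG CL K_pos G_pos phi0_range gam_range V_eigen x t n a Ix Hs0 Hbc A'); auto. }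
    destruct (End h phi0 alpha) as [a [Ea Ha]]; auto; [lra| |].
    { intros B. apply (comb_left K_pos h_alpha LB V_eigen). }
    destruct (End H gam beta) as [b [Eb Hb]]; auto; [lra| |].
    { intros B. apply (comb_right K_pos h_beta RB V_eigen). }
    unfold N_m_bar. rewrite N_m_total, Ea, Eb, <- !plus_INR.
    assert (Hlt : (total (map (fun x => (x, mu x)) zs) + a + b < n)%nat).
    { apply Bound. exists (map (fun x => (x, mu x)) zs), a, b. split; [|auto].
      apply sorted_chain; auto. intros x Hx. apply Hz in Hx. split; [tauto|]. apply Hmu. lra. }
    apply le_INR in Hlt. rewrite S_INR in Hlt. lra.
Qed.
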